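(* Let $0\le k\le n$, $n\ge1$. For Young diagrams $\lambda,\mu$ in the $k\times(n-k)$ rectangle, let $d^{\lambda,\mu}_\nu(\vec y)$ be the coefficients defined by the identity in $K_T(Gr(k,n))$ $$G^\lambda(\bar x;\vec y)\,G^\mu(\bar x;\overleftarrow{y})=\sum_\nu d^{\lambda,\mu}_\nu(\vec y)\,G^\nu(\bar x;\overleftarrow{y}),$$ where $\nu$ runs over Young diagrams in the $k\times(n-k)$ rectangle. Then $d^{\lambda,\mu}_\nu(\vec y)$ equals the sum of the modified weights of all equivariant puzzles in an up-pointing equilateral triangle of side $n$ whose boundary is as follows: the right side, read from the top corner to the bottom-right corner, encodes $\lambda$; the bottom horizontal side, read from right to left, encodes $\mu$; the left side, read from the top corner to the bottom-left corner, encodes $\nu$. Here the parameter of an elementary lozenge is $w=y_i/y_j$, where, numbering the unit edges of the bottom side $1,\dots,n$ from left to right, $j$ is the number of the bottom edge reached from the centre of the lozenge by going straight down-left (direction $240^\circ$), and $i$ is the number of the bottom edge reached from the centre by going straight down-right (direction $300^\circ$); thus $1\le j<i\le n$.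
   Context: **Young diagrams.** Fix $0\le k\le n$. A Young diagram $\lambda$ (English convention) in the $k\times(n-k)$ rectangle ($k$ rows, $n-k$ columns) is encoded by its frame, a $k$-subset of $\{1,\dots,n\}$: follow the border of $\lambda$ from the bottom-left to the top-right corner of the rectangle in $n$ unit steps (up or right), and record $i$ if the $i$-th step is up. So $\varnothing$ has frame $\{1,\dots,k\}$ and the full rectangle has frame $\{n-k+1,\dots,n\}$. **Polynomials.** Let $\bar x=(x_1,\dots,x_k)$, $\vec y=(y_1,\dots,y_n)$, $\overleftarrow{y}=(y_n,\dots,y_1)$. The double Grothendieck polynomials $G^\lambda(\bar x;\vec y)$ are defined inductively by $G^{\{n-k+1,\dots,n\}}(\bar x;\vec y)=\prod_{i=1}^k\prod_{j=1}^{n-k}(1-x_i/y_j)$ and $G^\mu=D_iG^\lambda$ whenever the frame of $\mu$ is obtained from that of $\lambda$ by replacing $i+1$ with $i$, where $D_if=\dfrac{y_if(\ldots,y_i,y_{i+1},\ldots)-y_{i+1}f(\ldots,y_{i+1},y_i,\ldots)}{y_i-y_{i+1}}$ acts on the $y$ variables. $G^\lambda(\bar x;\overleftarrow{y})$ is obtained from $G^\lambda(\bar x;\vec y)$ by substituting $y_i\mapsto y_{n+1-i}$. **Ring.** $K_T(Gr(k,n))$ is the quotient of $\mathbb Z[x_1^{\pm1},\dots,x_k^{\pm1},y_1^{\pm1},\dots,y_n^{\pm1}]^{\mathcal S_k}$ ($\mathcal S_k$ permuting the $x_i$) by the ideal of elements that vanish whenever $(x_1,\dots,x_k)$ is specialized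 to $(y_{i_1},\dots,y_{i_k})$ for any $i_1<\dots<i_k$. It is known that the classes of the $G^\lambda(\bar x;\vec y)$ (equally, of the $G^\lambda(\bar x;\overleftarrow{y})$) form a $\mathbb Z[y_1^{\pm1},\dots,y_n^{\pm1}]$-basis. **Equivariant puzzles.** Consider the triangular lattice of unit equilateral triangles with horizontal edges. Each unit triangle has a horizontal edge $h$, an edge $a$ in direction $60^\circ/240^\circ$ and an edge $b$ in direction $120^\circ/300^\circ$; for an up-pointing triangle $a$ is the left and $b$ the right edge; for a down-pointing triangle $a$ is the right and $b$ the left edge. Each edge has a state, a subset of $\{R,G\}$ (red, green), written $\emptyset,R,G,RG$. The allowed tiles, given by the states $(h,a,b)$, are $E=(\emptyset,\emptyset,\emptyset)$, $G_1=(G,G,\emptyset)$, $G_2=(G,RG,R)$, $R_1=(R,\emptyset,R)$, $R_2=(R,G,RG)$, $Q=(RG,G,R)$ (equivariant tile), for both up- and down-pointing triangles, and the $K$-tile $K=(\emptyset,RG,RG)$ for up-pointing triangles only. An equivariant puzzle in a domain is an assignment of an allowed tile to every unit triangle of the domain such that triangles sharing an edge assign it the same state. **Boundary conditions.** Horizontal boundary edges must be in state $R$ or $G$; boundary edges in direction $60^\circ/240^\circ$ in state $G$ or $\emptyset$; boundary edges in direction $120^\circ/300^\circ$ in state $R$ or $\emptyset$. A side of length $n$, read in a given direction, encodes the Young diagram whose frame is the set of positions (numbered $1,\dots,n$ along the reading direction) of the $G$ edges for horizontal and $60^\circ/240^\circ$ sides, and of the $\emptyset$ edges for $120^\circ/300^\circ$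 sides. **Modified weights.** An elementary lozenge is the union of an up-pointing unit triangle and the down-pointing unit triangle just below it, sharing a horizontal edge, both in the domain. Its modified weight depends on a parameter $w$ (depending on its location) and on its (upper tile, lower tile): $(G_2,G_1)$ has weight $w$; $(R_1,R_2)$ has weight $w$; $(Q,Q)$ has weight $1-w$; $(K,E)$ has weight $-1$; all the others, $(G_1,G_1),(G_1,G_2),(G_2,G_2),(R_1,R_1),(R_2,R_1),(R_2,R_2),(E,E)$, have weight $1$. The modified weight of an equivariant puzzle is the product of the modified weights of all its elementary lozenges (unit triangles not belonging to an elementary lozenge contribute no factor). *)

(* Defs.v *)
From HB Require Import structures.
From mathcomp Require Import all_boot all_order all_fingroup all_algebra.
From mathcomp Require Import ring.
From mathcomp Require Import mpoly.
From Stdlib Require Import ClassicalEpsilon.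

Set Implicit Arguments.
Unset Strict Implicit.
Unset Printing Implicit Defensive.

Import GRing.Theory.
Local Open Scope ring_scope.

(* All the Laurent polynomial rings are realized as subsets of the field
   Q(x_1, .., x_k, y_1, .., y_n).  Every index is 0-based: the mathematical
   x_i, y_i and frame element i are the ones of ordinal value i - 1 below. *)
Notation ratfun k n := {fraction {mpoly int[k + n]}}.

Definition ratvar m (v : 'I_m) : {fraction {mpoly int[m]}} :=
  FracField.tofrac 'X_v.
Definition xvar k n (a : 'I_k) : ratfun k n := ratvar (lshift n a).
Definition yvar k n (j : 'I_n) : ratfun k n := ratvar (rshift k j).

Definition polyeval m (F : fieldType) (v : 'I_m -> F) (p : {mpoly int[m]}) : F :=
  mmap intr v p.

(* The value at v of the rational function f, computed from any fraction p / q
   representing f whose denominator does not vanish at v; it does not depend on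
   the choice of p / q, see rateval_frac.  If there is no such fraction, the
   value is unspecified. *)
Definition rateval m (F : fieldType) (v : 'I_m -> F)
    (f : {fraction {mpoly int[m]}}) : F :=
  epsilon (inhabits 0) (fun r : F => exists p q : {mpoly int[m]},
    [/\ polyeval v q != 0,
        f = FracField.tofrac p / FracField.tofrac q
      & r = polyeval v p / polyeval v q]).

Lemma polyeval_ratvar m (s : 'S_m) (p : {mpoly int[m]}) :
  polyeval (fun v => ratvar (s v)) p = FracField.tofrac (msym s p).
Proof.
rewrite /polyeval /msym /mmap rmorph_sum; apply: eq_bigr => e _ /=.
rewrite rmorphM; congr (_ * _).
  by rewrite -[in RHS](intz (p@_e)) !rmorph_int.
by rewrite /mmap1 rmorph_prod; apply: eq_bigr => i _; rewrite rmorphXn.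
Qed.

Lemma ratfrac m (f : {fraction {mpoly int[m]}}) :
  exists p q : {mpoly int[m]},
    q != 0 /\ f = FracField.tofrac p / FracField.tofrac q.
Proof.
exists \n_(generic_quotient.repr f), \d_(generic_quotient.repr f).
split; first exact: denom_ratioP.
rewrite -[LHS]generic_quotient.reprK; unlock FracField.tofrac.
rewrite -[X in _ = _ * X]FracField.pi_inv -[RHS]FracField.pi_mul.
rewrite /FracField.mulf /FracField.invf.
by rewrite !numden_Ratio ?oner_neq0 ?denom_ratioP // mulr1 mul1r Ratio_numden.
Qed.

Section RatevalTheory.
Variables (m : nat) (F : fieldType) (v : 'I_m -> F).
Implicit Types (p q : {mpoly int[m]}) (f g : {fraction {mpoly int[m]}}).

Lemma rateval_frac p q : polyeval v q != 0 ->
  rateval v (FracField.tofrac p / FracField.tofrac q)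
  = polyeval v p / polyeval v q.
Proof.
move=> q0; rewrite /rateval; set P := (P in epsilon _ P).
have: P (epsilon (inhabits 0) P) by apply: epsilon_spec; exists (polyeval v p / polyeval v q), p, q.
move: (epsilon _ _) => r [p' [q' [q'0 e ->]]].
have nz (t : {mpoly int[m]}) : polyeval v t != 0 -> FracField.tofrac t != 0.
  by apply: contraNneq => /eqP; rewrite tofrac_eq0 => /eqP->; rewrite /polyeval mmap0.
move/eqP: e; rewrite eqr_div ?nz // -!tofracM tofrac_eq => /eqP e.
by apply/eqP; rewrite eqr_div // /polyeval -!rmorphM -e.
Qed.

Hypothesis v_inj : forall q, q != 0 -> polyeval v q != 0.

Lemma ratevalM f g : rateval v (f * g) = rateval v f * rateval v g.
Proof.
have [p [q [q0 ->]]] := ratfrac f; have [p' [q' [q'0 ->]]] := ratfrac g.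
rewrite mulf_div -!tofracM !rateval_frac ?v_inj ?mulf_neq0 //.
by rewrite /polyeval !rmorphM mulf_div.
Qed.

Lemma ratevalB f g : rateval v (f - g) = rateval v f - rateval v g.
Proof.
have [p [q [q0 ->]]] := ratfrac f; have [p' [q' [q'0 ->]]] := ratfrac g.
rewrite -mulNr -tofracN addf_div ?tofrac_eq0 // -!tofracM -tofracD.
rewrite !rateval_frac ?v_inj ?mulf_neq0 //.
by rewrite /polyeval rmorphD !rmorphM rmorphN -[X in _ = _ + X]mulNr addf_div // v_inj.
Qed.

Lemma ratevalV f : rateval v f^-1 = (rateval v f)^-1.
Proof.
have [p [q [q0 ->]]] := ratfrac f.
have [->|p0] := eqVneq p 0.
  have r0 : rateval v 0 = 0.
    have := @rateval_frac 0 1; rewrite tofrac0 mul0r => -> //.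
      by rewrite /polyeval rmorph0 mul0r.
    by apply: v_inj; exact: oner_neq0.
  by rewrite tofrac0 mul0r invr0 r0 invr0.
by rewrite invf_div !rateval_frac ?v_inj // invf_div.
Qed.

Lemma rateval_var i : rateval v (ratvar i) = v i.
Proof.
have q1 : polyeval v 1 = 1 by rewrite /polyeval rmorph1.
have := @rateval_frac 'X_i 1; rewrite q1 oner_neq0 tofrac1 !divr1 => -> //.
by rewrite /polyeval mmapX mmap1U.
Qed.

End RatevalTheory.

(* Substitution of x a for x_a and y j for y_j. *)
Definition subst k n (x : 'I_k -> ratfun k n) (y : 'I_n -> ratfun k n)
    (f : ratfun k n) : ratfun k n :=
  rateval (fun v => match split v with inl a => x a | inr j => y j end) f.

(* f belongs to Z[v_1^{+-1}, .., v_m^{+-1}]; all the v_i are meant to be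
   nonzero. *)
Definition laurent m (F : fieldType) (v : 'I_m -> F) (f : F) : Prop :=
  exists (p : {mpoly int[m]}) (e : 'X_{1..m}),
    f = polyeval v p / \prod_(i < m) v i ^+ e i.

Lemma divdiffC_field (F : fieldType) (a b c d f f12 f1 f2 : F) :
  a - b != 0 -> c - d != 0 ->
  (a * ((c * f - d * f2) / (c - d)) - b * ((c * f1 - d * f12) / (c - d))) / (a - b)
  = (c * ((a * f - b * f1) / (a - b)) - d * ((a * f2 - b * f12) / (a - b))) / (c - d).
Proof. by move=> ab cd; field; rewrite ab cd. Qed.

Section Grothendieck.
Variables k n : nat.
Local Notation x := (@xvar k n).
Local Notation y := (@yvar k n).
Implicit Types (f : ratfun k n) (lam mu : {set 'I_n}).

(* The operator D_i, where j is meant to be i + 1. *)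
Definition divdiff (i j : 'I_n) f : ratfun k n :=
  (y i * f - y j * subst x (fun l => y (tperm i j l)) f) / (y i - y j).

Definition yrev f : ratfun k n := subst x (fun l => y (rev_ord l)) f.

Definition top_frame : {set 'I_n} := [set j : 'I_n | (n - k <= j)%N].

Definition top_groth : ratfun k n :=
  \prod_(a < k) \prod_(j < n | (j < n - k)%N) (1 - x a / y j).

(* lam with j replaced by i *)
Definition replace_elt lam (j i : 'I_n) : {set 'I_n} := i |: (lam :\ j).

(* With ij = (i, i + 1), mu is obtained from a frame by replacing i + 1 with i *)
Definition addable mu (ij : 'I_n * 'I_n) : bool :=
  [&& val ij.2 == ij.1.+1, ij.1 \in mu & ij.2 \notin mu].

Fixpoint groth_rec (m : nat) mu : ratfun k n :=
  if m is m'.+1 then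
    if [pick ij | addable mu ij] is Some ij
    then divdiff ij.1 ij.2 (groth_rec m' (replace_elt mu ij.1 ij.2))
    else top_groth
  else top_groth.

(* G^mu, for a k-subset mu, computed along one chain of frames from mu to
   top_frame (whose length is at most k * n).  By groth_top and groth_step it
   satisfies all the relations defining the family inductively, so the choice
   of the chain is immaterial. *)
Definition groth mu : ratfun k n := groth_rec (k * n)%N mu.

Lemma msym_nz (s : 'S_(k + n)) (q : {mpoly int[k + n]}) :
  q != 0 -> msym s q != 0.
Proof.
by apply: contraNneq => e; apply/eqP/(inj_msym s); rewrite e msym0.
Qed.

Section Swap.
Variables i j : 'I_n.

Definition swap_val (v : 'I_(k + n)) : ratfun k n :=
  match split v with inl a => x a | inr l => y (tperm i j l) end.
Definition swap_perm : 'S_(k + n) := tperm (rshift k i) (rshift k j).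

Lemma swap_polyeval p : polyeval swap_val p = FracField.tofrac (msym swap_perm p).
Proof.
rewrite -polyeval_ratvar /polyeval /mmap; apply: eq_bigr => e _.
congr (_ * _); apply: eq_bigr => v _; congr (_ ^+ _); rewrite /swap_val /swap_perm.
case: (splitP v) => [a|l] e'.
  have -> : v = lshift n a by apply: val_inj.
  by rewrite tpermD // eq_rlshift.
have -> : v = rshift k l by apply: val_inj.
by rewrite /yvar inj_tperm //; exact: rshift_inj.
Qed.

Lemma swap_nz q : q != 0 -> polyeval swap_val q != 0.
Proof. by move=> q0; rewrite swap_polyeval tofrac_eq0 msym_nz. Qed.

Lemma swapM f g :
  rateval swap_val (f * g) = rateval swap_val f * rateval swap_val g.
Proof. exact: (ratevalM swap_nz). Qed.

Lemma swapB f g :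
  rateval swap_val (f - g) = rateval swap_val f - rateval swap_val g.
Proof. exact: (ratevalB swap_nz). Qed.

Lemma swapV f : rateval swap_val f^-1 = (rateval swap_val f)^-1.
Proof. exact: (ratevalV swap_nz). Qed.

Lemma swap_y l : rateval swap_val (y l) = y (tperm i j l).
Proof.
rewrite rateval_var.
by rewrite /swap_val -[rshift k l]/(unsplit (inr l)) unsplitK.
Qed.

End Swap.

Lemma swapC i j i' j' f : i' != i -> i' != j -> j' != i -> j' != j ->
  rateval (swap_val i j) (rateval (swap_val i' j') f)
  = rateval (swap_val i' j') (rateval (swap_val i j) f).
Proof.
move=> ii ij ji jj; have [p [q [q0 ->]]] := ratfrac f.
rewrite !rateval_frac ?swap_nz // !swap_polyeval.
rewrite !rateval_frac ?swap_nz ?msym_nz // !swap_polyeval -!msymMm.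
suff -> : (swap_perm i' j' * swap_perm i j = swap_perm i j * swap_perm i' j')%g by [].
rewrite conjgC; congr (_ * _)%g; rewrite /swap_perm tpermJ.
by rewrite !tpermD // (inj_eq (@rshift_inj _ _)) eq_sym.
Qed.

Lemma yvar_inj : injective y.
Proof.
move=> i j /eqP; rewrite tofrac_eq => /eqP/(congr1 (mcoeff U_(rshift k i))).
rewrite !mcoeffX eqxx eq_mnm1 eq_rshift; case: eqP => [->//|_] /eqP.
by rewrite oner_eq0.
Qed.

Lemma divdiffE i j f : divdiff i j f =
  (y i * f - y j * rateval (swap_val i j) f) / (y i - y j).
Proof. by []. Qed.

Lemma divdiffC i j i' j' f :
  i != j -> i' != j' -> i' != i -> i' != j -> j' != i -> j' != j ->
  divdiff i j (divdiff i' j' f) = divdiff i' j' (divdiff i j f).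
Proof.
move=> nij nij' ii ij ji jj; rewrite !divdiffE.
rewrite !(swapM, swapB, swapV, swap_y).
have y0 u v : u != v -> y u - y v != 0.
  by move=> uv; rewrite subr_eq0 (inj_eq yvar_inj).
rewrite (tpermD (z := i')) 1?eq_sym // (tpermD (z := j')) 1?eq_sym //.
rewrite (tpermD (z := i)) // (tpermD (z := j)) // swapC //.
exact: (divdiffC_field _ _ _ _ (y0 _ _ nij) (y0 _ _ nij')).
Qed.

Lemma replace_eltC mu (ij ij' : 'I_n * 'I_n) :
  addable mu ij -> addable mu ij' -> ij != ij' ->
  [/\ [/\ ij.1 != ij.2, ij'.1 != ij'.2, ij'.1 != ij.1 & ij'.1 != ij.2],
     ij'.2 != ij.1 /\ ij'.2 != ij.2,
     addable (replace_elt mu ij.1 ij.2) ij', addable (replace_elt mu ij'.1 ij'.2) ij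
   & replace_elt (replace_elt mu ij.1 ij.2) ij'.1 ij'.2 = replace_elt (replace_elt mu ij'.1 ij'.2) ij.1 ij.2].
Proof.
case: ij ij' => i j [i' j'] /and3P[/= /eqP ej im jm] /and3P[/= /eqP ej' im' jm'].
rewrite xpair_eqE => ne.
have nij : i != j by apply: contraNneq jm => <-.
have nij' : i' != j' by apply: contraNneq jm' => <-.
have ij : i' != j by apply: contraNneq jm => <-.
have ji : j' != i by apply: contraNneq jm' => ->.
have ii : i' != i.
  apply: contraNneq ne => e; rewrite e eqxx /=; apply/eqP/val_inj.
  by rewrite /= ej ej' e.
have jj : j' != j.
  apply: contraNneq ii => e; apply/eqP/val_inj/eqP.
  by rewrite -eqSS -ej -ej' e.
split=> //.
- by rewrite /addable /replace_elt /= ej' eqxx !inE (negPf ij) ii im' (negPf jj) (negPf ji) (negPf jm').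
- rewrite /addable /replace_elt /= ej eqxx !inE ![i == _]eq_sym ![j == _]eq_sym.
  by rewrite (negPf ji) ii im (negPf jj) (negPf ij) (negPf jm) /=.
apply/setP => l; rewrite !inE.
have [->|_] := eqVneq l j'; first by rewrite (negPf jj) (negPf ji) /= ?orbT.
have [->|_] := eqVneq l j; first by rewrite ![j == _]eq_sym (negPf ij).
by rewrite andbCA.
Qed.

Let height mu := (\sum_(l in mu) (n - l))%N.

Lemma height_replace mu ij : addable mu ij -> (height (replace_elt mu ij.1 ij.2) < height mu)%N.
Proof.
case: ij => i j /and3P[/= /eqP ej im jm]; rewrite /height /replace_elt.
rewrite big_setU1 /=; last by rewrite !inE negb_and jm orbT.
by rewrite [X in (_ < X)%N](big_setD1 i) //= ltn_add2r ej subnSK.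
Qed.

Lemma groth_rec_fuel m mu : (height mu <= m)%N -> groth_rec m mu = groth_rec m.+1 mu.
Proof.
elim: m mu => [|m IH] mu hm.
  rewrite /=; case: pickP => // ij /height_replace.
  by rewrite ltnNge (leq_trans hm).
rewrite [LHS]/= [RHS]/=; case: pickP => // ij /height_replace h.
by rewrite IH // -ltnS (leq_trans h).
Qed.

Lemma groth_rec_step m mu ij : (height mu <= m.+1)%N -> addable mu ij ->
  groth_rec m.+1 mu = divdiff ij.1 ij.2 (groth_rec m (replace_elt mu ij.1 ij.2)).
Proof.
elim: m mu ij => [|m IH] mu ij hm a.
  rewrite /=; case: pickP => [ij' a'|/(_ ij)]; last by rewrite a.
  have [->//|ne] := eqVneq ij ij'.
  have [_ _ /height_replace h _ _] := replace_eltC a a' ne.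
  have h' := height_replace a.
  by move: (leq_trans h' hm) h; rewrite ltnS leqn0 => /eqP->.
rewrite [LHS]/=; case: pickP => [ij' a'|/(_ ij)]; last by rewrite a.
have [->//|ne] := eqVneq ij ij'.
have [[? ? ? ?] [? ?] a1 a2 e] := replace_eltC a a' ne.
rewrite -/(groth_rec m.+1 _) (IH _ ij) //; last first.
  by rewrite -ltnS (leq_trans (height_replace a')).
rewrite -/(groth_rec m.+1 _) (IH _ ij') //; last first.
  by rewrite -ltnS (leq_trans (height_replace a)).
by rewrite -e divdiffC // eq_sym.
Qed.

Lemma groth_top : groth top_frame = top_groth.
Proof.
rewrite /groth; case: (k * n)%N => //= m; case: pickP => // ij.
case/and3P => /eqP e; rewrite !inE => h; rewrite -ltnNge [nat_of_ord _]e => h'.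
by have := leq_trans h' h; rewrite ltnNge leqnSn.
Qed.

Lemma groth_step lam (i j : 'I_n) :
  #|lam| = k -> val j = i.+1 -> j \in lam -> i \notin lam ->
  groth (replace_elt lam j i) = divdiff i j (groth lam).
Proof.
move=> clam ej jl il; set mu := replace_elt lam j i.
have nij : i != j by apply: contraNneq il => ->.
have a : addable mu (i, j).
  by rewrite /addable /mu /replace_elt /= ej !inE !eqxx /= eq_sym negb_or nij.
have e : replace_elt mu i j = lam.
  apply/setP => l; rewrite /mu /replace_elt !inE.
  have [->|_] := eqVneq l j; first by rewrite jl.
  by have [->|] := eqVneq l i; rewrite ?(negPf il).
have cmu : #|mu| = k.
  by rewrite /mu /replace_elt cardsU1 !inE (negPf il) andbF -clam [in RHS](cardsD1 j) jl.
have hmu : (height mu <= k * n)%N.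
  by rewrite -cmu -sum_nat_const; apply: leq_sum => l _; exact: leq_subr.
have hlam := height_replace a; rewrite /= e in hlam.
have k0 : (0 < k * n)%N by apply: leq_trans hmu; exact: leq_ltn_trans hlam.
have hl : (height lam <= (k * n).-1)%N by rewrite -ltnS prednK // (leq_trans hlam).
move: hmu; rewrite /groth -(prednK k0) => hmu.
by rewrite (groth_rec_step hmu a) [replace_elt _ _ _]e -(groth_rec_fuel hl).
Qed.

Definition KT_ring f : Prop :=
  laurent (@ratvar (k + n)) f /\
  forall s : 'S_k, subst (fun a => x (s a)) y f = f.

Definition KT_ideal f : Prop :=
  KT_ring f /\
  forall i : 'I_k -> 'I_n, (forall a b : 'I_k, (a < b)%N -> (i a < i b)%N) ->
    subst (fun a => y (i a)) y f = 0.

(* f and g are elements of the invariant ring with the same class in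
   K_T(Gr(k,n)) *)
Definition KT_eq f g : Prop := [/\ KT_ring f, KT_ring g & KT_ideal (f - g)].

End Grothendieck.

(* An edge state is the pair (contains R, contains G). *)
Definition state : Type := (bool * bool)%type.
Definition sO : state := (false, false).
Definition sR : state := (true, false).
Definition sG : state := (false, true).
Definition sRG : state := (true, true).

Inductive tile := tE | tG1 | tG2 | tR1 | tR2 | tQ | tK.

Definition tile_code (t : tile) : 'I_7 :=
  inord (match t with
         | tE => 0 | tG1 => 1 | tG2 => 2 | tR1 => 3 | tR2 => 4 | tQ => 5 | tK => 6
         end).
Definition tile_decode (c : 'I_7) : tile :=
  nth tE [:: tE; tG1; tG2; tR1; tR2; tQ; tK] c.
Lemma tile_codeK : cancel tile_code tile_decode.
Proof. by case; rewrite /tile_decode inordK. Qed.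
HB.instance Definition _ := Finite.copy tile (can_type tile_codeK).

Definition tile_states (t : tile) : state * state * state :=
  match t with
  | tE  => (sO,  sO,  sO)
  | tG1 => (sG,  sG,  sO)
  | tG2 => (sG,  sRG, sR)
  | tR1 => (sR,  sO,  sR)
  | tR2 => (sR,  sG,  sRG)
  | tQ  => (sRG, sG,  sR)
  | tK  => (sO,  sRG, sRG)
  end.
Definition hstate (t : tile) : state := (tile_states t).1.1.
Definition astate (t : tile) : state := (tile_states t).1.2.
Definition bstate (t : tile) : state := (tile_states t).2.

Section Puzzles.
Variable n : nat.

(* Lattice points have coordinates (p, q) along the directions of angles 0 and
   60 degrees, the origin being the bottom-left corner of the big triangle.
   uptri is the set of up-pointing unit triangles, (p, q) standing for the one
   with vertices (p, q), (p + 1, q), (p, q + 1).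
   downtri is the set of down-pointing unit triangles, (p, q) standing for the
   one just below the up-pointing triangle (p, q), with vertices (p, q),
   (p + 1, q), (p + 1, q - 1); thus it also indexes elementary lozenges. *)
Definition uptri := {pq : 'I_n * 'I_n | (pq.1 + pq.2 < n)%N}.
Definition downtri := {u : uptri | (0 < (val u).2)%N}.

Definition puzzle_filling : Type := {ffun uptri -> tile} * {ffun downtri -> tile}.

Definition above (v : downtri) : uptri := val v.

Definition is_puzzle (P : puzzle_filling) : bool :=
  [&& [forall v : downtri, P.2 v != tK],
      [forall v : downtri, hstate (P.2 v) == hstate (P.1 (above v))],
      [forall v : downtri, forall u : uptri,
        ((val u).1 == (val (above v)).1) && ((val u).2.+1 == (val (above v)).2 :> nat)
          ==> (bstate (P.2 v) == bstate (P.1 u))]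
    & [forall v : downtri, forall u : uptri,
        ((val u).1 == (val (above v)).1.+1 :> nat) &&
        ((val u).2.+1 == (val (above v)).2 :> nat)
          ==> (astate (P.2 v) == astate (P.1 u))]].

(* Boundary edges are edges of up-pointing triangles.  For u = (p, q), the
   bottom side consists of the horizontal edges with q = 0, the left side of the
   a-edges with p = 0, and the right side of the b-edges with p + q = n - 1. *)
Definition has_boundary (lam mu nu : {set 'I_n}) (P : puzzle_filling) : bool :=
  [&& [forall u : uptri, ((val u).1 + (val u).2 == n.-1)%N ==>
        (bstate (P.1 u) == if (val u).1 \in lam then sO else sR)],
      [forall u : uptri, ((val u).2 == 0%N :> nat) ==>
        (hstate (P.1 u) == if rev_ord (val u).1 \in mu then sG else sR)]
    & [forall u : uptri, ((val u).1 == 0%N :> nat) ==>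
        (astate (P.1 u) == if rev_ord (val u).2 \in nu then sG else sO)]].

(* The pairs of tiles not listed have weight 1 *)
Definition lozenge_weight (R : pzRingType) (w : R) (upper lower : tile) : R :=
  match upper, lower with
  | tG2, tG1 => w
  | tR1, tR2 => w
  | tQ, tQ => 1 - w
  | tK, tE => -1
  | _, _ => 1
  end.

(* The centre of the lozenge (p, q) is the midpoint of (p, q) and (p + 1, q);
   the lines of directions 240 and 300 degrees from it meet the bottom side in
   its edges number p + 1 and p + q + 1. *)
Definition left_foot (v : downtri) : 'I_n := (val (above v)).1.
Definition right_foot (v : downtri) : 'I_n := Ordinal (valP (above v)).

Definition puzzle_weight (F : fieldType) (y : 'I_n -> F) (P : puzzle_filling) : F :=
  \prod_(v : downtri)
     lozenge_weight (y (right_foot v) / y (left_foot v)) (P.1 (above v)) (P.2 v).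

Definition puzzle_sum (F : fieldType) (y : 'I_n -> F) (lam mu nu : {set 'I_n}) : F :=
  \sum_(P : puzzle_filling | is_puzzle P && has_boundary lam mu nu P)
     puzzle_weight y P.

End Puzzles.

(* Main.v *)
(** Read the puzzles of the statement as a vertex model: the lozenge is a vertex
    where a line of parameter y_i entering from the left side crosses a line of
    parameter y_j reflected by the bottom side.  This model satisfies Yang-Baxter
    equations, so that exchanging y_i and y_{i+1} in the puzzle sum amounts to
    acting on the three boundary words with R-matrices.  The same R-matrices
    express how y_i <-> y_{i+1} acts on the double Grothendieck polynomials
    (this is the operator D_i in disguise).  Hence, x being fixed, the identity
      sum_nu d_nu(y) G^nu(x; rev y) = G^lam(x; y) G^mu(x; rev y)
    for a given y implies the identity with y_i and y_{i+1} exchanged, and it is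
    enough to prove it when x consists of the last k variables y.  Then
    G^nu(x; rev y) vanishes unless nu is empty, and the puzzles whose left side
    encodes the empty diagram degenerate to products of R-matrices that compute
    G^lam(x; y).  This gives the identity at all fixed points, and G^nu is
    triangular with respect to the fixed points, so that the coefficients are
    unique. *)

Require Import Defs.
From mathcomp Require Import all_boot all_order all_fingroup all_algebra.
From mathcomp Require Import ring.
From mathcomp Require Import mpoly.
From Stdlib Require Import FunctionalExtensionality.

Set Implicit Arguments.
Unset Strict Implicit.
Unset Printing Implicit Defensive.

Import GRing.Theory.
Local Open Scope ring_scope.

(** The argument runs on a list of parameters rather than on the variables [y]: a fixed point
    selects [k] entries of the list, and swapping two neighbours leads to another fixed point while
    [x] stays put. Two transfers make up the exchange step. Since [Rh] is the transpose of [Ra] on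
    the states [O] and [G], the sum over left words moves the R-matrix from [G^nu] onto the puzzle;
    Yang-Baxter then carries it to the two other words, where it is exactly the action on [G^lam]
    and [G^mu]. Matrices are written as functionals: a vertex with given incoming states takes a
    function of the outgoing ones. Local identities become finite case checks closed by [ring] or
    [field], with no sum over internal states; interchanging two such functionals is the role of
    [finite_comb]. Words are arbitrary boolean words, not only those with [k] letters true, so [G]
    is extended by zero. *)

Local Notation O := (false, false).
Local Notation R := (true, false).
Local Notation G := (false, true).
Local Notation RG := (true, true).

(** * The vertex model and the Yang-Baxter equations *)

Section Vertex.
Variable F : fieldType.
Implicit Types (w z y : F) (ys : seq F) (hs ls : seq bool) (a b : state).

(* [a] and [b] are the states of the upper left and lower left edges, [f] is
   applied to those of the upper right and lower right edges. *)
Definition lozenge w a b (f : state -> state -> F) : F :=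
  match a, b with
  | O, O => f O O
  | RG, O => w * f R G - f RG O
  | G, O => f O G
  | G, R => f O RG + f RG O + (1 - w) * f R G
  | RG, R => f R RG
  | O, R => f R O
  | O, RG => w * f R G
  | G, RG => f RG G
  | _, _ => 0
  end.

(** The reflection vertex: an up-pointing triangle on the bottom side, which belongs to no lozenge.
    The bottom state is G if [h] and R otherwise; [f] is applied to the b-edge. *)
Definition bottom_triangle a (h : bool) (f : state -> F) : F :=
  match a, h with
  | O, false => f R
  | G, false => f RG
  | G, true => f O
  | RG, true => f R
  | _, _ => 0
  end.

(* R-matrices exchanging two adjacent lines, carried by the edges of type a or b
   inside the puzzle ([Ra], [Rb]), and their boundary versions for the bottom
   word, where [true] is the state G, and for the right word, where [true] is the
   empty state ([Rh], [Rl]). *)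
Definition Ra z (a1 a2 : state) (f : state -> state -> F) : F :=
  match a1, a2 with
  | O, O | G, G | RG, RG => f a1 a2
  | O, G | O, RG | RG, G => f a1 a2 + (1 - z) * f a2 a1
  | G, O | RG, O | G, RG => z * f a1 a2
  | _, _ => 0
  end.

Definition Rb z (b1 b2 : state) (f : state -> state -> F) : F :=
  match b1, b2 with
  | O, O | R, R | RG, RG | RG, O => f b1 b2
  | O, R | RG, R => f b1 b2 + (1 - z) * f b2 b1
  | R, O | R, RG => z * f b1 b2
  | O, RG => z * f b1 b2 + (1 - z) * f b2 b1
  | _, _ => 0
  end.

Definition Rh z (h1 h2 : bool) (f : bool -> bool -> F) : F :=
  if h1 && ~~ h2 then z * f true false + (1 - z) * f false true else f h1 h2.

Definition Rl z (l1 l2 : bool) (f : bool -> bool -> F) : F :=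
  if ~~ l1 && l2 then z * f false true + (1 - z) * f true false else f l1 l2.

(** The puzzle of side 2: two lines, each reflected once, crossing once. *)
Definition small_triangle w a1 a2 (h1 h2 : bool) (f : state -> state -> F) : F :=
  bottom_triangle a1 h1 (fun b => lozenge w a2 b (fun b1 a =>
    bottom_triangle a h2 (f b1))).

(** Two lines carried by a-edges cross a third one; sliding their mutual crossing [Ra z] from one
    side of it to the other interchanges the parameters [z * w] and [w]. *)
Lemma yang_baxter_a z w a1 a2 b (f : state -> state -> state -> F) :
  Ra z a1 a2 (fun c1 c2 => lozenge (z * w) c1 b (fun b1 d1 =>
    lozenge w c2 b1 (fun b2 d2 => f b2 d1 d2)))
  = lozenge w a1 b (fun b1 c1 => lozenge (z * w) a2 b1 (fun b2 c2 =>
    Ra z c1 c2 (f b2))).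
Proof.
by case: a1 a2 b => [[] []] [[] []] [[] []]; rewrite /Ra /lozenge /=; ring.
Qed.

Lemma yang_baxter_b z w a b1 b2 (f : state -> state -> state -> F) :
  Rb z b1 b2 (fun c1 c2 => lozenge (z * w) a c1 (fun d1 a1 =>
    lozenge w a1 c2 (fun d2 a2 => f d1 d2 a2)))
  = lozenge w a b1 (fun c1 a1 => lozenge (z * w) a1 b2 (fun c2 a2 =>
    Rb z c1 c2 (fun d1 d2 => f d1 d2 a2))).
Proof.
by case: a b1 b2 => [[] []] [[] []] [[] []]; rewrite /Rb /lozenge /=; ring.
Qed.

(** Reflection equation, the boundary counterpart of Yang-Baxter: [Ra] coming from the left leaves
    as [Rb], at the cost of [Rh] on the bottom word. The parameter of the crossing is inverted
    because the two lines trade places. *)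
Lemma small_triangle_exchange z a1 a2 h1 h2 (f : state -> state -> F) :
  z != 0 ->
  Ra z^-1 a1 a2 (fun c1 c2 => small_triangle z c1 c2 h1 h2 f)
  = Rh z^-1 h1 h2 (fun g1 g2 =>
      small_triangle z^-1 a1 a2 g1 g2 (fun b1 b2 => Rb z b1 b2 f)).
Proof.
move=> z0; case: a1 a2 h1 h2 => [[] []] [[] []] [] [];
by rewrite /Ra /Rh /Rb /small_triangle /lozenge /bottom_triangle /=; field.
Qed.

Definition out_state (l : bool) : state := if l then O else R.

(** The delta functions restrict the outgoing edges to O and R, where the matrix of [Rl] is the
    transpose of that of [Rb]. *)
Lemma Rb_out z b1 b2 l1 l2 c :
  Rb z b1 b2 (fun c1 c2 => (c1 == out_state l1)%:R * ((c2 == out_state l2)%:R * c))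
  = Rl z l1 l2 (fun l1' l2' =>
      (b1 == out_state l1')%:R * ((b2 == out_state l2')%:R * c)).
Proof.
by case: b1 b2 l1 l2 => [[] []] [[] []] [] [];
  rewrite /Rb /Rl /out_state /= ?xpair_eqE /=; ring.
Qed.

End Vertex.

(** * Linear functionals and their interchange *)

Section Functionals.
Variable F : fieldType.

Definition linear_functional T (phi : (T -> F) -> F) :=
  forall c f g, phi (fun t => c * f t + g t) = c * phi f + phi g.

(* Stands for "[phi] is a finite linear combination of evaluations". *)
Definition finite_comb S (psi : (S -> F) -> F) :=
  forall T (phi : (T -> F) -> F) (f : S -> T -> F), linear_functional phi ->
  psi (fun s => phi (f s)) = phi (fun t => psi (fun s => f s t)).

Definition finite_comb2 S (psi : (S -> S -> F) -> F) :=
  finite_comb (fun f : S * S -> F => psi (fun c d => f (c, d))).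

Section Linear.
Variables (T : Type) (phi : (T -> F) -> F).
Hypothesis lin : linear_functional phi.

Lemma linear_functional0 : phi (fun=> 0) = 0.
Proof.
apply: (addrI (phi (fun=> 0))); rewrite addr0 -[X in X + _]mul1r -lin.
by congr phi; apply: functional_extensionality => t; rewrite mulr0 addr0.
Qed.

Lemma linear_functionalD f g : phi (fun t => f t + g t) = phi f + phi g.
Proof.
rewrite -[phi f]mul1r -lin.
by congr phi; apply: functional_extensionality => t; rewrite mul1r.
Qed.

Lemma linear_functionalZ c f : phi (fun t => c * f t) = c * phi f.
Proof.
rewrite -[RHS]addr0 -linear_functional0 -lin.
by congr phi; apply: functional_extensionality => t; rewrite addr0.
Qed.

Lemma linear_functionalN f : phi (fun t => - f t) = - phi f.
Proof.
rewrite -mulN1r -linear_functionalZ.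
by congr phi; apply: functional_extensionality => t; rewrite mulN1r.
Qed.

Definition linear_functionalE := (linear_functional0, linear_functionalD,
  linear_functionalN, linear_functionalZ).

End Linear.

Lemma finite_comb_linear S (psi : (S -> F) -> F) :
  finite_comb psi -> linear_functional psi.
Proof.
move=> comb c f g.
(* The combination of [f] and [g] is itself a functional, applied to the family indexed by [bool]
   that consists of [f] and [g]. *)
pose phi (h : bool -> F) := c * h true + h false.
have lin : linear_functional phi by move=> *; rewrite /phi; ring.
exact: (comb _ phi (fun s b => if b then f s else g s) lin).
Qed.

Lemma lozenge_comb w a b : finite_comb2 (@lozenge F w a b).
Proof.
move=> T phi f lin.
by case: a b => [[] []] [[] []]; rewrite /lozenge ?(linear_functionalE lin).
Qed.

Lemma bottom_triangle_comb a h :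
  finite_comb (@bottom_triangle F a h).
Proof.
move=> T phi f lin.
by case: a h => [[] []] []; rewrite /bottom_triangle ?(linear_functionalE lin).
Qed.

Lemma Ra_comb z a b : finite_comb2 (@Ra F z a b).
Proof.
move=> T phi f lin.
by case: a b => [[] []] [[] []]; rewrite /Ra ?(linear_functionalE lin).
Qed.

Lemma Rh_comb z a b : finite_comb2 (@Rh F z a b).
Proof.
move=> T phi f lin.
by case: a b => [] []; rewrite /Rh /= ?(linear_functionalE lin).
Qed.

Lemma Rl_comb z a b : finite_comb2 (@Rl F z a b).
Proof.
move=> T phi f lin.
by case: a b => [] []; rewrite /Rl /= ?(linear_functionalE lin).
Qed.

(* [op] acting on the entries [i] and [i + 1] *)
Fixpoint act_at T i (op : T -> T -> (T -> T -> F) -> F) (s : seq T)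
    (f : seq T -> F) : F :=
  match i, s with
  | 0, a :: b :: s' => op a b (fun c d => f (c :: d :: s'))
  | i'.+1, a :: s' => act_at i' op s' (fun t => f (a :: t))
  | _, _ => f s
  end.

Lemma act_at_comb T i (op : T -> T -> (T -> T -> F) -> F) s :
  (forall a b, finite_comb2 (op a b)) -> finite_comb (act_at i op s).
Proof.
move=> comb U phi; elim: i s => [|i IH] [|a s] f lin //=; last exact: IH.
case: s => [|b s] //.
exact: (comb a b _ _ (fun cd => f (cd.1 :: cd.2 :: s)) lin).
Qed.

Lemma act_at_cat T (op : T -> T -> (T -> T -> F) -> F) s1 a b s2 f :
  act_at (size s1) op (s1 ++ a :: b :: s2) f
  = op a b (fun c d => f (s1 ++ c :: d :: s2)).
Proof. by elim: s1 f => //= c s1 IH f; rewrite IH. Qed.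

End Functionals.

(** * Exchange of two adjacent lines in a whole puzzle *)

Section Strips.
Variable F : fieldType.
Implicit Types (w z y u v : F) (ys : seq F) (hs ls : seq bool) (a b : state).
Implicit Types (s : seq state).

(* One line of parameter [y] in state [b] crossing lines of parameters [ys] in
   states [s]; [f] is applied to the resulting states. *)
Fixpoint strip y b ys s (f : state -> seq state -> F) : F :=
  match ys, s with
  | y' :: ys', a :: s' => lozenge (y' / y) a b (fun b' a' =>
      strip y b' ys' s' (fun b'' t => f b'' (a' :: t)))
  | _, _ => f b [::]
  end.

Lemma strip_comb y b ys s :
  finite_comb (fun f : state * seq state -> F => strip y b ys s (fun c t => f (c, t))).
Proof.
move=> T phi; elim: ys s b => [|y' ys IH] [|a s] b f lin //=.
rewrite -(lozenge_comb _ _ _ (fun ba t => strip y ba.1 ys s (fun b'' t0 => f (b'', ba.2 :: t0) t)) lin) /=.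
congr lozenge; apply: functional_extensionality => b'.
apply: functional_extensionality => a'.
exact: (IH _ _ (fun bt => f (bt.1, a' :: bt.2))).
Qed.

(* [s] is read from bottom to top, [hs] from left to right (the opposite of the
   statement) and [ls] from top to bottom. *)
Fixpoint triangle ys s hs ls : F :=
  match ys, s, hs, ls with
  | y :: ys', a :: s', h :: hs', l :: ls' =>
      bottom_triangle a h (fun b => strip y b ys' s' (fun b' t =>
        (b' == out_state l)%:R * triangle ys' t hs' ls'))
  | _, _, _, _ => 1
  end.

Lemma eq_strip y b ys s f g : f =2 g -> strip y b ys s f = strip y b ys s g.
Proof.
move=> e; congr strip; apply: functional_extensionality => c.
exact: functional_extensionality.
Qed.

Lemma eq_strip_size y b ys s f g : size s = size ys ->
  (forall c t, size t = size ys -> f c t = g c t) -> strip y b ys s f = strip y b ys s g.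
Proof.
elim: ys s b f g => [|y' ys IH] [|a s] b f g //=; first by move=> _; apply.
move=> [ssz] e; congr lozenge; apply: functional_extensionality => b'.
apply: functional_extensionality => a'; apply: IH => // c t szt.
by apply: e => /=; rewrite szt.
Qed.

Lemma eq_act_at T i (op : T -> T -> (T -> T -> F) -> F) (s : seq T) f g :
  (forall t, size t = size s -> f t = g t) -> act_at i op s f = act_at i op s g.
Proof.
elim: i s f g => [|i IH] [|a s] f g e /=; try exact: e; last first.
  by apply: IH => t szt; apply: e; rewrite /= szt.
case: s e => [|b s] e /=; first exact: e.
congr op; apply: functional_extensionality => c.
by apply: functional_extensionality => d; apply: e.
Qed.

(** The weights depend on ratios of parameters only, and [v / y = (v / u) * (u / y)] is the form
    [z * w] that [yang_baxter_a] needs. *)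
Lemma strip_exchange y b ys1 u v ys2 s f : y != 0 -> u != 0 ->
  size s = (size ys1 + size ys2).+2 ->
  act_at (size ys1) (Ra (v / u)) s (fun t => strip y b (ys1 ++ v :: u :: ys2) t f)
  = strip y b (ys1 ++ u :: v :: ys2) s
      (fun b' t => act_at (size ys1) (Ra (v / u)) t (f b')).
Proof.
move=> y0 u0; elim: ys1 s b f => [|y1 ys1 IH] [|a s] // b f.
  case: s => // a' s [ssz] /=.
  rewrite [v / y](_ : _ = (v / u) * (u / y)); last by field; rewrite y0 u0.
  rewrite (yang_baxter_a _ _ _ _ _ (fun b2 d1 d2 =>
     strip y b2 ys2 s (fun b'' t => f b'' (d1 :: d2 :: t)))).
  congr lozenge; apply: functional_extensionality => b1.
  apply: functional_extensionality => c1.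
  congr lozenge; apply: functional_extensionality => b2.
  apply: functional_extensionality => c2.
  exact: (Ra_comb _ _ _ (fun cd t => f t.1 (cd.1 :: cd.2 :: t.2))
    (finite_comb_linear (@strip_comb y b2 ys2 s))).
move=> [ssz] /=.
rewrite (act_at_comb _ _ (@Ra_comb _ _) (fun t ba => strip y ba.1 (ys1 ++ v :: u :: ys2) t
   (fun b'' t0 => f b'' (ba.2 :: t0))) (finite_comb_linear (@lozenge_comb F (y1 / y) a b))) /=.
congr lozenge; apply: functional_extensionality => b1.
apply: functional_extensionality => c1.
by rewrite IH.
Qed.

(** Two consecutive strips traversed together, one lozenge of each at a time, so that
    [yang_baxter_b] applies level by level. *)
Fixpoint two_strips y1 y2 b1 b2 ys s (f : state -> state -> seq state -> F) : F :=
  match ys, s with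
  | y :: ys', a :: s' => lozenge (y / y1) a b1 (fun c1 a1 =>
      lozenge (y / y2) a1 b2 (fun c2 a2 =>
        two_strips y1 y2 c1 c2 ys' s' (fun d1 d2 t => f d1 d2 (a2 :: t))))
  | _, _ => f b1 b2 [::]
  end.

(** A lozenge of the second strip only uses the a-edge at its own level, so it commutes with the
    part of the first strip above that level. *)
Lemma two_stripsE y1 y2 b1 b2 ys s f : size s = size ys ->
  strip y1 b1 ys s (fun c1 t => strip y2 b2 ys t (f c1)) = two_strips y1 y2 b1 b2 ys s f.
Proof.
elim: ys s b1 b2 f => [|y ys IH] [|a s] b1 b2 f //= [ssz].
congr lozenge; apply: functional_extensionality => c1.
apply: functional_extensionality => a1.
rewrite -(lozenge_comb _ _ _ (fun ba t => strip y2 ba.1 ys t.2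
   (fun b'' t0 => f t.1 b'' (ba.2 :: t0))) (finite_comb_linear (@strip_comb y1 c1 ys s))) /=.
congr lozenge; apply: functional_extensionality => c2.
apply: functional_extensionality => a2.
by rewrite IH.
Qed.

Lemma two_strips_comb y1 y2 b1 b2 ys s : size s = size ys -> finite_comb
  (fun f : state * state * seq state -> F =>
     two_strips y1 y2 b1 b2 ys s (fun c d t => f (c, d, t))).
Proof.
move=> ssz T phi f lin; rewrite -two_stripsE //.
transitivity (phi (fun t => strip y1 b1 ys s (fun c t0 =>
    strip y2 b2 ys t0 (fun d t1 => f (c, d, t1) t)))); last first.
  by congr phi; apply: functional_extensionality => t; rewrite -two_stripsE.
rewrite -[RHS](strip_comb y1 b1 ys s (fun bt t => strip y2 b2 ys bt.2 (fun d t0 => f (bt.1, d, t0) t)) lin).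
apply: eq_strip => c t.
exact: (strip_comb _ _ _ _ (fun bt => f (c, bt.1, bt.2)) lin).
Qed.

Lemma two_strips_exchange u v b1 b2 ys s f : u != 0 -> v != 0 ->
  size s = size ys ->
  Rb (u / v) b1 b2 (fun c1 c2 => two_strips v u c1 c2 ys s f)
  = two_strips u v b1 b2 ys s (fun c1 c2 t => Rb (u / v) c1 c2 (fun d1 d2 => f d1 d2 t)).
Proof.
move=> u0 v0; elim: ys s b1 b2 f => [|y ys IH] [|a s] b1 b2 f //= [ssz].
rewrite [y / v](_ : _ = (u / v) * (y / u)); last by field; rewrite u0 v0.
rewrite (yang_baxter_b _ _ _ _ _ (fun c1 c2 a2 =>
  two_strips v u c1 c2 ys s (fun d1 d2 t => f d1 d2 (a2 :: t)))).
congr lozenge; apply: functional_extensionality => c1.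
apply: functional_extensionality => a1.
congr lozenge; apply: functional_extensionality => c2.
apply: functional_extensionality => a2.
by rewrite IH.
Qed.

(* The Yang-Baxter equations move the [R]-matrix of the two exchanged lines from
   the left side through the puzzle to the bottom and right sides. *)
Lemma triangle_exchange ys1 u v ys2 s hs ls :
  all (fun y => y != 0) (ys1 ++ u :: v :: ys2) ->
  size s = (size ys1 + size ys2).+2 -> size hs = size s -> size ls = size s ->
  act_at (size ys1) (Ra (v / u)) s (fun t => triangle (ys1 ++ v :: u :: ys2) t hs ls)
  = act_at (size ys1) (Rh (v / u)) hs (fun hs' =>
      act_at (size ys1) (Rl (u / v)) ls (fun ls' =>
        triangle (ys1 ++ u :: v :: ys2) s hs' ls')).
Proof.
elim: ys1 s hs ls => [|y1 ys1 IH] [|a s] [|h hs] [|l ls] //.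
  case: s hs ls => [|a' s] [|h' hs] [|l' ls] //= /and3P[u0 v0 _] [ssz] _ _.
  (* The two leftmost strips, rearranged as the puzzle of side 2 at their feet followed by the
     interleaved remainders. *)
  pose X y y' h h' l l' a a' : F := small_triangle (y' / y) a a' h h'
    (fun b1 b2 => two_strips y y' b1 b2 ys2 s (fun d1 d2 t =>
       (d1 == out_state l)%:R * ((d2 == out_state l')%:R * triangle ys2 t hs ls))).
  have XE y y' g g' k k' c c' :
    bottom_triangle c g (fun b => lozenge (y' / y) c' b (fun b' a0 =>
      strip y b' ys2 s (fun b'' t => (b'' == out_state k)%:R *
        bottom_triangle a0 g' (fun b0 => strip y' b0 ys2 t (fun b'0 t0 =>
          (b'0 == out_state k')%:R * triangle ys2 t0 hs ls)))))
    = X y y' g g' k k' c c'.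
    congr bottom_triangle; apply: functional_extensionality => b.
    congr lozenge; apply: functional_extensionality => b1.
    apply: functional_extensionality => a1.
    pose H b2 (bt : state * seq state) := (bt.1 == out_state k)%:R *
      strip y' b2 ys2 bt.2 (fun b'0 t0 => (b'0 == out_state k')%:R * triangle ys2 t0 hs ls).
    transitivity (strip y b1 ys2 s (fun b'' t => bottom_triangle a1 g' (fun b2 => H b2 (b'', t)))).
      apply: eq_strip => b'' t; rewrite /H /=.
      by rewrite (linear_functionalZ (finite_comb_linear (@bottom_triangle_comb F a1 g'))).
    rewrite -(bottom_triangle_comb _ _ H (finite_comb_linear (@strip_comb y b1 ys2 s))).
    congr bottom_triangle; apply: functional_extensionality => b2.
    rewrite -two_stripsE //; apply: eq_strip => c1 t; rewrite /H /=.
    exact: (esym (linear_functionalZ (finite_comb_linear (@strip_comb y' b2 ys2 t)) _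
      (fun bt => (bt.1 == out_state k')%:R * triangle ys2 bt.2 hs ls))).
  transitivity (Ra (v / u) a a' (fun c c' => X v u h h' l l' c c')).
    congr Ra; apply: functional_extensionality => c.
    by apply: functional_extensionality => c'; rewrite -XE.
  transitivity (Rh (v / u) h h' (fun g g' => Rl (u / v) l l' (fun k k' =>
     X u v g g' k k' a a'))); last first.
    congr Rh; apply: functional_extensionality => g.
    apply: functional_extensionality => g'.
    congr Rl; apply: functional_extensionality => k.
    by apply: functional_extensionality => k'; rewrite -XE.
  have z0 : u / v != 0 by rewrite mulf_neq0 ?invr_eq0.
  (* The crossing passes the puzzle of side 2 and becomes [Rb], climbs between the two strips, and
     is absorbed by the right word through [Rb_out]. *)
  rewrite /X -[v / u]invf_div small_triangle_exchange //.
  congr Rh; apply: functional_extensionality => g.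
  apply: functional_extensionality => g'.
  have lin : linear_functional (fun f : state * state -> F =>
    small_triangle (u / v)^-1 a a' g g' (fun b1 b2 => f (b1, b2))).
    move=> c f1 f2; rewrite /small_triangle.
    by case: a a' g g' => [[] []] [[] []] [] []; rewrite /= /lozenge /=; ring.
  apply: etrans (esym (Rl_comb (u / v) l l' (fun kk bb => two_strips u v bb.1 bb.2 ys2 s (fun d1 d2 t =>
    (d1 == out_state kk.1)%:R * ((d2 == out_state kk.2)%:R * triangle ys2 t hs ls))) lin)) => /=.
  congr small_triangle; apply: functional_extensionality => b1.
  apply: functional_extensionality => b2.
  rewrite two_strips_exchange //.
  apply: etrans (esym (Rl_comb (u / v) l l' (fun kk bb =>
    (bb.1.1 == out_state kk.1)%:R * ((bb.1.2 == out_state kk.2)%:R * triangle ys2 bb.2 hs ls))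
    (finite_comb_linear (@two_strips_comb u v b1 b2 ys2 s ssz)))) => /=.
  congr two_strips; apply: functional_extensionality => d1.
  apply: functional_extensionality => d2; apply: functional_extensionality => t.
  exact: Rb_out.
(* The exchanged lines both cross the first strip; [strip_exchange] moves [Ra] to the left side of
   the remaining triangle, where the induction hypothesis takes over. *)
move=> /= /andP[y0 nz] [ssz] [hsz] [lsz].
rewrite (act_at_comb _ _ (@Ra_comb _ _) (fun t b => strip y1 b (ys1 ++ v :: u :: ys2) t
   (fun b' t0 => (b' == out_state l)%:R * triangle (ys1 ++ v :: u :: ys2) t0 hs ls))
   (finite_comb_linear (@bottom_triangle_comb F a h))) /=.
have lin := finite_comb_linear (@bottom_triangle_comb F a h).
pose H hs' ls' b := strip y1 b (ys1 ++ u :: v :: ys2) s (fun b' t =>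
  (b' == out_state l)%:R * triangle (ys1 ++ u :: v :: ys2) t hs' ls').
transitivity (bottom_triangle a h (fun b => act_at (size ys1) (Rh (v / u)) hs (fun hs' =>
  act_at (size ys1) (Rl (u / v)) ls (fun ls' => H hs' ls' b)))); last first.
  symmetry; apply: etrans (act_at_comb _ _ (@Rh_comb F _) (fun hs' b =>
     act_at (size ys1) (Rl (u / v)) ls (fun ls' => H hs' ls' b)) lin).
  by apply: eq_act_at => hs' _; exact: (act_at_comb _ _ (@Rl_comb F _) (H hs') lin).
congr bottom_triangle; apply: functional_extensionality => b.
have lin2 := finite_comb_linear (@strip_comb y1 b (ys1 ++ u :: v :: ys2) s).
pose H2 hs' ls' (bt : state * seq state) := (bt.1 == out_state l)%:R *
  triangle (ys1 ++ u :: v :: ys2) bt.2 hs' ls'.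
transitivity (strip y1 b (ys1 ++ u :: v :: ys2) s (fun b' t =>
  act_at (size ys1) (Rh (v / u)) hs (fun hs' =>
  act_at (size ys1) (Rl (u / v)) ls (fun ls' => H2 hs' ls' (b', t))))); last first.
  symmetry; apply: etrans (act_at_comb _ _ (@Rh_comb F _) (fun hs' bt =>
     act_at (size ys1) (Rl (u / v)) ls (fun ls' => H2 hs' ls' bt)) lin2).
  by apply: eq_act_at => hs' _; exact: (act_at_comb _ _ (@Rl_comb F _) (H2 hs') lin2).
have u0 : u != 0 by move: nz; rewrite all_cat /= => /and4P[].
rewrite strip_exchange //; apply: eq_strip_size => [|b' t szt].
  by rewrite ssz size_cat /= !addnS.
have lina := finite_comb_linear (act_at_comb (size ys1) t (@Ra_comb F (v / u))).
have linh := finite_comb_linear (act_at_comb (size ys1) hs (@Rh_comb F (v / u))).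
have linl := finite_comb_linear (act_at_comb (size ys1) ls (@Rl_comb F (u / v))).
rewrite (linear_functionalZ lina) IH ?szt ?hsz ?lsz ?ssz ?size_cat //=; last 3 first.
- by rewrite !addnS.
- by rewrite !addnS.
- by rewrite !addnS.
rewrite -(linear_functionalZ linh); apply: eq_act_at => hs' _.
by rewrite -(linear_functionalZ linl).
Qed.
End Strips.

Section BitSum.
Variable F : fieldType.

Fixpoint bsum n (f : seq bool -> F) : F :=
  if n is n'.+1 then \sum_(c : bool) bsum n' (fun s => f (c :: s)) else f [::].

Lemma eq_bsum n f g : (forall s, size s = n -> f s = g s) -> bsum n f = bsum n g.
Proof.
elim: n f g => [|n IH] f g e /=; first exact: e.
by apply: eq_bigr => c _; apply: IH => s ss; apply: e; rewrite /= ss.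
Qed.

Lemma bsumD n f g : bsum n (fun s => f s + g s) = bsum n f + bsum n g.
Proof.
elim: n f g => [|n IH] f g //=; rewrite -big_split /=.
by apply: eq_bigr => c _; rewrite IH.
Qed.

Lemma bsum_sum n (f : bool -> seq bool -> F) :
  bsum n (fun s => \sum_(c : bool) f c s) = \sum_(c : bool) bsum n (f c).
Proof.
rewrite big_bool /= -bsumD; apply: eq_bsum => s _; exact: big_bool.
Qed.

Lemma bsumZ n c f : bsum n (fun s => c * f s) = c * bsum n f.
Proof.
elim: n f => [|n IH] f //=; rewrite mulr_sumr.
by apply: eq_bigr => b _; rewrite IH.
Qed.

Lemma bsum0 n : bsum n (fun=> 0) = 0.
Proof. by elim: n => //= n IH; rewrite big1. Qed.

End BitSum.

(** * Puzzles whose left side encodes the empty diagram *)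

Section EmptyLeftSide.
Variables (F : fieldType) (Y X : seq F) (g : seq bool -> seq F -> F).
Hypothesis g_exchange : forall s1 a b s2 zs1 u v zs2,
  size s1 = size zs1 -> size s2 = size zs2 -> perm_eq (zs1 ++ u :: v :: zs2) Y ->
  g (s1 ++ a :: b :: s2) (zs1 ++ v :: u :: zs2)
  = Rl (u / v) a b (fun c d => g (s1 ++ c :: d :: s2) (zs1 ++ u :: v :: zs2)).
Hypothesis g_vanish : forall s1 s2 zs1 zs2,
  size s1 = size zs1 -> size zs2 = (size s2).+1 -> perm_eq (zs1 ++ zs2) Y ->
  {subset X <= zs1} -> g (s1 ++ true :: s2) (zs1 ++ zs2) = 0.

Implicit Types (y w : F) (ys zs : seq F) (hs ls : seq bool) (f : state -> seq state -> F).

(* When the left side encodes the empty diagram, the edges of type a above its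
   empty part only take the states G and RG, which stand for 1 and 0. *)
Definition in_state (c : bool) : state := if c then G else RG.

(* An edge of type b in state RG forces this state up to the right side, where it
   is forbidden. *)
Lemma strip_dead y ys s f : size s = size ys -> (forall t, f RG t = 0) ->
  strip y RG ys (map in_state s) f = 0.
Proof.
elim: ys s f => [|y' ys IH] [|[] s] f //= [ssz] f0.
by rewrite IH // => t; apply: f0.
Qed.

Lemma strip_vacant y ys1 ys2 s f :
  strip y R (ys1 ++ ys2) (nseq (size ys1) O ++ s) f
  = strip y R ys2 s (fun b t => f b (nseq (size ys1) O ++ t)).
Proof. by elim: ys1 f => //= y1 ys1 IH f; rewrite IH. Qed.

(** On these states a lozenge is the matrix [Rl]; the remaining terms leave a b-edge in state RG and
    are killed by the hypothesis on [f]. *)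
Lemma lozenge_exchange w (h : bool -> bool -> F) (f : state -> state -> F) : (forall a, f RG a = 0) ->
  \sum_(c : bool) \sum_(d : bool) h c d * lozenge w (in_state c) (out_state d) f
  = \sum_(d : bool) \sum_(c : bool) Rl w c d h * f (out_state c) (in_state d).
Proof. by move=> f0; rewrite !big_bool /= /Rl /= !f0; ring. Qed.

(** Each lozenge exchanges [y] with one neighbouring parameter of [g], so the strip carries [y] from
    the right of [rev ys] to its left. *)
Lemma strip_sum s1 s2 zs1 zs2 y ys f :
  size s1 = size zs1 -> size s2 = size zs2 -> (forall t, f RG t = 0) ->
  perm_eq (zs1 ++ rev ys ++ y :: zs2) Y ->
  bsum (size ys) (fun s => \sum_(c : bool)
    g (s1 ++ rev s ++ c :: s2) (zs1 ++ rev ys ++ y :: zs2)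
      * strip y (out_state c) ys (map in_state s) f)
  = bsum (size ys) (fun s => \sum_(c : bool)
    g (s1 ++ c :: rev s ++ s2) (zs1 ++ y :: rev ys ++ zs2)
      * f (out_state c) (map in_state s)).
Proof.
elim: ys s2 zs2 f => [|y' ys IH] s2 zs2 f sz1 sz2 f0 zsY //=.
rewrite -2!bsum_sum.
transitivity (bsum (size ys) (fun s => \sum_(d : bool) \sum_(c : bool)
    g (s1 ++ rev s ++ c :: d :: s2) (zs1 ++ rev ys ++ y :: y' :: zs2)
      * strip y (out_state c) ys (map in_state s) (fun b t => f b (in_state d :: t)))).
  apply: eq_bsum => s ssz.
  pose f' b' a' := strip y b' ys (map in_state s) (fun b t => f b (a' :: t)).
  have f'0 a : f' RG a = 0 by apply: strip_dead.
  transitivity (\sum_(c : bool) \sum_(d : bool)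
    g ((s1 ++ rev s) ++ c :: d :: s2) ((zs1 ++ rev ys) ++ y' :: y :: zs2)
     * lozenge (y' / y) (in_state c) (out_state d) f').
    apply: eq_bigr => c _; apply: eq_bigr => d _.
    by rewrite !rev_cons !cat_rcons !catA.
  rewrite (lozenge_exchange _ _ f'0); apply: eq_bigr => d _; apply: eq_bigr => c _.
  rewrite -g_exchange ?catA //; first by rewrite !size_cat !size_rev ssz sz1.
  by move: zsY; rewrite rev_cons cat_rcons !catA.
rewrite [LHS]bsum_sum [RHS]bsum_sum; apply: eq_bigr => d _.
have := IH (d :: s2) (y' :: zs2) (fun b t => f b (in_state d :: t)) sz1.
rewrite /= sz2 => -> //; last first.
  apply: perm_trans zsY; rewrite rev_cons cat_rcons !perm_cat2l.
  by rewrite -[y :: y' :: _]/([:: y] ++ [:: y'] ++ _) perm_catCA.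
apply: eq_bsum => s _; apply: eq_bigr => c _.
by rewrite !rev_cons !cat_rcons.
Qed.

(** Between equal letters [Rl] is the identity, so [g] is symmetric in the parameters of consecutive
    letters false. *)
Lemma move_zero s1 zs1 ys y : size s1 = size zs1 -> perm_eq (zs1 ++ ys ++ [:: y]) Y ->
  g (s1 ++ nseq (size ys).+1 false) (zs1 ++ ys ++ [:: y])
  = g (s1 ++ nseq (size ys).+1 false) (zs1 ++ y :: ys).
Proof.
elim: ys s1 zs1 => [|y' ys IH] s1 zs1 sz // zsY.
have := IH (rcons s1 false) (rcons zs1 y'); rewrite !size_rcons sz !cat_rcons => -> //.
have -> : nseq (size (y' :: ys)).+1 false = false :: false :: nseq (size ys) false by [].
rewrite g_exchange //; first by rewrite size_nseq.
by apply: perm_trans zsY; rewrite perm_cat2l perm_sym perm_catC perm_refl.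
Qed.

(** Removing the leftmost strip fixes the next letter of [ls] and brings its parameter from the
    reversed tail to the end of [zs1]. Once all strips are gone, the reversed list has been put back
    in order. [s1] and [zs1] store the letters and parameters already treated. *)
Lemma triangle_empty_left zs1 ys1 ys2 s1 hs ls :
  size s1 = size zs1 -> perm_eq (zs1 ++ ys1 ++ ys2) Y ->
  {subset X <= zs1 ++ ys2} ->
  size hs = (size ys1 + size ys2)%N -> size ls = (size ys1 + size ys2)%N ->
  bsum (size ys2) (fun s =>
    g (s1 ++ rev s ++ nseq (size ys1) false) (zs1 ++ rev (ys1 ++ ys2))
    * triangle (ys1 ++ ys2) (nseq (size ys1) O ++ map in_state s) hs ls)
  = (hs == nseq (size ys1) false ++ nseq (size ys2) true)%:R
    * g (s1 ++ ls) (zs1 ++ ys1 ++ ys2).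
Proof.
have pick_out l x (f : bool -> F) :
    \sum_(c : bool) f c * ((out_state c == out_state l)%:R * x) = f l * x.
  by rewrite big_bool; case: l; rewrite /= ?mul0r ?mul1r ?mulr0 ?addr0 ?add0r.
elim: ys1 zs1 s1 hs ls => [|y ys1 IH] zs1 s1 hs ls /=.
  elim: ys2 zs1 s1 hs ls => [|y ys2 IH] zs1 s1 [|h hs] [|l ls] //= sz zsY Xs.
    by rewrite cats0 mulr1 mul1r.
  move=> [hsz] [lsz].
  pose f b t : F := (b == out_state l)%:R * triangle ys2 t hs ls.
  have f0 t : f RG t = 0 by rewrite /f; case: (l); rewrite mul0r.
  (* Under a bottom letter R, the state RG admits no tile and the state G sends RG along the strip,
     which dies. *)
  case: h => /=; last first.
    rewrite mul0r big1 // => c _; rewrite -[RHS](bsum0 F (size ys2)).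
    apply: eq_bsum => s ssz; case: c => /=; last by rewrite mulr0.
    by rewrite strip_dead ?mulr0.
  transitivity (bsum (size ys2) (fun s => \sum_(c : bool)
    g (s1 ++ rev s ++ [:: c]) (zs1 ++ rev ys2 ++ [:: y])
      * strip y (out_state c) ys2 (map in_state s) f)).
    rewrite bsum_sum; apply: eq_bigr => c _; apply: eq_bsum => s _.
    by rewrite !rev_cons cats0 -!cats1; case: c.
  rewrite strip_sum //; last first.
    apply: perm_trans zsY; rewrite perm_cat2l cats1 perm_rcons perm_cons.
    by rewrite perm_rev.
  have -> : (true :: hs == true :: nseq (size ys2) true) = (hs == nseq (size ys2) true) by [].
  have := IH (rcons zs1 y) (rcons s1 l) hs ls; rewrite !size_rcons sz !cat_rcons => <- //.
  by apply: eq_bsum => s _; rewrite /f pick_out !cats0 cat_rcons.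
case: hs ls => [|h hs] [|l ls] // sz zsY Xs [hsz] [lsz].
case: h => /=.
  rewrite mul0r -[RHS](bsum0 F (size ys2)).
  by apply: eq_bsum => s _; rewrite mulr0.
have -> : (false :: hs == false :: nseq (size ys1) false ++ nseq (size ys2) true)
  = (hs == nseq (size ys1) false ++ nseq (size ys2) true) by [].
pose f b t : F := (b == out_state l)%:R * triangle (ys1 ++ ys2) (nseq (size ys1) O ++ t) hs ls.
have f0 t : f RG t = 0 by rewrite /f; case: (l); rewrite mul0r.
transitivity (bsum (size ys2) (fun s => \sum_(c : bool)
    g (s1 ++ rev s ++ c :: nseq (size ys1) false) (zs1 ++ rev ys2 ++ y :: rev ys1)
      * strip y (out_state c) ys2 (map in_state s) f)).
  apply: eq_bsum => s ssz.
  have zsY' : perm_eq (zs1 ++ rev ys2 ++ y :: rev ys1) Y.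
    apply: perm_trans zsY; rewrite perm_cat2l perm_sym -cat_cons perm_catC.
    apply: perm_cat; first by rewrite perm_sym perm_rev.
    by rewrite perm_cons perm_sym perm_rev.
  (* The strip starts in state R, the letter false. The term with letter true, required by
     [strip_sum], can be added because [g] vanishes there: all of [X] lies to the left of that
     letter. *)
  have g0 : g (s1 ++ rev s ++ true :: nseq (size ys1) false) (zs1 ++ rev ys2 ++ y :: rev ys1) = 0.
    rewrite !catA g_vanish -?catA //.
    - by rewrite !size_cat !size_rev sz ssz.
    - by rewrite /= size_rev size_nseq.
    - by move=> x /Xs; rewrite !mem_cat mem_rev.
  rewrite big_bool g0 mul0r [RHS]add0r.
  (* The lozenges on the O part have weight 1; correspondingly [y] moves freely in [g] past the
     parameters [ys1], whose letters are false. *)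
  rewrite strip_vacant; congr (_ * _).
  rewrite -[false :: nseq _ _]/(nseq (size ys1).+1 false) -(size_rev ys1).
  have := @move_zero (s1 ++ rev s) (zs1 ++ rev ys2) (rev ys1) y.
  rewrite -!catA => <-; first by rewrite rev_cons rev_cat -cats1 -catA.
    by rewrite !size_cat !size_rev sz ssz.
  apply: perm_trans zsY'; rewrite !perm_cat2l cats1 perm_rcons.
  exact: perm_refl.
rewrite strip_sum //; last 2 first.
- by rewrite size_rev size_nseq.
- apply: perm_trans zsY; rewrite perm_cat2l perm_sym -cat_cons perm_catC.
  apply: perm_cat; first by rewrite perm_sym perm_rev.
  by rewrite perm_cons perm_sym perm_rev.
have := IH (rcons zs1 y) (rcons s1 l) hs ls; rewrite !size_rcons sz !cat_rcons => <- //; last first.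
  by move=> x /Xs; rewrite !mem_cat inE => /orP[->//|->]; rewrite !orbT.
by apply: eq_bsum => s _; rewrite /f pick_out rev_cat cat_rcons.
Qed.

End EmptyLeftSide.

(** * The product identity for an abstract family of functions *)

Lemma perm_adjacent_ind (T : eqType) (P : seq T -> Prop) :
  (forall s1 u v s2, P (s1 ++ u :: v :: s2) -> P (s1 ++ v :: u :: s2)) ->
  forall s t, perm_eq s t -> P s -> P t.
Proof.
move=> swap s t.
suff gen s0 : perm_eq s t -> P (s0 ++ s) -> P (s0 ++ t) by exact: (gen [::]).
elim: s t s0 => [|a s IH] t s0.
  by rewrite perm_sym => /perm_nilP->.
move=> pst; have at_ : a \in t by rewrite -(perm_mem pst) mem_head.
case/splitPr: at_ pst => t1 t2 pst.
have {}pst : perm_eq s (t1 ++ t2).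
  by move: pst; rewrite perm_sym -cat1s perm_catCA /= perm_cons perm_sym.
rewrite -cat_rcons => /(IH _ _ pst); rewrite cat_rcons.
elim: t1 s0 {pst} => //= b t1 IHt s0 /swap.
by rewrite -cat_rcons => /IHt; rewrite cat_rcons.
Qed.

Section Adjoint.
Variable F : fieldType.

Definition left_state (c : bool) : state := if c then G else O.

Lemma bsum_delta n (f : seq bool -> F) s0 : size s0 = n ->
  bsum n (fun s => f s * (s == s0)%:R) = f s0.
Proof.
elim: n f s0 => [|n IH] f [|c s0] //= => [_|[ssz]]; first by rewrite mulr1.
rewrite big_bool -(IH (fun s => f (c :: s)) s0 ssz).
have e0 (b : bool) : b != c -> bsum n (fun s => f (b :: s) * (b :: s == c :: s0)%:R) = 0.
  move=> bc; rewrite -[RHS](bsum0 F n); apply: eq_bsum => s _.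
  by rewrite eqseq_cons (negPf bc) mulr0.
have e1 : bsum n (fun s => f (c :: s) * (c :: s == c :: s0)%:R)
   = bsum n (fun s => f (c :: s) * (s == s0)%:R).
  by apply: eq_bsum => s _; rewrite eqseq_cons eqxx.
by case: c e0 e1 => e0 e1; rewrite /= e1; [rewrite (e0 false) ?addr0 | rewrite (e0 true) ?add0r].
Qed.

(** Summation by parts: [Ra] preserves the span of the states O and G, and there its matrix is the
    transpose of that of [Rh]. *)
Lemma act_at_adjoint i n z (T : seq state -> F) (H : seq bool -> F) : (i.+1 < n)%N ->
  bsum n (fun s => T (map left_state s) * act_at i (Rh z) s H)
  = bsum n (fun s => act_at i (Ra z) (map left_state s) T * H s).
Proof.
elim: i n T H => [|i IH] [|n] T H //= lt; last first.
  apply: eq_bigr => c _.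
  exact: (IH _ (fun t => T (left_state c :: t)) (fun t => H (c :: t))).
case: n lt => // n _ /=; rewrite !big_bool /= -!bsumD.
by apply: eq_bsum => s _; rewrite /Rh /Ra /=; ring.
Qed.

End Adjoint.

Section ProductIdentity.
Variables (F : fieldType) (Y X : seq F) (g : seq bool -> seq F -> F).
Hypothesis Y0 : all (fun y => y != 0) Y.
Hypothesis g_exchange : forall s1 a b s2 zs1 u v zs2,
  size s1 = size zs1 -> size s2 = size zs2 -> perm_eq (zs1 ++ u :: v :: zs2) Y ->
  g (s1 ++ a :: b :: s2) (zs1 ++ v :: u :: zs2)
  = Rl (u / v) a b (fun c d => g (s1 ++ c :: d :: s2) (zs1 ++ u :: v :: zs2)).
Hypothesis g_vanish : forall s1 s2 zs1 zs2,
  size s1 = size zs1 -> size zs2 = (size s2).+1 -> perm_eq (zs1 ++ zs2) Y ->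
  {subset X <= zs1} -> g (s1 ++ true :: s2) (zs1 ++ zs2) = 0.
Hypothesis g_base : forall s zs1 zs2,
  size s = (size zs1 + size zs2)%N -> perm_eq (zs1 ++ zs2) Y -> X =i zs1 ->
  g s (zs1 ++ zs2) = (s == nseq (size zs1) true ++ nseq (size zs2) false)%:R.

(** The identity at one fixed point. [s] and [hs] are read in the directions opposite to those of
    [nu] and [mu], whence [rev] on words; [rev ys] is the reversed list of variables. *)
Definition product_identity ys := forall hs ls, size hs = size ys -> size ls = size ys ->
  bsum (size ys) (fun s => triangle ys (map left_state s) hs ls * g (rev s) (rev ys))
  = g ls ys * g (rev hs) (rev ys).

Lemma split_two n1 n2 (s : seq bool) : size s = (n1 + n2).+2 ->
  exists s1 a b s2, [/\ s = s1 ++ a :: b :: s2, size s1 = n1 & size s2 = n2].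
Proof.
elim: n1 s => [|n1 IH] [|a s] //=; first by case: s => // b s [e]; exists [::], a, b, s.
by move=> [/IH [s1 [c [d [s2 [-> <- <-]]]]]]; exists (a :: s1), c, d, s2.
Qed.

Lemma g_act_at ys1 u v ys2 ls : perm_eq (ys1 ++ u :: v :: ys2) Y ->
  size ls = (size ys1 + size ys2).+2 ->
  g ls (ys1 ++ v :: u :: ys2)
  = act_at (size ys1) (Rl (u / v)) ls (fun ls' => g ls' (ys1 ++ u :: v :: ys2)).
Proof.
move=> pY /split_two [s1 [a [b [s2 [-> sz1 sz2]]]]].
by rewrite g_exchange // -sz1 act_at_cat.
Qed.

Lemma g_act_at_rev ys1 u v ys2 hs : perm_eq (ys1 ++ u :: v :: ys2) Y ->
  size hs = (size ys1 + size ys2).+2 ->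
  g (rev hs) (rev (ys1 ++ v :: u :: ys2))
  = act_at (size ys1) (Rh (v / u)) hs (fun hs' => g (rev hs') (rev (ys1 ++ u :: v :: ys2))).
Proof.
move=> pY /split_two [s1 [a [b [s2 [-> sz1 sz2]]]]].
rewrite -sz1 act_at_cat !rev_cat !rev_cons !cat_rcons g_exchange ?size_rev //; last first.
  apply: perm_trans pY; rewrite perm_sym -perm_rev perm_sym.
  by rewrite rev_cat !rev_cons !cat_rcons perm_refl.
by rewrite /Rl /Rh andbC; case: (a && ~~ b) => /=; rewrite !rev_cat !rev_cons !cat_rcons.
Qed.

(** Each side for the swapped list equals [Rh] on [hs] and [Rl] on [ls] applied to the same side for
    the original list. *)
Lemma product_identity_swap ys1 u v ys2 : perm_eq (ys1 ++ u :: v :: ys2) Y ->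
  product_identity (ys1 ++ u :: v :: ys2) -> product_identity (ys1 ++ v :: u :: ys2).
Proof.
move=> pY IH hs ls; rewrite !size_cat /= !addnS => hsz lsz.
have nz : all (fun y => y != 0) (ys1 ++ u :: v :: ys2).
  by apply/allP => y; rewrite (perm_mem pY) => /(allP Y0).
have lin_l := finite_comb_linear (act_at_comb (size ys1) ls (@Rl_comb F (u / v))).
have lin_h := finite_comb_linear (act_at_comb (size ys1) hs (@Rh_comb F (v / u))).
rewrite (g_act_at pY lsz) (g_act_at_rev pY hsz).
set n := (_ + _).+2 in hsz lsz *.
set zs := ys1 ++ u :: v :: ys2.
have szs : size zs = n by rewrite size_cat /= !addnS.
transitivity (act_at (size ys1) (Rh (v / u)) hs (fun hs' =>
  act_at (size ys1) (Rl (u / v)) ls (fun ls' => g ls' zs * g (rev hs') (rev zs)))); last first.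
  rewrite -(linear_functionalZ lin_h); apply: eq_act_at => hs' hsz'; rewrite [RHS]mulrC.
  rewrite -(linear_functionalZ lin_l); apply: eq_act_at => ls' lsz'; exact: mulrC.
transitivity (bsum n (fun s =>
  triangle (ys1 ++ v :: u :: ys2) (map left_state s) hs ls *
  act_at (size ys1) (Rh (v / u)) s (fun s' => g (rev s') (rev zs)))).
  by apply: eq_bsum => s ssz; rewrite g_act_at_rev.
rewrite (act_at_adjoint _ (fun t => triangle (ys1 ++ v :: u :: ys2) t hs ls)); last first.
  by rewrite /n !ltnS leq_addr.
transitivity (bsum n (fun s => act_at (size ys1) (Rh (v / u)) hs (fun hs' =>
  act_at (size ys1) (Rl (u / v)) ls (fun ls' =>
    g (rev s) (rev zs) * triangle zs (map left_state s) hs' ls')))).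
  apply: eq_bsum => s ssz; rewrite triangle_exchange ?size_map ?ssz //.
  rewrite [LHS]mulrC -(linear_functionalZ lin_h); apply: eq_act_at => hs' hsz'.
  by rewrite -(linear_functionalZ lin_l).
have lin_b : linear_functional (@bsum F n) by move=> c f f'; rewrite bsumD bsumZ.
transitivity (act_at (size ys1) (Rh (v / u)) hs (fun hs' =>
  bsum n (fun s => act_at (size ys1) (Rl (u / v)) ls (fun ls' =>
    g (rev s) (rev zs) * triangle zs (map left_state s) hs' ls')))).
  exact: esym (act_at_comb _ _ (@Rh_comb F _) (fun hs' s =>
    act_at (size ys1) (Rl (u / v)) ls (fun ls' =>
    g (rev s) (rev zs) * triangle zs (map left_state s) hs' ls')) lin_b).
apply: eq_act_at => hs' hsz'.
transitivity (act_at (size ys1) (Rl (u / v)) ls (fun ls' =>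
  bsum n (fun s => g (rev s) (rev zs) * triangle zs (map left_state s) hs' ls'))).
  exact: esym (act_at_comb _ _ (@Rl_comb F _) (fun ls' s =>
    g (rev s) (rev zs) * triangle zs (map left_state s) hs' ls') lin_b).
apply: eq_act_at => ls' lsz'; rewrite -szs.
rewrite -IH ?hsz' ?lsz' ?szs ?hsz ?lsz //.
by apply: eq_bsum => s _; rewrite mulrC.
Qed.

Lemma product_identity_base ys1 ys2 : perm_eq (ys1 ++ ys2) Y -> X =i ys2 ->
  product_identity (ys1 ++ ys2).
Proof.
move=> pY Xys hs ls; rewrite size_cat => hsz lsz.
have revn n (c : bool) : rev (nseq n c) = nseq n c.
  by elim: n => //= n IHn; rewrite rev_cons IHn -cats1 -(nseqD n 1) addn1.
have gE s : size s = (size ys1 + size ys2)%N ->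
  g (rev s) (rev (ys1 ++ ys2)) = (s == nseq (size ys1) false ++ nseq (size ys2) true)%:R.
  move=> ssz; rewrite rev_cat g_base ?size_rev ?ssz 1?addnC //; last 2 first.
  - by rewrite -rev_cat perm_rev.
  - by move=> x; rewrite mem_rev.
  by congr (nat_of_bool _)%:R; rewrite -(inj_eq (can_inj revK)) revK rev_cat !revn.
transitivity (triangle (ys1 ++ ys2) (nseq (size ys1) O ++ nseq (size ys2) G) hs ls).
  under eq_bsum => s ssz do rewrite gE //.
  rewrite bsum_delta; first by rewrite map_cat !map_nseq.
  by rewrite size_cat !size_nseq.
rewrite gE // [RHS]mulrC.
have := @triangle_empty_left F Y X g g_exchange g_vanish [::] ys1 ys2 [::] hs ls.
rewrite /= => <- //; last by move=> x; rewrite Xys.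
have -> : nseq (size ys2) G = map in_state (nseq (size ys2) true) by rewrite map_nseq.
(* The single puzzle sum is expanded as a sum over [s] against a delta, which is precisely the value
   of [g] required by [triangle_empty_left]. *)
rewrite -[LHS](bsum_delta (fun s => triangle (ys1 ++ ys2)
  (nseq (size ys1) O ++ map in_state s) hs ls) (size_nseq (size ys2) true)).
apply: eq_bsum => s ssz; rewrite mulrC; congr (_ * _).
rewrite -(revn (size ys1)) -rev_cat gE; first by rewrite eqseq_cat ?eqxx ?size_nseq.
by rewrite size_cat size_nseq ssz.
Qed.

Lemma product_identity_perm ys : {subset X <= Y} -> perm_eq ys Y -> product_identity ys.
Proof.
move=> XY pY.
pose ys1 := [seq y <- Y | y \notin X]; pose ys2 := [seq y <- Y | y \in X].
have p0 : perm_eq (ys1 ++ ys2) Y.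
  by rewrite perm_catC; apply/permPl; exact: perm_filterC.
have p1 : perm_eq (ys1 ++ ys2) ys by rewrite (perm_trans p0) // perm_sym.
suff [] : perm_eq ys Y /\ product_identity ys by [].
apply: (@perm_adjacent_ind _ (fun t => perm_eq t Y /\ product_identity t) _ _ _ p1) => [s1 u v s2 [pu iu]|].
  split; last exact: product_identity_swap.
  apply: perm_trans pu; rewrite perm_cat2l.
  by rewrite -[_ :: _]/([:: v] ++ [:: u] ++ s2) perm_catCA perm_refl.
split=> //; apply: product_identity_base => // x; rewrite mem_filter.
by case: (boolP (x \in X)) => //= /XY ->.
Qed.

End ProductIdentity.

(** * Puzzles as a vertex model *)

Section Split.
Variables (D1 D2 D : finType) (i1 : D1 -> D) (i2 : D2 -> D).
Hypotheses (i1_inj : injective i1) (i2_inj : injective i2).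
Hypothesis disj : forall a b, i1 a != i2 b.
Hypothesis cover : forall d, (exists a, d = i1 a) \/ (exists b, d = i2 b).

Let h (s : D1 + D2) := match s with inl a => i1 a | inr b => i2 b end.

Let h_bij : bijective h.
Proof.
have inj : injective h.
  move=> [a|a] [b|b] /=; [by move=> /i1_inj->| | |by move=> /i2_inj->].
    by move/eqP; rewrite (negPf (disj _ _)).
  by move/esym/eqP; rewrite (negPf (disj _ _)).
have sur d : d \in codom h.
  apply/codomP; case: (cover d) => [[a ->]|[b ->]].
    by exists (inl a).
  by exists (inr b).
exists (fun d => iinv (sur d)) => [s|d]; last exact: f_iinv.
exact: iinv_f.
Qed.

Lemma forall_split (P : pred D) :
  [forall d, P d] = [forall a, P (i1 a)] && [forall b, P (i2 b)].
Proof.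
apply/forallP/andP => [Pd|[/forallP P1 /forallP P2] d].
  by split; apply/forallP => ?; apply: Pd.
by case: (cover d) => [[a ->]|[b ->]].
Qed.

Lemma prod_split (F : fieldType) (E : D -> F) :
  \prod_d E d = (\prod_a E (i1 a)) * \prod_b E (i2 b).
Proof.
rewrite (reindex h) /=; last exact: onW_bij.
by rewrite big_sumType.
Qed.

(** A filling of a disjoint union is a pair of fillings; the two parts will be the leftmost strip
    and the rest of the puzzle. *)
Lemma sum_ffun_split (T : finType) (F : fieldType)
    (E : {ffun D1 -> T} -> {ffun D2 -> T} -> F) :
  \sum_(f : {ffun D -> T}) E [ffun a => f (i1 a)] [ffun b => f (i2 b)]
  = \sum_f1 \sum_f2 E f1 f2.
Proof.
have [g hK gK] := h_bij; rewrite pair_big /=.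
rewrite (reindex (fun p : {ffun D1 -> T} * {ffun D2 -> T} =>
  [ffun d => match g d with inl a => p.1 a | inr b => p.2 b end])) /=.
  apply: eq_bigr => -[f1 f2] _ /=; congr E; apply/ffunP => d; rewrite !ffunE.
    by rewrite -[i1 d]/(h (inl d)) hK.
  by rewrite -[i2 d]/(h (inr d)) hK.
apply: onW_bij; exists (fun f : {ffun D -> T} => ([ffun a => f (i1 a)], [ffun b => f (i2 b)])).
  move=> [f1 f2]; congr pair; apply/ffunP => d; rewrite !ffunE.
    by rewrite -[i1 d]/(h (inl d)) hK.
  by rewrite -[i2 d]/(h (inr d)) hK.
move=> f; apply/ffunP => d; rewrite !ffunE /= -{2}[d]gK.
by case: (g d) => a; rewrite ffunE.
Qed.

End Split.

Lemma sum_ffun_ordS (n : nat) (T : finType) (F : fieldType)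
    (E : T -> {ffun 'I_n -> T} -> F) :
  \sum_(f : {ffun 'I_n.+1 -> T}) E (f ord0) [ffun b => f (lift ord0 b)]
  = \sum_t \sum_f E t f.
Proof.
pose i1 (_ : unit) : 'I_n.+1 := ord0.
have i1i : injective (i1 : unit -> _) by case; case.
have cov (d : 'I_n.+1) : (exists a : unit, d = i1 a) \/ (exists b, d = lift ord0 b).
  by case: (unliftP ord0 d) => [j|] ->; [right; exists j | left; exists tt].
have dis (a : unit) b : i1 a != lift ord0 b by exact: neq_lift.
have := sum_ffun_split i1i (@lift_inj _ ord0) dis cov (fun f1 f2 => E (f1 tt) f2).
under eq_bigr => f _ do rewrite ffunE.
move=> ->; rewrite (reindex (fun t : T => [ffun=> t] : {ffun unit -> T})) /=.
  by apply: eq_bigr => t _; rewrite ffunE.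
apply: onW_bij; exists (fun f : {ffun unit -> T} => f tt) => [t|f]; first by rewrite ffunE.
by apply/ffunP => -[]; rewrite ffunE.
Qed.

Lemma sum_mkcond (F : fieldType) (I : finType) (P : pred I) (E : I -> F) :
  \sum_(i | P i) E i = \sum_i (P i)%:R * E i.
Proof.
by rewrite big_mkcond; apply: eq_bigr => i _; case: (P i); rewrite ?mul1r ?mul0r.
Qed.

Lemma sum_tile (F : fieldType) (E : tile -> F) :
  \sum_t E t = E tE + E tG1 + E tG2 + E tR1 + E tR2 + E tQ + E tK.
Proof.
have decodeK : cancel tile_decode tile_code.
  move=> c; apply: val_inj; rewrite /tile_decode; case: c => -[|[|[|[|[|[|[|c]]]]]]] //= _;
  by rewrite inordK.
rewrite (reindex tile_decode) /=.
  by rewrite !big_ord_recr big_ord0 /= add0r.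
by apply: onW_bij; exists tile_code => //; exact: tile_codeK.
Qed.

(** This is where the table of [lozenge] is checked against the tiles and the modified weights. *)
Lemma lozenge_tiles (F : fieldType) w a b (f : state -> state -> F) :
  \sum_t \sum_s [&& s != tK, hstate s == hstate t, astate t == a & bstate s == b]%:R
    * (lozenge_weight w t s * f (bstate t) (astate s)) = lozenge w a b f.
Proof.
rewrite !sum_tile.
have neqK s : (s != tK) = if s is tK then false else true.
  by case: s; apply/eqP.
rewrite !neqK.
by case: a b => [[] []] [[] []]; rewrite /= ?(mul0r, mul1r, add0r, addr0); ring.
Qed.

Section StripSum.
Variable F : fieldType.
Implicit Types (b : state).

(** The lower left edge of a lozenge is the b-edge of the up-pointing triangle of the previous
    lozenge; prepending [b] to the list shifts the index by one and provides the first edge. *)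
Definition strip_valid n b (A : 'I_n -> state) (f g : {ffun 'I_n -> tile}) :=
  [forall q, [&& g q != tK, hstate (g q) == hstate (f q), astate (f q) == A q
    & bstate (g q) == nth O (b :: [seq bstate (f q) | q <- enum 'I_n]) q]].

Lemma map_enum_ordS T n (f : 'I_n.+1 -> T) :
  map f (enum 'I_n.+1) = f ord0 :: map (f \o lift ord0) (enum 'I_n).
Proof. by rewrite enum_ordSl /= -map_comp. Qed.

Lemma forall_ordS n (P : pred 'I_n.+1) :
  [forall q, P q] = P ord0 && [forall q, P (lift ord0 q)].
Proof.
apply/forallP/andP => [Pq|[P0 /forallP Pq] q]; first by split=> //; apply/forallP.
by case: (unliftP ord0 q) => [j|] ->.
Qed.

Lemma strip_validS n b (A : 'I_n.+1 -> state) (f g : {ffun 'I_n.+1 -> tile}) :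
  strip_valid b A f g
  = [&& g ord0 != tK, hstate (g ord0) == hstate (f ord0), astate (f ord0) == A ord0
      & bstate (g ord0) == b]
    && strip_valid (bstate (f ord0)) (A \o lift ord0)
        [ffun q => f (lift ord0 q)] [ffun q => g (lift ord0 q)].
Proof.
rewrite /strip_valid forall_ordS /=; congr (_ && _).
apply: eq_forallb => q; rewrite map_enum_ordS !ffunE /=.
by congr [&& _, _, _ & _ == nth _ (_ :: _) _]; apply: eq_map => j; rewrite /= ffunE.
Qed.

Lemma strip_tiles n (y0 : F) (y : 'I_n -> F) b (A : 'I_n -> state) (f : state -> seq state -> F) :
  \sum_(u : {ffun 'I_n -> tile}) \sum_(d : {ffun 'I_n -> tile})
    (strip_valid b A u d)%:R * ((\prod_q lozenge_weight (y q / y0) (u q) (d q))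
      * f (last b [seq bstate (u q) | q <- enum 'I_n]) [seq astate (d q) | q <- enum 'I_n])
  = strip y0 b [seq y q | q <- enum 'I_n] [seq A q | q <- enum 'I_n] f.
Proof.
elim: n y b A f => [|n IH] y b A f.
  have e0 : enum 'I_0 = [::] by apply: size0nil; rewrite size_enum_ord.
  have ff0 (u : {ffun 'I_0 -> tile}) : u = [ffun=> tE] by apply/ffunP => -[].
  rewrite e0 /= (big_pred1 [ffun=> tE]) /= => [|u]; last by apply/esym/eqP; exact: ff0.
  rewrite (big_pred1 [ffun=> tE]) /= => [|u]; last by apply/esym/eqP; exact: ff0.
  have -> : strip_valid b A [ffun=> tE] [ffun=> tE] by apply/forallP => -[].
  by rewrite big_ord0 !mul1r.
rewrite !map_enum_ordS /= -lozenge_tiles.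
pose E t u' s d' := ([&& s != tK, hstate s == hstate t, astate t == A ord0 & bstate s == b]
    && strip_valid (bstate t) (A \o lift ord0) u' d')%:R *
   ((lozenge_weight (y ord0 / y0) t s *
     \prod_q lozenge_weight ((y \o lift ord0) q / y0) (u' q) (d' q))
   * f (last (bstate t) [seq bstate (u' q) | q <- enum 'I_n])
       (astate s :: [seq astate (d' q) | q <- enum 'I_n])).
transitivity (\sum_(u : {ffun 'I_n.+1 -> tile}) \sum_(d : {ffun 'I_n.+1 -> tile})
    E (u ord0) [ffun q => u (lift ord0 q)] (d ord0) [ffun q => d (lift ord0 q)]).
  apply: eq_bigr => u _; apply: eq_bigr => d _.
  rewrite strip_validS /E !map_enum_ordS big_ord_recl /=.
  congr (_ * (_ * _ * f (last _ _) (_ :: _)));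
    [apply: eq_bigr => q _|apply: eq_map => q|apply: eq_map => q];
    by rewrite /= !ffunE.
under eq_bigr => u _ do rewrite (sum_ffun_ordS (E (u ord0) [ffun q => u (lift ord0 q)])).
rewrite (sum_ffun_ordS (fun t u' => \sum_s \sum_d' E t u' s d')).
apply: eq_bigr => t _; rewrite exchange_big /=; apply: eq_bigr => s _.
rewrite [RHS]mulrA -IH !mulr_sumr; apply: eq_bigr => u' _.
rewrite !mulr_sumr; apply: eq_bigr => d' _.
by rewrite /E -mulnb natrM; ring.
Qed.

End StripSum.

Section PuzzleSum.
Variable F : fieldType.

(** Unlike [has_boundary], it allows any states on the left side: once a strip is removed, the new
    left side is made of inner edges of the puzzle. *)
Definition boundary n (A : 'I_n -> state) (H L : 'I_n -> bool) (P : puzzle_filling n) :=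
  [&& [forall u : uptri n, ((val u).1 + (val u).2 == n.-1)%N ==>
        (bstate (P.1 u) == out_state (L (val u).1))],
      [forall u : uptri n, ((val u).2 == 0%N :> nat) ==>
        (hstate (P.1 u) == if H (val u).1 then sG else sR)]
    & [forall u : uptri n, ((val u).1 == 0%N :> nat) ==>
        (astate (P.1 u) == A (val u).2)]].


Definition up_strip n (q : 'I_n.+1) : uptri n.+1 :=
  @exist _ (fun pq : 'I_n.+1 * 'I_n.+1 => (pq.1 + pq.2 < n.+1)%N) (ord0, q) (ltn_ord q).
Definition up_rest n (u : uptri n) : uptri n.+1 :=
  @exist _ (fun pq : 'I_n.+1 * 'I_n.+1 => (pq.1 + pq.2 < n.+1)%N)
    (lift ord0 (val u).1, widen_ord (leqnSn n) (val u).2) (valP u).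
(** Index shift: the lowest up-pointing triangle of the strip has no partner, so lozenge [q] has the
    up-pointing triangle [q + 1]. *)
Definition down_strip n (q : 'I_n) : downtri n.+1 :=
  @exist _ (fun u : uptri n.+1 => (0 < (val u).2)%N) (up_strip (lift ord0 q)) isT.
Definition down_rest n (v : downtri n) : downtri n.+1 :=
  @exist _ (fun u : uptri n.+1 => (0 < (val u).2)%N) (up_rest (val v)) (valP v).

Section Recursion.
Variable n : nat.

Lemma up_strip_inj : injective (@up_strip n).
Proof. by move=> a b e; exact: (congr1 (fun u : uptri n.+1 => (val u).2) e). Qed.

Lemma up_rest_inj : injective (@up_rest n).
Proof.
move=> [[p q] pq] [[p' q'] pq'] /(congr1 val)[] /= e1 e2.
by apply: val_inj; congr pair; apply: val_inj.
Qed.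

Lemma up_disj (q : 'I_n.+1) (u : uptri n) : up_strip q != up_rest u.
Proof. by apply/eqP => /(congr1 val)[]. Qed.

Lemma up_cover (u : uptri n.+1) :
  (exists q, u = up_strip q) \/ (exists u', u = up_rest u').
Proof.
case: u => -[p q] /= pq; case: (unliftP ord0 p) => [j|] ep; last first.
  by left; exists q; apply: val_inj; rewrite /= ep.
have lt : (j + q < n)%N by rewrite ep in pq.
have qn : (q < n)%N by apply: leq_ltn_trans lt; exact: leq_addl.
right; exists (@exist _ (fun pq : 'I_n * 'I_n => (pq.1 + pq.2 < n)%N) (j, Ordinal qn) lt).
by apply: val_inj; rewrite /= ep; congr pair; apply: val_inj.
Qed.

Lemma down_strip_inj : injective (@down_strip n).
Proof.
by move=> a b /(congr1 val) /up_strip_inj /lift_inj.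
Qed.

Lemma down_rest_inj : injective (@down_rest n).
Proof. by move=> a b /(congr1 val) /up_rest_inj /val_inj. Qed.

Lemma down_disj (q : 'I_n) (v : downtri n) : down_strip q != down_rest v.
Proof. by apply/eqP => /(congr1 val)/eqP; rewrite (negPf (up_disj _ _)). Qed.

Lemma down_cover (v : downtri n.+1) :
  (exists q, v = down_strip q) \/ (exists v', v = down_rest v').
Proof.
case: v => u u0; case: (up_cover u) => -[x ex].
  left; case: (unliftP ord0 x) => [j|] ej; last by move: u0; rewrite ex ej.
  by exists j; apply: val_inj; rewrite /= ex ej.
have x0 : (0 < (val x).2)%N by move: u0; rewrite ex.
right; exists (@exist _ (fun u : uptri n => (0 < (val u).2)%N) x x0).
by apply: val_inj; rewrite /= ex.
Qed.

(** The a-edges between the strip and the rest are matching conditions for the whole puzzle and the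
    left boundary condition [astate \o g0] for the rest. *)
Lemma boundary_split (A : 'I_n.+1 -> state) (H L : 'I_n.+1 -> bool)
    (f : {ffun uptri n.+1 -> tile}) (g : {ffun downtri n.+1 -> tile}) :
  let f0 := [ffun q => f (up_strip q)] in
  let f1 := [ffun u => f (up_rest u)] in
  let g0 := [ffun q => g (down_strip q)] in
  let g1 := [ffun v => g (down_rest v)] in
  is_puzzle (f, g) && boundary A H L (f, g)
  = [&& astate (f0 ord0) == A ord0, hstate (f0 ord0) == (if H ord0 then sG else sR),
        strip_valid (bstate (f0 ord0)) (A \o lift ord0) [ffun q => f0 (lift ord0 q)] g0
      & bstate (f0 ord_max) == out_state (L ord0)]
    && (is_puzzle (f1, g1) &&
        boundary (astate \o g0) (H \o lift ord0) (L \o lift ord0) (f1, g1)).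
Proof.
move=> f0 f1 g0 g1; rewrite /is_puzzle /boundary /=.
have c1 : [forall v, g v != tK] = [forall q, g0 q != tK] && [forall v, g1 v != tK].
  rewrite (forall_split down_cover).
  by congr andb; apply: eq_forallb => q; rewrite ffunE.
have c2 : [forall v, hstate (g v) == hstate (f (above v))]
  = [forall q, hstate (g0 q) == hstate (f0 (lift ord0 q))]
    && [forall v, hstate (g1 v) == hstate (f1 (above v))].
  rewrite (forall_split down_cover).
  by congr andb; apply: eq_forallb => q; rewrite !ffunE.
have sU := forall_split up_cover.
have sD := forall_split down_cover.
have c3 : [forall v : downtri n.+1, forall u : uptri n.+1,
        ((val u).1 == (val (above v)).1) && ((val u).2.+1 == (val (above v)).2 :> nat)
          ==> (bstate (g v) == bstate (f u))]
  = [forall q, bstate (g0 q) == bstate (f0 (widen_ord (leqnSn n) q))]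
    && [forall v : downtri n, forall u : uptri n,
        ((val u).1 == (val (above v)).1) && ((val u).2.+1 == (val (above v)).2 :> nat)
          ==> (bstate (g1 v) == bstate (f1 u))].
  rewrite sD; congr andb; apply: eq_forallb => q.
    rewrite !ffunE; apply/forallP/idP => [/(_ (up_strip (widen_ord (leqnSn n) q)))|/eqP e u].
      by rewrite /= !eqxx.
    apply/implyP => /andP[/eqP e1 /eqP [e2]]; rewrite e; apply/eqP; congr (bstate (f _)).
    apply: val_inj; rewrite [RHS]surjective_pairing e1; congr pair.
    by apply: val_inj; rewrite /= e2.
  rewrite sU [X in X && _](_ : _ = true) ?andTb; last by apply/forallP.
  by apply: eq_forallb => u; rewrite !ffunE /= (inj_eq (@lift_inj _ _)).
have c4 : [forall v : downtri n.+1, forall u : uptri n.+1,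
        ((val u).1 == (val (above v)).1.+1 :> nat) &&
        ((val u).2.+1 == (val (above v)).2 :> nat)
          ==> (astate (g v) == astate (f u))]
  = [forall u : uptri n, ((val u).1 == 0%N :> nat) ==>
        (astate (f1 u) == astate (g0 (val u).2))]
    && [forall v : downtri n, forall u : uptri n,
        ((val u).1 == (val (above v)).1.+1 :> nat) &&
        ((val u).2.+1 == (val (above v)).2 :> nat)
          ==> (astate (g1 v) == astate (f1 u))].
  rewrite sD; congr andb; last first.
    apply: eq_forallb => q.
    rewrite sU [X in X && _](_ : _ = true) ?andTb; last by apply/forallP.
    by apply: eq_forallb => u; rewrite !ffunE.
  apply/forallP/forallP => [h u|h q].
    rewrite !ffunE; apply/implyP => u0; have /forallP/(_ (up_rest u)) := h (val u).2.
    by rewrite /= /bump /= eqSS u0 eqxx /= eq_sym.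
  rewrite sU; apply/andP; split; apply/forallP => // u.
  apply/implyP => /andP[/= e1 e2]; have := h u; rewrite !ffunE.
  rewrite -eqSS e1 /= eq_sym => /eqP <-; apply/eqP; congr (astate (g (down_strip _))).
  by apply: val_inj; move/eqP: e2 => /= [].
have b1 : [forall u : uptri n.+1, ((val u).1 + (val u).2 == n.+1.-1)%N ==>
        (bstate (f u) == out_state (L (val u).1))]
  = (bstate (f0 ord_max) == out_state (L ord0))
   && [forall u : uptri n, ((val u).1 + (val u).2 == n.-1)%N ==>
        (bstate (f1 u) == out_state (L (lift ord0 (val u).1)))].
  rewrite sU; congr andb.
    rewrite ffunE; apply/forallP/idP => [/(_ ord_max)|/eqP e q]; first by rewrite /= eqxx.
    by apply/implyP => /= /eqP eq; rewrite -e; apply/eqP; congr (bstate (f (up_strip _))); apply: val_inj.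
  apply: eq_forallb => -[[p q] /= pq]; rewrite ffunE; congr (_ ==> _).
  have pred_eq (a m : nat) : (a < m)%N -> (a.+1 == m) = (a == m.-1) by case: m.
  exact: pred_eq.
have b2 : [forall u : uptri n.+1, ((val u).2 == 0%N :> nat) ==>
        (hstate (f u) == if H (val u).1 then sG else sR)]
  = (hstate (f0 ord0) == if H ord0 then sG else sR)
    && [forall u : uptri n, ((val u).2 == 0%N :> nat) ==>
        (hstate (f1 u) == if H (lift ord0 (val u).1) then sG else sR)].
  rewrite sU; congr andb; last by apply: eq_forallb => u; rewrite ffunE.
  rewrite ffunE; apply/forallP/idP => [/(_ ord0)//|/eqP e q].
  by apply/implyP => /= /eqP eq; rewrite -e; apply/eqP; congr (hstate (f (up_strip _))); apply: val_inj.
have b3 : [forall u : uptri n.+1, ((val u).1 == 0%N :> nat) ==> (astate (f u) == A (val u).2)]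
  = [forall q, astate (f0 q) == A q].
  rewrite sU [X in _ && X](_ : _ = true) ?andbT; last by apply/forallP.
  by apply: eq_forallb => q; rewrite ffunE.
rewrite c1 c2 c3 c4 b1 b2 b3 forall_ordS; clearbody f0 f1 g0 g1.
have -> : strip_valid (bstate (f0 ord0)) (A \o lift ord0) [ffun q => f0 (lift ord0 q)] g0
  = [&& [forall q, g0 q != tK], [forall q, hstate (g0 q) == hstate (f0 (lift ord0 q))],
     [forall q, astate (f0 (lift ord0 q)) == A (lift ord0 q)]
   & [forall q, bstate (g0 q) == bstate (f0 (widen_ord (leqnSn n) q))]].
  have nthE (q : 'I_n) : nth O (bstate (f0 ord0) ::
     [seq bstate ([ffun q => f0 (lift ord0 q)] q) | q <- enum 'I_n]) q
     = bstate (f0 (widen_ord (leqnSn n) q)).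
    have -> : bstate (f0 ord0) :: [seq bstate ([ffun q => f0 (lift ord0 q)] q) | q <- enum 'I_n]
      = [seq bstate (f0 q) | q <- enum 'I_n.+1].
      rewrite map_enum_ordS; congr cons; apply: eq_map => j; by rewrite /= ffunE.
    rewrite (nth_map ord0) ?size_enum_ord; last by rewrite ltnS ltnW.
    by congr (bstate (f0 _)); apply: val_inj; rewrite /= nth_enum_ord // ltnS ltnW.
  apply/forallP/and4P => [h|[/forallP h1 /forallP h2 /forallP h3 /forallP h4] q].
    split; apply/forallP => q; have := h q; rewrite ffunE nthE => /and4P[] //.
  by rewrite ffunE nthE h1 h2 h3 h4.
(* Both sides are conjunctions of the same booleans in different orders; each of them is destructed
   in turn. *)
by do ?[match goal with |- context [andb ?b _] => lazymatch b with andb _ _ => fail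
  | _ => case: b; rewrite ?andbT ?andbF //= end end].
Qed.

Lemma puzzle_weight_split (y : 'I_n.+1 -> F)
    (f : {ffun uptri n.+1 -> tile}) (g : {ffun downtri n.+1 -> tile}) :
  let f0 := [ffun q => f (up_strip q)] in
  let f1 := [ffun u => f (up_rest u)] in
  let g0 := [ffun q => g (down_strip q)] in
  let g1 := [ffun v => g (down_rest v)] in
  puzzle_weight y (f, g)
  = (\prod_q lozenge_weight (y (lift ord0 q) / y ord0) (f0 (lift ord0 q)) (g0 q))
    * puzzle_weight (y \o lift ord0) (f1, g1).
Proof.
move=> f0 f1 g0 g1; rewrite /puzzle_weight.
rewrite (prod_split down_strip_inj down_rest_inj down_disj down_cover).
congr (_ * _); apply: eq_bigr => v _; rewrite /= !ffunE.
  by congr (lozenge_weight (y _ / y _)); apply: val_inj.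
congr (lozenge_weight (y _ / y _)); by apply: val_inj.
Qed.

End Recursion.

Lemma bottom_triangle_tiles a h (f : state -> F) :
  \sum_t ((astate t == a) && (hstate t == if h then sG else sR))%:R * f (bstate t)
  = bottom_triangle a h f.
Proof.
rewrite sum_tile.
by case: a h => [[] []] []; rewrite /= ?(mul0r, mul1r, add0r, addr0).
Qed.

Definition boundary_sum n (y : 'I_n -> F) A H L : F :=
  \sum_(P : puzzle_filling n | is_puzzle P && boundary A H L P) puzzle_weight y P.

Lemma boundary_sumE n (y : 'I_n -> F) A H L : boundary_sum y A H L
  = \sum_f \sum_g (is_puzzle (f, g) && boundary A H L (f, g))%:R * puzzle_weight y (f, g).
Proof.
rewrite /boundary_sum sum_mkcond.
by rewrite -(pair_bigA _ (fun f g => (is_puzzle (f, g) && boundary A H L (f, g))%:R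
  * puzzle_weight y (f, g))).
Qed.

Lemma boundary_sum_triangle n (y : 'I_n -> F) A H L :
  boundary_sum y A H L
  = triangle [seq y q | q <- enum 'I_n] [seq A q | q <- enum 'I_n]
      [seq H q | q <- enum 'I_n] [seq L q | q <- enum 'I_n].
Proof.
elim: n y A H L => [|n IH] y A H L.
  have e0 : enum 'I_0 = [::] by apply: size0nil; rewrite size_enum_ord.
  rewrite e0 /= /boundary_sum.
  have noU (u : uptri 0) : False by case: u => -[[]].
  have noD (v : downtri 0) : False by case: v => -[[[]]].
  rewrite (big_pred1 ([ffun=> tE], [ffun=> tE])) /=.
    by rewrite /puzzle_weight big1 // => v; case: (noD v).
  move=> [f g]; rewrite /=; transitivity true; last first.
    by apply/esym/eqP; congr pair; apply/ffunP => t; [case: (noU t)|case: (noD t)].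
  rewrite /is_puzzle /boundary; apply/andP; split.
    by apply/and4P; split; apply/forallP => t; case: (noD t).
  by apply/and3P; split; apply/forallP => t; case: (noU t).
rewrite boundary_sumE.
pose E (f0 : {ffun 'I_n.+1 -> tile}) (f1 : {ffun uptri n -> tile})
    (g0 : {ffun 'I_n -> tile}) (g1 : {ffun downtri n -> tile}) : F :=
  ([&& astate (f0 ord0) == A ord0, hstate (f0 ord0) == (if H ord0 then sG else sR),
        strip_valid (bstate (f0 ord0)) (A \o lift ord0) [ffun q => f0 (lift ord0 q)] g0
      & bstate (f0 ord_max) == out_state (L ord0)]
    && (is_puzzle (f1, g1) &&
        boundary (astate \o g0) (H \o lift ord0) (L \o lift ord0) (f1, g1)))%:R
  * ((\prod_q lozenge_weight (y (lift ord0 q) / y ord0) (f0 (lift ord0 q)) (g0 q))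
    * puzzle_weight (y \o lift ord0) (f1, g1)).
transitivity (\sum_f0 \sum_f1 \sum_g0 \sum_g1 E f0 f1 g0 g1).
  rewrite -(sum_ffun_split (@up_strip_inj n) (@up_rest_inj n) (@up_disj n) (@up_cover n)
    (fun f0 f1 => \sum_g0 \sum_g1 E f0 f1 g0 g1)).
  apply: eq_bigr => f _.
  rewrite -(sum_ffun_split (@down_strip_inj n) (@down_rest_inj n) (@down_disj n)
    (@down_cover n) (E _ _)).
  by apply: eq_bigr => g _; rewrite boundary_split puzzle_weight_split.
rewrite !map_enum_ordS /= -bottom_triangle_tiles.
pose Phi b s := (b == out_state (L ord0))%:R * triangle [seq (y \o lift ord0) q | q <- enum 'I_n] s
   [seq (H \o lift ord0) q | q <- enum 'I_n] [seq (L \o lift ord0) q | q <- enum 'I_n].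
pose E1 t (u : {ffun 'I_n -> tile}) : F :=
  ((astate t == A ord0) && (hstate t == if H ord0 then sG else sR))%:R *
  \sum_(d : {ffun 'I_n -> tile}) (strip_valid (bstate t) (A \o lift ord0) u d)%:R *
    ((\prod_q lozenge_weight ((y \o lift ord0) q / y ord0) (u q) (d q)) *
    Phi (last (bstate t) [seq bstate (u q) | q <- enum 'I_n])
        [seq astate (d q) | q <- enum 'I_n]).
transitivity (\sum_(f0 : {ffun 'I_n.+1 -> tile}) E1 (f0 ord0) [ffun q => f0 (lift ord0 q)]).
  apply: eq_bigr => f0 _; rewrite exchange_big /= /E1 mulr_sumr; apply: eq_bigr => g0 _.
  have -> : last (bstate (f0 ord0)) [seq bstate ([ffun q => f0 (lift ord0 q)] q) | q <- enum 'I_n]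
    = bstate (f0 ord_max).
    rewrite (last_nth O) size_map size_enum_ord.
    have -> : bstate (f0 ord0) :: [seq bstate ([ffun q => f0 (lift ord0 q)] q) | q <- enum 'I_n]
      = [seq bstate (f0 q) | q <- enum 'I_n.+1].
      by rewrite map_enum_ordS; congr cons; apply: eq_map => q; rewrite /= ffunE.
    rewrite (nth_map ord0) ?size_enum_ord //.
    by congr (bstate (f0 _)); apply: val_inj; rewrite /= nth_enum_ord.
  rewrite /Phi -(IH (y \o lift ord0) (astate \o g0) (H \o lift ord0) (L \o lift ord0)).
  rewrite boundary_sumE.
  rewrite !mulr_sumr; apply: eq_bigr => f1 _.
  rewrite !mulr_sumr; apply: eq_bigr => g1 _.
  rewrite /E -!mulnb !natrM.
  have -> : \prod_q lozenge_weight ((y \o lift ord0) q / y ord0)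
     ([ffun q0 => f0 (lift ord0 q0)] q) (g0 q)
     = \prod_q lozenge_weight (y (lift ord0 q) / y ord0) (f0 (lift ord0 q)) (g0 q).
    by apply: eq_bigr => q _; rewrite ffunE.
  by ring.
rewrite (sum_ffun_ordS E1); apply: eq_bigr => t _.
by rewrite /E1 -mulr_sumr strip_tiles.
Qed.

End PuzzleSum.

Lemma puzzle_sum_triangle (F : fieldType) n (y : 'I_n -> F) lam mu nu :
  puzzle_sum y lam mu nu
  = triangle [seq y q | q <- enum 'I_n]
      [seq left_state (rev_ord q \in nu) | q <- enum 'I_n]
      [seq rev_ord q \in mu | q <- enum 'I_n] [seq q \in lam | q <- enum 'I_n].
Proof. exact: boundary_sum_triangle. Qed.

(** * Evaluation of Laurent polynomials *)

Lemma subf_div (F : fieldType) (a b c d : F) :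
  b != 0 -> d != 0 -> a / b - c / d = (a * d - c * b) / (b * d).
Proof. by move=> b0 d0; rewrite -mulNr addf_div // mulNr. Qed.

Section Regular.
Variables (m : nat) (F : fieldType) (v : 'I_m -> F).
Implicit Types (f g : {fraction {mpoly int[m]}}).

(** The fractions for which [rateval v] has a specified value; on them it is compatible with the
    ring operations. *)
Definition regular f := exists p q : {mpoly int[m]},
  polyeval v q != 0 /\ f = FracField.tofrac p / FracField.tofrac q.

Lemma polyeval_tofrac_neq0 (q : {mpoly int[m]}) :
  polyeval v q != 0 -> FracField.tofrac q != 0.
Proof.
by apply: contraNneq => /eqP; rewrite tofrac_eq0 => /eqP->; rewrite /polyeval mmap0.
Qed.

Lemma regularM_rateval f g : regular f -> regular g ->
  regular (f * g) /\ rateval v (f * g) = rateval v f * rateval v g.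
Proof.
move=> [p [q [q0 ->]]] [p' [q' [q'0 ->]]].
have qq0 : polyeval v (q * q') != 0 by rewrite /polyeval rmorphM mulf_neq0.
rewrite mulf_div -!tofracM; split; first by exists (p * p'), (q * q').
by rewrite !rateval_frac // /polyeval !rmorphM mulf_div.
Qed.

Lemma regularD_rateval f g : regular f -> regular g ->
  regular (f + g) /\ rateval v (f + g) = rateval v f + rateval v g.
Proof.
move=> [p [q [q0 ->]]] [p' [q' [q'0 ->]]].
have qq0 : polyeval v (q * q') != 0 by rewrite /polyeval rmorphM mulf_neq0.
rewrite addf_div ?polyeval_tofrac_neq0 // -!tofracM -tofracD; split.
  by exists (p * q' + p' * q), (q * q').
by rewrite !rateval_frac // /polyeval rmorphD !rmorphM addf_div.
Qed.

Lemma regular_poly p : regular (FracField.tofrac p) /\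
  rateval v (FracField.tofrac p) = polyeval v p.
Proof.
have q1 : polyeval v 1 != 0 by rewrite /polyeval rmorph1 oner_neq0.
have -> : FracField.tofrac p = FracField.tofrac p / FracField.tofrac 1.
  by rewrite tofrac1 divr1.
split; first by exists p, 1.
by rewrite rateval_frac // /polyeval rmorph1 divr1.
Qed.

Lemma regular_const (c : int) :
  regular c%:~R /\ rateval v c%:~R = c%:~R.
Proof.
have [r e] := regular_poly c%:~R; move: r e; rewrite rmorph_int => r ->.
by rewrite /polyeval rmorph_int.
Qed.

Lemma regular_var i : regular (ratvar i) /\ rateval v (ratvar i) = v i.
Proof.
by have [r ->] := regular_poly 'X_i; rewrite /polyeval mmapX mmap1U.
Qed.

Lemma regularN_rateval f : regular f -> regular (- f) /\ rateval v (- f) = - rateval v f.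
Proof.
move=> rf; have [rN eN] := regular_const (-1).
have := regularM_rateval rN rf; rewrite eN mulrN1z !mulN1r.
by case.
Qed.

Lemma regularB_rateval f g : regular f -> regular g ->
  regular (f - g) /\ rateval v (f - g) = rateval v f - rateval v g.
Proof.
move=> rf rg; have [rN eN] := regularN_rateval rg.
by rewrite -eN; exact: regularD_rateval.
Qed.

Lemma regularV_rateval f : regular f -> rateval v f != 0 ->
  regular f^-1 /\ rateval v f^-1 = (rateval v f)^-1.
Proof.
move=> [p [q [q0 ->]]]; rewrite rateval_frac // => pq0.
have p0 : polyeval v p != 0 by apply: contraNneq pq0 => ->; rewrite mul0r.
by rewrite !invf_div; split; [exists q, p | rewrite rateval_frac].
Qed.

Lemma regular_sum_rateval I (r : seq I) (P : pred I) (E : I -> {fraction {mpoly int[m]}}) :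
  (forall i, P i -> regular (E i)) ->
  regular (\sum_(i <- r | P i) E i)
  /\ rateval v (\sum_(i <- r | P i) E i) = \sum_(i <- r | P i) rateval v (E i).
Proof.
move=> rE; elim: r => [|i r [IH1 IH2]].
  by rewrite !big_nil; exact: (regular_const 0).
rewrite !big_cons; case: ifP => // Pi; rewrite -IH2.
exact: regularD_rateval (rE _ Pi) IH1.
Qed.

Lemma regular_prod_rateval I (r : seq I) (P : pred I) (E : I -> {fraction {mpoly int[m]}}) :
  (forall i, P i -> regular (E i)) ->
  regular (\prod_(i <- r | P i) E i)
  /\ rateval v (\prod_(i <- r | P i) E i) = \prod_(i <- r | P i) rateval v (E i).
Proof.
move=> rE; elim: r => [|i r [IH1 IH2]].
  by rewrite !big_nil; exact: (regular_const 1).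
rewrite !big_cons; case: ifP => // Pi; rewrite -IH2.
exact: regularM_rateval (rE _ Pi) IH1.
Qed.

End Regular.

Section Laurent.
Variables (m : nat) (F : fieldType) (v : 'I_m -> F).
Hypothesis v0 : forall i, v i != 0.
Implicit Types (f g : F).

Lemma polyevalX (e : 'X_{1..m}) : polyeval v 'X_[e] = \prod_(i < m) v i ^+ e i.
Proof. by rewrite /polyeval mmapX. Qed.

Lemma monomial_neq0 (e : 'X_{1..m}) : \prod_(i < m) v i ^+ e i != 0.
Proof. by apply/prodf_neq0 => i _; rewrite expf_neq0. Qed.

Lemma laurentE f :
  laurent v f <-> exists p (e : 'X_{1..m}), f = polyeval v p / polyeval v 'X_[e].
Proof.
by split=> -[p [e ->]]; exists p, e; rewrite polyevalX.
Qed.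

Lemma laurent_poly p : laurent v (polyeval v p).
Proof. by apply/laurentE; exists p, 0%MM; rewrite mpolyX0 /polyeval rmorph1 divr1. Qed.

Lemma laurentM f g : laurent v f -> laurent v g -> laurent v (f * g).
Proof.
move=> /laurentE[p [e ->]] /laurentE[q [e' ->]]; apply/laurentE.
by exists (p * q), (e + e')%MM; rewrite mpolyXD /polyeval !rmorphM mulf_div.
Qed.

Lemma laurentD f g : laurent v f -> laurent v g -> laurent v (f + g).
Proof.
move=> /laurentE[p [e ->]] /laurentE[q [e' ->]]; apply/laurentE.
exists (p * 'X_[e'] + q * 'X_[e]), (e + e')%MM.
rewrite addf_div ?polyevalX ?monomial_neq0 // -!polyevalX.
by rewrite mpolyXD /polyeval rmorphD !rmorphM.
Qed.

Lemma laurent_const (c : int) : laurent v c%:~R.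
Proof.
have -> : c%:~R = polyeval v c%:~R by rewrite /polyeval rmorph_int.
exact: laurent_poly.
Qed.

Lemma laurentN f : laurent v f -> laurent v (- f).
Proof. by move=> lf; rewrite -mulN1r; apply: laurentM lf; exact: (laurent_const (-1)). Qed.

Lemma laurentB f g : laurent v f -> laurent v g -> laurent v (f - g).
Proof. by move=> lf lg; apply: laurentD => //; exact: laurentN. Qed.

Lemma laurent_var i : laurent v (v i).
Proof. by have := laurent_poly 'X_i; rewrite /polyeval mmapX mmap1U. Qed.

Lemma laurent_varV i : laurent v (v i)^-1.
Proof.
apply/laurentE; exists 1, U_(i)%MM.
by rewrite /polyeval rmorph1 mmapX mmap1U div1r.
Qed.

Lemma laurent_sum I (r : seq I) (P : pred I) (E : I -> F) :
  (forall i, P i -> laurent v (E i)) -> laurent v (\sum_(i <- r | P i) E i).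
Proof.
move=> lE; elim/big_ind: _ => //; first exact: (laurent_const 0).
exact: laurentD.
Qed.

Lemma laurent_prod I (r : seq I) (P : pred I) (E : I -> F) :
  (forall i, P i -> laurent v (E i)) -> laurent v (\prod_(i <- r | P i) E i).
Proof.
move=> lE; elim/big_ind: _ => //; first exact: (laurent_const 1).
exact: laurentM.
Qed.

End Laurent.

Lemma polyeval_rename m m' (h : 'I_m -> 'I_m') (F : fieldType) (v : 'I_m' -> F)
    (p : {mpoly int[m]}) :
  polyeval v (mmap (@mpolyC m' int) (fun i => 'X_(h i)) p) = polyeval (v \o h) p.
Proof.
rewrite /polyeval [mmap (@mpolyC _ _) _ _]/mmap rmorph_sum; apply: eq_bigr => e _ /=.
rewrite rmorphM /= mmapC; congr (_ * _).
rewrite /mmap1 rmorph_prod; apply: eq_bigr => i _.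
by rewrite rmorphXn /= mmapX mmap1U.
Qed.

Section LaurentRatvar.
Variable m : nat.
Implicit Types (f g : {fraction {mpoly int[m]}}).

Lemma ratvar_neq0 (i : 'I_m) : ratvar i != 0.
Proof.
rewrite tofrac_eq0; apply: contraTneq isT => /(congr1 (mcoeff U_(i)))/eqP.
by rewrite mcoeffX eqxx mcoeff0 oner_eq0.
Qed.

Lemma polyeval_id (p : {mpoly int[m]}) : polyeval (@ratvar m) p = FracField.tofrac p.
Proof.
rewrite -[in RHS](msym1m p) -polyeval_ratvar.
by congr (mmap _ _ _); apply: functional_extensionality => i; rewrite perm1.
Qed.

Lemma laurent_regular (F : fieldType) (v : 'I_m -> F) f :
  (forall i, v i != 0) -> laurent (@ratvar m) f -> regular v f.
Proof.
move=> v0 /laurentE[p [e ->]]; rewrite !polyeval_id; exists p, 'X_[e].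
by rewrite polyevalX monomial_neq0.
Qed.

Lemma polyeval_msym (F : fieldType) (v : 'I_m -> F) (s : 'S_m) (p : {mpoly int[m]}) :
  polyeval v (msym s p) = polyeval (v \o s) p.
Proof. exact: polyeval_rename. Qed.

Lemma rateval_perm (s : 'S_m) f : laurent (@ratvar m) f ->
  laurent (@ratvar m) (rateval (@ratvar m \o s) f).
Proof.
move=> /laurentE[p [e ->]]; rewrite !polyeval_id.
have e0 : polyeval (@ratvar m \o s) 'X_[e] != 0.
  by rewrite polyevalX monomial_neq0 // => i; exact: ratvar_neq0.
rewrite rateval_frac // -!polyeval_msym msymX.
by apply/laurentE; exists (msym s p), [multinom e ((s^-1)%g i) | i < m].
Qed.

Lemma rateval_comp (F : fieldType) (v : 'I_m -> F) (s : 'S_m) f :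
  (forall i, v i != 0) -> laurent (@ratvar m) f ->
  rateval v (rateval (@ratvar m \o s) f) = rateval (v \o s) f.
Proof.
move=> v0 /laurentE[p [e ->]]; rewrite !polyeval_id.
have e0 : polyeval (@ratvar m \o s) 'X_[e] != 0.
  by rewrite polyevalX monomial_neq0 // => i; exact: ratvar_neq0.
have e1 : polyeval (v \o s) 'X_[e] != 0.
  by rewrite polyevalX monomial_neq0 // => i; exact: v0.
rewrite (rateval_frac _ e0) (rateval_frac _ e1) -!polyeval_msym !polyeval_id.
by rewrite rateval_frac // polyeval_msym.
Qed.

Lemma rateval_id f : rateval (@ratvar m) f = f.
Proof.
have [p [q [q0 ->]]] := ratfrac f.
by rewrite rateval_frac polyeval_id ?tofrac_eq0 // polyeval_id.
Qed.

(** [p - msym (tperm i j) p] is a twisted derivation in [p], so divisibility passes from the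
    variables to products. *)
Lemma msym_tperm_dvd (i j : 'I_m) (p : {mpoly int[m]}) :
  exists q : {mpoly int[m]}, p - msym (tperm i j) p = ('X_i - 'X_j) * q.
Proof.
have mulP (p1 p2 : {mpoly int[m]}) : (exists q, p1 - msym (tperm i j) p1 = ('X_i - 'X_j) * q) ->
    (exists q, p2 - msym (tperm i j) p2 = ('X_i - 'X_j) * q) ->
    exists q : {mpoly int[m]}, p1 * p2 - msym (tperm i j) (p1 * p2) = ('X_i - 'X_j) * q.
  move=> [q1 e1] [q2 e2]; exists (q1 * p2 + msym (tperm i j) p1 * q2).
  rewrite msymM (_ : _ * (_ + _) = ('X_i - 'X_j) * q1 * p2 + msym (tperm i j) p1 * (('X_i - 'X_j) * q2)); last by ring.
  by rewrite -e1 -e2; ring.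
elim/mpolyind: p => [|c e p _ _ [q eq]]; first by exists 0; rewrite msym0 subrr mulr0.
suff [q' eq'] : exists q : {mpoly int[m]}, 'X_[e] - msym (tperm i j) 'X_[e] = ('X_i - 'X_j) * q.
  exists (c *: q' + q); rewrite msymD msymZ opprD addrACA eq -scalerBr eq'.
  by rewrite mulrDr scalerAr.
rewrite (mpolyXE_id _ e); elim/big_ind: _ => [|p1 p2|l _].
- by exists 0; rewrite msym1 subrr mulr0.
- exact: mulP.
elim: (e l) => [|d IH]; first by exists 0; rewrite expr0 msym1 subrr mulr0.
rewrite exprS; apply: mulP IH.
have -> : msym (tperm i j) 'X_l = 'X_(tperm i j l) :> {mpoly int[m]}.
  by rewrite /msym mmapX mmap1U.
case: tpermP => [->|->|_ _]; [exists 1|exists (-1)|exists 0]; ring.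
Qed.

(** With [s] the transposition, the numerator is [(v_i - v_j) f + v_j (f - s f)]. For [f = p / X^e],
    over the symmetric denominator [X^e * s(X^e)] the difference [f - s f] has numerator [q - s q]
    with [q = p * s(X^e)], divisible by [v_i - v_j]. *)
Lemma laurent_divdiff (i j : 'I_m) f : i != j -> laurent (@ratvar m) f ->
  laurent (@ratvar m)
    ((ratvar i * f - ratvar j * rateval (@ratvar m \o tperm i j) f) / (ratvar i - ratvar j)).
Proof.
move=> ij lf; have lsf := rateval_perm (tperm i j) lf.
have l0 := @ratvar_neq0.
have dij : ratvar i - ratvar j != 0.
  rewrite subr_eq0 tofrac_eq; apply: contra_neqN ij => /eqP/(congr1 (mcoeff U_(i))).
  by rewrite !mcoeffX eqxx eq_mnm1; case: eqP => // _ /eqP; rewrite oner_eq0.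
suff [h [lh eh]] : exists h, laurent (@ratvar m) h /\
    f - rateval (@ratvar m \o tperm i j) f = (ratvar i - ratvar j) * h.
  have -> : ratvar i * f - ratvar j * rateval (@ratvar m \o tperm i j) f
    = (ratvar i - ratvar j) * f + ratvar j * (f - rateval (@ratvar m \o tperm i j) f) by ring.
  rewrite eh mulrCA -mulrDr mulrAC divff // mul1r.
  by apply: laurentD => //; apply: laurentM => //; exact: laurent_var.
move: lf => /laurentE[p [e ->]]; rewrite !polyeval_id.
set s := tperm i j.
have ss q : msym s (msym s q) = q by rewrite -msymMm tperm2 msym1m.
have [q eq] := msym_tperm_dvd i j (p * msym s 'X_[e]).
have e0 : polyeval (@ratvar m \o s) 'X_[e] != 0.
  by rewrite polyevalX; apply: monomial_neq0 => l; exact: l0.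
have b0 : FracField.tofrac ('X_[e] : {mpoly int[m]}) != 0 by exact: polyeval_tofrac_neq0 e0.
have sb0 : FracField.tofrac (msym s ('X_[e] : {mpoly int[m]})) != 0.
  have := @polyeval_tofrac_neq0 m {fraction {mpoly int[m]}} (@ratvar m) (msym s 'X_[e]).
  rewrite polyeval_msym.
  by move=> /(_ e0).
rewrite rateval_frac // -!polyeval_msym !polyeval_id.
exists (FracField.tofrac q / (FracField.tofrac 'X_[e] * FracField.tofrac (msym s 'X_[e]))); split.
  apply/laurentE; exists q, (e + [multinom e ((s^-1)%g i) | i < m])%MM.
  by rewrite !polyeval_id msymX mpolyXD tofracM.
rewrite /ratvar mulrA -tofracB -[FracField.tofrac _ * FracField.tofrac q]tofracM -eq msymM ss tofracB !tofracM.
exact (@subf_div _ (FracField.tofrac p) _ (FracField.tofrac (msym s p)) _ b0 sb0).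
Qed.

End LaurentRatvar.

Section GrothLaurent.
Variables k n : nat.
Implicit Types (f : ratfun k n) (lam mu : {set 'I_n}).

Lemma swap_valE (i j : 'I_n) : swap_val i j = @ratvar (k + n) \o swap_perm k i j.
Proof.
apply: functional_extensionality => v /=; rewrite /swap_val /swap_perm.
case: (splitP v) => [a|l] e.
  have -> : v = lshift n a by apply: val_inj.
  by rewrite tpermD // eq_rlshift.
have -> : v = rshift k l by apply: val_inj.
by rewrite /yvar inj_tperm //; exact: rshift_inj.
Qed.

Lemma laurent_divdiff_frac (i j : 'I_n) f : i != j ->
  laurent (@ratvar (k + n)) f -> laurent (@ratvar (k + n)) (divdiff i j f).
Proof.
move=> ij lf; rewrite divdiffE swap_valE /swap_perm /yvar.
by apply: laurent_divdiff => //; rewrite (inj_eq (@rshift_inj _ _)).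
Qed.

Lemma laurent_top_groth : laurent (@ratvar (k + n)) (top_groth k n).
Proof.
have r0 := @ratvar_neq0 (k + n).
apply: laurent_prod => // a _; apply: laurent_prod => // j _.
apply: laurentB => //; first exact: (laurent_const _ 1).
apply: laurentM; first exact: laurent_var.
exact: laurent_varV.
Qed.

(** No denominator [y_i - y_j] survives, hence the values at points with nonzero coordinates are
    well defined and the products lie in the ring. *)
Lemma laurent_groth lam : laurent (@ratvar (k + n)) (groth k lam).
Proof.
rewrite /groth; elim: (k * n)%N lam => [|m IH] lam /=; first exact: laurent_top_groth.
case: pickP => [ij /and3P[_ im jm]|_]; last exact: laurent_top_groth.
by apply: laurent_divdiff_frac => //; apply: contraNneq jm => <-.
Qed.

End GrothLaurent.

Section GrothValue.
Variables (k n : nat) (F : fieldType).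
Implicit Types (x : 'I_k -> F) (y : 'I_n -> F) (lam mu : {set 'I_n}).

Definition point x y (v : 'I_(k + n)) : F :=
  match split v with inl a => x a | inr j => y j end.

Lemma point_x x y a : point x y (lshift n a) = x a.
Proof. by rewrite /point -[lshift n a]/(unsplit (inl a)) unsplitK. Qed.

Lemma point_y x y j : point x y (rshift k j) = y j.
Proof. by rewrite /point -[rshift k j]/(unsplit (inr j)) unsplitK. Qed.

Lemma point_neq0 x y : (forall a, x a != 0) -> (forall j, y j != 0) ->
  forall v, point x y v != 0.
Proof. by move=> x0 y0 v; rewrite /point; case: split. Qed.

Lemma point_swap x y i j : point x y \o swap_perm k i j = point x (y \o tperm i j).
Proof.
apply: functional_extensionality => v /=; rewrite /swap_perm.
case: (splitP v) => [a|l] e.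
  have -> : v = lshift n a by apply: val_inj.
  by rewrite tpermD ?eq_rlshift // !point_x.
have -> : v = rshift k l by apply: val_inj.
by rewrite -inj_tperm ?point_y //; exact: rshift_inj.
Qed.

Definition groth_value lam x y : F := rateval (point x y) (groth k lam).

Variables (x : 'I_k -> F) (y : 'I_n -> F).
Hypotheses (x0 : forall a, x a != 0) (y0 : forall j, y j != 0).

Lemma groth_value_top :
  groth_value (top_frame k n) x y
  = \prod_(a < k) \prod_(j < n | (j < n - k)%N) (1 - x a / y j).
Proof.
have p0 := point_neq0 x0 y0.
rewrite /groth_value groth_top /top_groth.
have fac a j : regular (point x y) (1 - xvar n a / yvar k j)
    /\ rateval (point x y) (1 - xvar n a / yvar k j) = 1 - x a / y j.
  have [rx ex] := regular_var (point x y) (lshift n a).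
  have [ry ey] := regular_var (point x y) (rshift k j).
  have ey0 : rateval (point x y) (ratvar (rshift k j)) != 0 by rewrite ey.
  have [rV eV] := regularV_rateval ry ey0.
  have [rM eM] := regularM_rateval rx rV.
  have [r1 e1] := regular_const (point x y) 1.
  have [rB eB] := regularB_rateval r1 rM.
  split; first exact: rB.
  by rewrite [LHS]eB eM eV ex ey e1 point_x point_y.
have row a : regular (point x y) (\prod_(j < n | (j < n - k)%N) (1 - xvar n a / yvar k j))
    /\ rateval (point x y) (\prod_(j < n | (j < n - k)%N) (1 - xvar n a / yvar k j))
     = \prod_(j < n | (j < n - k)%N) (1 - x a / y j).
  have [r ->] := regular_prod_rateval (index_enum 'I_n)
    (P := fun j : 'I_n => (j < n - k)%N) (fun j _ => (fac a j).1).
  by split=> //; apply: eq_bigr => j _; rewrite (fac a j).2.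
have [_ ->] := regular_prod_rateval (index_enum 'I_k)
  (P := xpredT) (fun a _ => (row a).1).
by apply: eq_bigr => a _; rewrite (row a).2.
Qed.

Lemma groth_value_step lam (i j : 'I_n) :
  #|lam| = k -> val j = i.+1 -> j \in lam -> i \notin lam -> y i != y j ->
  groth_value (replace_elt lam j i) x y
  = (y i * groth_value lam x y - y j * groth_value lam x (y \o tperm i j)) / (y i - y j).
Proof.
move=> clam ej jl il yij; have p0 := point_neq0 x0 y0.
have ij : i != j by apply: contraNneq il => ->.
rewrite /groth_value (groth_step clam ej jl il).
set v := point x y; set f := groth k lam.
have lf : laurent (@ratvar (k + n)) f := laurent_groth k lam.
have lsf : laurent (@ratvar (k + n)) (rateval (swap_val i j) f).
  by rewrite swap_valE; exact: rateval_perm.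
have esf : rateval v (rateval (swap_val i j) f) = rateval (point x (y \o tperm i j)) f.
  by rewrite swap_valE -point_swap rateval_comp.
have rf := laurent_regular p0 lf.
have rsf := laurent_regular p0 lsf.
have rd := laurent_regular p0 (laurent_divdiff_frac ij lf).
have [ri ei] := regular_var v (rshift k i).
have [rj ej'] := regular_var v (rshift k j).
have vy l : v (rshift k l) = y l by exact: point_y.
rewrite !vy in ei ej'.
have [rij eij] := regularB_rateval ri rj.
have [r1 e1] := regularM_rateval ri rf.
have [r2 e2] := regularM_rateval rj rsf.
have [r3 e3] := regularB_rateval r1 r2.
have [r4 e4] := regularM_rateval rd rij.
have yij0 : y i - y j != 0 by rewrite subr_eq0.
apply: (canRL (mulfK yij0)); rewrite -esf -[in RHS]ei -[in RHS]ej' -e1 -e2 -e3.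
rewrite -ei -ej' -eij -e4; congr (rateval v _).
rewrite divdiffE divfK //.
by rewrite subr_eq0 (inj_eq (@yvar_inj k n)).
Qed.

End GrothValue.

(** * Exchange relation and triangularity of Grothendieck polynomials *)

Section Frames.
Variables k n : nat.
Hypothesis hkn : (k <= n)%N.
Implicit Types (lam mu : {set 'I_n}).

Lemma card_ord_lt m : (m <= n)%N -> #|[set j : 'I_n | (j < m)%N]| = m.
Proof.
move=> mn; rewrite -sum1_card.
under eq_bigl do rewrite inE.
by rewrite (big_ord_narrow mn) sum_nat_const card_ord muln1.
Qed.

Lemma card_top_frame : #|top_frame k n| = k.
Proof.
have -> : top_frame k n = ~: [set j : 'I_n | (j < n - k)%N].
  by apply/setP => j; rewrite !inE -leqNgt.
by rewrite cardsCs setCK card_ord_lt ?leq_subr // card_ord subKn.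
Qed.

(** A frame none of whose elements can be raised is closed under successor, hence a final
    segment. *)
Lemma top_frame_or_raise lam : #|lam| = k ->
  lam = top_frame k n \/
  exists i j : 'I_n, [/\ val j = i.+1, i \in lam & j \notin lam].
Proof.
move=> clam.
case: (boolP [exists i : 'I_n, exists j : 'I_n, [&& val j == i.+1, i \in lam & j \notin lam]]).
  by move=> /existsP[i /existsP[j /and3P[/eqP e il jl]]]; right; exists i, j.
rewrite negb_exists => /forallP noex; left.
have up (i j : 'I_n) : i \in lam -> val j = i.+1 -> j \in lam.
  move=> il e; apply: contraT => jl; have := noex i.
  by rewrite negb_exists => /forallP/(_ j); rewrite e eqxx il jl.
have upc d : forall i j : 'I_n, i \in lam -> val j = (i + d)%N -> j \in lam.
  elim: d => [|d IH] i j il; first by rewrite addn0 => /val_inj->.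
  rewrite addnS => e.
  have ltd : (i + d < n)%N by apply: ltn_trans (ltn_ord j); rewrite e.
  by apply: (up (Ordinal ltd)); first exact: (IH i).
have sub : top_frame k n \subset lam.
  apply/subsetP => t; rewrite inE => tn; apply: contraT => tl.
  have sub2 : lam \subset [set j : 'I_n | (t < j)%N].
    apply/subsetP => i il; rewrite inE ltnNge; apply/negP => it; case/negP: tl.
    by apply: (upc (t - i)%N i) => //; rewrite subnKC.
  have : (k < k)%N; last by rewrite ltnn.
  rewrite -{1}clam (leq_ltn_trans (subset_leq_card sub2)) // -[X in (_ < X)%N]card_top_frame.
  apply: proper_card; apply/properP; split; last by exists t; rewrite ?inE ?ltnn.
  by apply/subsetP => j; rewrite !inE => /ltnW; exact: leq_trans.
apply/esym/eqP; rewrite eqEcard sub clam card_top_frame leqnn //.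
Qed.

Lemma replaceK lam (i j : 'I_n) : i \in lam -> j \notin lam ->
  replace_elt (replace_elt lam i j) j i = lam.
Proof.
move=> il jl; apply/setP => l; rewrite /replace_elt !inE.
have [->|li] /= := eqVneq l i; first by rewrite il.
by have [->|lj] /= := eqVneq l j; rewrite ?(negPf jl).
Qed.

Lemma card_replace lam (i j : 'I_n) : i \in lam -> j \notin lam ->
  #|replace_elt lam i j| = #|lam|.
Proof.
by move=> il jl; rewrite /replace_elt cardsU1 !inE (negPf jl) andbF [in RHS](cardsD1 i) il.
Qed.

Lemma in_replace lam (i j : 'I_n) (l : 'I_n) :
  (l \in replace_elt lam i j) = (l == j) || ((l != i) && (l \in lam)).
Proof. by rewrite /replace_elt !inE. Qed.

Lemma replace_tperm lam (i j : 'I_n) l : i \in lam -> j \notin lam ->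
  (tperm i j l \in lam) = (l \in replace_elt lam i j).
Proof.
move=> il jl; rewrite in_replace.
have ij : i != j by apply: contraNneq jl => <-.
case: tpermP => [->|->|/eqP li /eqP lj].
- by rewrite (negPf jl) eqxx (negPf ij).
- by rewrite il eqxx.
by rewrite (negPf lj) li.
Qed.

Definition frame_height lam := (\sum_(l in lam) (n - l))%N.

Lemma frame_height_raise lam (i j : 'I_n) : val j = i.+1 -> i \in lam -> j \notin lam ->
  (frame_height (replace_elt lam i j) < frame_height lam)%N.
Proof.
move=> e il jl; apply: (@height_replace n lam (i, j)).
by rewrite /addable /= e eqxx il jl.
Qed.

Lemma frame_ind (P : {set 'I_n} -> Prop) :
  P (top_frame k n) ->
  (forall lam (i j : 'I_n), #|lam| = k -> val j = i.+1 -> j \in lam -> i \notin lam ->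
     P lam -> P (replace_elt lam j i)) ->
  forall lam, #|lam| = k -> P lam.
Proof.
move=> Ptop Pstep lam; move: {2}(frame_height lam) (leqnn (frame_height lam)) => m.
elim: m lam => [|m IH] lam hm clam.
  case: (top_frame_or_raise clam) => [->//|[i [j [e il jl]]]].
  by have := leq_trans (frame_height_raise e il jl) hm.
case: (top_frame_or_raise clam) => [->//|[i [j [e il jl]]]].
rewrite -(replaceK il jl); apply: Pstep => //.
- by rewrite card_replace.
- by rewrite in_replace eqxx.
- by rewrite in_replace eqxx orbF; apply: contraNneq jl => <-.
apply: IH; last by rewrite card_replace.
by rewrite -ltnS (leq_trans (frame_height_raise e il jl)).
Qed.

End Frames.

Section Family.
Variables (F : fieldType) (k n : nat) (x : 'I_k -> F).
Variable Gr : {set 'I_n} -> ('I_n -> F) -> F.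
Hypothesis hkn : (k <= n)%N.

Definition generic (y : 'I_n -> F) := injective y /\ forall i, y i != 0.

Hypothesis family_top : forall y, generic y -> Gr (top_frame k n) y
  = \prod_(a < k) \prod_(j < n | (j < n - k)%N) (1 - x a / y j).
Hypothesis family_step : forall (lam : {set 'I_n}) (i j : 'I_n) y, generic y ->
  #|lam| = k -> val j = i.+1 -> j \in lam -> i \notin lam ->
  Gr (replace_elt lam j i) y
  = (y i * Gr lam y - y j * Gr lam (y \o tperm i j)) / (y i - y j).

Implicit Types (lam mu : {set 'I_n}) (y : 'I_n -> F).

Lemma generic_tperm y i j : generic y -> generic (y \o tperm i j).
Proof. by move=> [inj y0]; split=> [a b /inj /perm_inj|a] //=. Qed.

Lemma generic_neq y i j : generic y -> i != j -> y i - y j != 0.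
Proof. by move=> [inj _] ij; rewrite subr_eq0 (inj_eq inj). Qed.

Lemma family_raise lam (i j : 'I_n) y : generic y -> #|lam| = k ->
  val j = i.+1 -> i \in lam -> j \notin lam ->
  Gr lam y = (y i * Gr (replace_elt lam i j) y
             - y j * Gr (replace_elt lam i j) (y \o tperm i j)) / (y i - y j).
Proof.
move=> gy clam e il jl; rewrite -{1}(replaceK il jl); apply: family_step => //.
- by rewrite card_replace.
- by rewrite in_replace eqxx.
by rewrite in_replace eqxx orbF; apply: contraNneq jl => <-.
Qed.

(** Explicit form of the braid relation of the operators [D_i] on a function symmetric in two of
    three variables: such a function takes only three values [A], [B], [C] under permutations of
    them. *)
Lemma braid_field1 (p q r A B C : F) : p - q != 0 -> q - r != 0 -> p - r != 0 ->
  (p * ((q * B - p * A) / (q - p)) - r * ((q * B - r * C) / (q - r))) / (p - r)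
  = (q * ((p * A - q * B) / (p - q)) - r * ((p * A - r * C) / (p - r))) / (q - r).
Proof.
move=> pq qr pr; have qp : q - p != 0 by rewrite -opprB oppr_eq0.
by field; rewrite pq qr pr qp.
Qed.

Lemma braid_field2 (p q r A B C : F) : p - q != 0 -> q - r != 0 -> p - r != 0 ->
  (p * ((r * B - q * A) / (r - q)) - r * ((p * B - q * C) / (p - q))) / (p - r)
  = (p * ((q * A - r * B) / (q - r)) - q * ((p * A - r * C) / (p - r))) / (p - q).
Proof.
move=> pq qr pr; have rq : r - q != 0 by rewrite -opprB oppr_eq0.
by field; rewrite pq qr pr rq.
Qed.

Lemma swapK y i j : (y \o tperm i j) \o tperm i j = y.
Proof. by apply: functional_extensionality => l /=; rewrite tpermK. Qed.

Lemma swap_braid y (i j l : 'I_n) : i != j -> j != l -> i != l ->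
  ((y \o tperm i j) \o tperm j l) \o tperm i j = ((y \o tperm j l) \o tperm i j) \o tperm j l.
Proof.
move=> ij jl il; apply: functional_extensionality => m /=.
suff -> : tperm i j (tperm j l (tperm i j m)) = tperm j l (tperm i j (tperm j l m)) by [].
rewrite -!permM; congr (fun s : 'S_n => s m).
have conj (u v : 'S_n) : u^-1%g = u -> (u * (v * u) = v ^ u)%g by move=> {1}<-; rewrite conjgE.
rewrite -?mulgA !conj ?tpermV // !tpermJ.
by rewrite tpermR tpermL (tpermD (z := l)) // (tpermD (z := i)) // eq_sym.
Qed.

Lemma swap_commute y (i j i' j' : 'I_n) : i' != i -> i' != j -> j' != i -> j' != j ->
  (y \o tperm i j) \o tperm i' j' = (y \o tperm i' j') \o tperm i j.
Proof.
move=> ii ij ji jj; apply: functional_extensionality => m /=.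
suff -> : tperm i j (tperm i' j' m) = tperm i' j' (tperm i j m) by [].
rewrite -!permM; congr (fun s : 'S_n => s m).
rewrite conjgC; congr (_ * _)%g; rewrite tpermJ.
by rewrite !tpermD // eq_sym.
Qed.

(** Write [lam] as [D] of a raised frame, for a pair [(a, b)]. If this pair is disjoint from
    [(i, j)], the operators commute. If they overlap, the raised frame is itself [D_i] of a frame
    [nu] symmetric in [(a, b)], and the braid relation yields the symmetry in [(i, j)]. *)
Lemma family_sym lam (i j : 'I_n) y : generic y -> #|lam| = k -> val j = i.+1 ->
  (i \in lam) = (j \in lam) -> Gr lam (y \o tperm i j) = Gr lam y.
Proof.
move: {2}(frame_height lam) (leqnn (frame_height lam)) => m.
elim: m lam i j y => [|m IH] lam i j y hm gy clam e mem.
all: have gys := generic_tperm i j gy.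
all: case: (top_frame_or_raise hkn clam) => [elam|[a [b [eb al bl]]]].
1, 3: rewrite elam !family_top //; apply: eq_bigr => c _;
  rewrite (reindex_inj (@perm_inj _ (tperm i j))) /=;
  apply: eq_big => [l|l _]; last by rewrite tpermK.
1, 2: move: mem; rewrite elam !inE e => mem;
  case: tpermP => [->|->|//]; rewrite ?e; apply/negb_inj; rewrite -!leqNgt ?mem //.
- by have := leq_trans (frame_height_raise eb al bl) hm.
have hm' : (frame_height (replace_elt lam a b) <= m)%N.
  by rewrite -ltnS (leq_trans (frame_height_raise eb al bl)).
have cmu : #|replace_elt lam a b| = k by rewrite card_replace.
have ij : i != j by apply/eqP => eij; move: e; rewrite eij => /n_Sn.
have ab : a != b by apply: contraNneq bl => <-.
set mu := replace_elt lam a b in hm' cmu.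
rewrite !(family_raise _ clam eb al bl) // -/mu.
have [ai|ai] := eqVneq a i.
  have bj : b = j by apply: val_inj; rewrite /= e -ai.
  by move: bl; rewrite bj -mem -ai al.
have [aj|aj] := eqVneq a j; last have [bi|bi] := eqVneq b i; last first.
- have bj : b != j by apply: contraNneq ai => bj; apply/eqP/val_inj/eq_add_S; rewrite -eb -e bj.
  have mem' : (i \in mu) = (j \in mu).
    by rewrite !in_replace ![i == _]eq_sym ![j == _]eq_sym (negPf bi) (negPf bj) ai aj mem.
  have gyt := generic_tperm a b gy.
  rewrite (swap_commute _ ai aj bi bj) (IH mu i j y) // (IH mu i j _ hm' gyt) //.
  by rewrite /= !(tpermD (z := a)) 1?eq_sym // !(tpermD (z := b)) 1?eq_sym.
(* Overlap with [a], [i], [j] consecutive; neither [i] nor [j] lies in [lam]. *)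
- subst b; have jl : j \notin lam by rewrite -mem.
  have aj' : a != j by [].
  have jmu : j \notin mu by rewrite in_replace (eq_sym j i) (negPf ij) (negPf jl) andbF.
  have imu : i \in mu by rewrite in_replace eqxx.
  have cnu : #|replace_elt mu i j| = k by rewrite card_replace.
  have hnu : (frame_height (replace_elt mu i j) <= m)%N.
    by rewrite (leq_trans _ hm') // ltnW // (frame_height_raise e imu jmu).
  set nu := replace_elt mu i j in cnu hnu.
  have gyt := generic_tperm a i gy; have gyts := generic_tperm i j gyt.
  have gyst := generic_tperm a i gys.
  rewrite !(family_raise _ cmu e imu jmu) // -/nu.
  have memnu : (a \in nu) = (i \in nu).
    by rewrite !in_replace !eqxx (negPf ij) (negPf ab) (negPf aj').
  rewrite swapK (IH nu a i y) // (IH nu a i (y \o tperm i j)) //.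
  rewrite -swap_braid //.
  rewrite (IH nu a i (y \o tperm a i \o tperm i j)) //.
  have tj : tperm a i j = j by rewrite tpermD.
  have ta : tperm i j a = a by rewrite tpermD // eq_sym.
  rewrite /= ?(tpermL, tpermR, tj, ta).
  by apply: braid_field2; apply: generic_neq.
(* Overlap with [i], [j], [b] consecutive; both [i] and [j] lie in [lam]. *)
subst a; have il : i \in lam by rewrite mem.
have bi : b != i by apply: contraNneq bl => ->.
have imu : i \in mu by rewrite in_replace ij il orbT.
have jmu : j \notin mu by rewrite in_replace eqxx orbF.
have cnu : #|replace_elt mu i j| = k by rewrite card_replace.
have hnu : (frame_height (replace_elt mu i j) <= m)%N.
  by rewrite (leq_trans _ hm') // ltnW // (frame_height_raise e imu jmu).
set nu := replace_elt mu i j in cnu hnu.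
have gyt := generic_tperm j b gy; have gyts := generic_tperm i j gyt.
have gyst := generic_tperm j b gys.
rewrite !(family_raise _ cmu e imu jmu) // -/nu.
have memnu : (j \in nu) = (b \in nu).
  by rewrite !in_replace !eqxx bi orbT.
rewrite swapK (IH nu j b y) // (IH nu j b (y \o tperm i j)) //.
rewrite swap_braid // 1?eq_sym //.
rewrite (IH nu j b (y \o tperm j b \o tperm i j)) //.
have ti : tperm j b i = i by rewrite tpermD // eq_sym.
have tb : tperm i j b = b by rewrite tpermD // eq_sym.
rewrite /= ?(tpermL, tpermR, ti, tb).
by apply: braid_field1; apply: generic_neq; rewrite // eq_sym.
Qed.

(** The first case is the definition of [D_i] solved for the swapped value. If only [i] belongs to
    [lam], then [Gr lam] lies in the image of [D_i], which consists of symmetric functions. This is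
    the matrix [Rl] with parameter [y i / y j]. *)
Lemma family_exchange lam (i j : 'I_n) y : generic y -> #|lam| = k -> val j = i.+1 ->
  Gr lam (y \o tperm i j) =
  if (i \notin lam) && (j \in lam)
  then y i / y j * Gr lam y + (1 - y i / y j) * Gr (replace_elt lam j i) y
  else Gr lam y.
Proof.
move=> gy clam e; have ij : i != j by apply/eqP => eij; move: e; rewrite eij => /n_Sn.
have yij := generic_neq gy ij.
have yji : y j - y i != 0 by rewrite -opprB oppr_eq0.
case: ifP => [/andP[il jl]|].
  rewrite family_step //; have yj := gy.2 j.
  by field; rewrite yj yij.
case: (boolP (i \in lam)) => il; case: (boolP (j \in lam)) => jl // _.
- by apply: family_sym; rewrite // il jl.
- rewrite !(family_raise _ clam e il jl) //; last exact: generic_tperm.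
  rewrite swapK /= tpermL tpermR.
  by field; rewrite yij yji.
by apply: family_sym; rewrite // (negPf il) (negPf jl).
Qed.

(** For sets of equal size, comparing these counts at every [t] is the Bruhat order, that is,
    inclusion of Young diagrams. *)
Definition count_ge (A : {set 'I_n}) t := #|[set l in A | (t <= l)%N]|.

Lemma count_geS (A : {set 'I_n}) (i : 'I_n) : count_ge A i = ((i \in A) + count_ge A i.+1)%N.
Proof.
rewrite /count_ge (cardsD1 i) !inE leqnn andbT; congr (_ + _)%N.
apply: eq_card => l; rewrite !inE [(i < l)%N]ltn_neqAle eq_sym andbCA.
by rewrite -(inj_eq val_inj).
Qed.

Lemma count_ge_out (A : {set 'I_n}) t : (n <= t)%N -> count_ge A t = 0.
Proof.
move=> nt; apply/eqP; rewrite cards_eq0; apply/eqP/setP => l; rewrite !inE.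
by rewrite [(t <= l)%N]leqNgt (leq_trans (ltn_ord l) nt) andbF.
Qed.

Lemma count_ge_inj (A B : {set 'I_n}) : (forall t, count_ge A t = count_ge B t) -> A = B.
Proof.
move=> eAB; apply/setP => i; have := eAB i; rewrite !count_geS eAB.
by move=> /addIn; case: (i \in A); case: (i \in B).
Qed.

Lemma count_ge_imset (A : {set 'I_n}) (i j : 'I_n) (t : nat) : val j = i.+1 -> t <> val j ->
  count_ge (tperm i j @: A) t = count_ge A t.
Proof.
move=> e tj; rewrite /count_ge -[RHS](card_imset _ (@perm_inj _ (tperm i j))).
apply: eq_card => l; rewrite !inE.
have mem_t (B : {set 'I_n}) : (l \in tperm i j @: B) = (tperm i j l \in B).
  by rewrite -{1}[l](tpermK i j) (mem_imset _ _ (@perm_inj _ _)).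
have key : (t <= j)%N = (t <= i)%N.
  rewrite [nat_of_ord j]e leq_eqVlt ltnS; case: eqP => // et.
  by case: tj; rewrite et -e.
by rewrite !mem_t inE; congr (_ && _); case: tpermP => [->|->|//]; rewrite key.
Qed.

Lemma count_ge_replace lam (i j : 'I_n) : val j = i.+1 -> j \in lam -> i \notin lam ->
  forall t : nat, count_ge (replace_elt lam j i) t = (count_ge lam t - (t == j))%N.
Proof.
move=> e jl il; have ij : i != j by apply: contraNneq il => ->.
have -> : replace_elt lam j i = tperm i j @: lam.
  apply/setP => l; rewrite -[in RHS](tpermK i j l) (mem_imset _ _ (@perm_inj _ _)).
  by rewrite tpermC replace_tperm.
move=> t; case: eqP => [->|tj]; last by rewrite subn0 count_ge_imset.
rewrite !count_geS [count_ge (_ @: _) _]count_ge_imset //; last by move=> /esym/n_Sn.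
rewrite jl -{1}(tpermL i j) (mem_imset _ _ (@perm_inj _ _)) (negPf il).
by rewrite add1n subn1 /= add0n.
Qed.

(** The value at [I] is a combination of two values for the higher frame, at the fixed points [I]
    and [tperm i j \o I]; if it is nonzero, one of these is, and induction bounds the counts. *)
Lemma family_vanish lam y (I : 'I_k -> 'I_n) : generic y -> injective I -> x =1 y \o I ->
  #|lam| = k -> Gr lam y != 0 -> forall t, (count_ge lam t <= count_ge (I @: setT) t)%N.
Proof.
move=> gy injI xI clam; move: y I gy injI xI.
move: lam clam; apply: (frame_ind hkn) => [|lam i j clam e jl il IH] y I gy injI xI.
  rewrite family_top // => nz t; suff -> : I @: setT = top_frame k n by [].
  apply/eqP; rewrite eqEcard card_imset // cardsT card_ord card_top_frame // leqnn andbT.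
  apply/subsetP => _ /imsetP[a _ ->]; rewrite inE leqNgt; apply: contraNN nz => lt.
  rewrite (bigD1 a) //= (bigD1 (I a)) //= xI /= divff ?subrr ?mul0r //.
  exact: gy.2.
rewrite family_step // => nz t.
have le_lam : (count_ge (replace_elt lam j i) t <= count_ge lam t)%N.
  by rewrite count_ge_replace // leq_subr.
have [G0|Gn0] := eqVneq (Gr lam y) 0; last first.
  by apply: leq_trans le_lam _; exact: (IH y I).
have Gs0 : Gr lam (y \o tperm i j) != 0.
  by apply: contraNneq nz => ->; rewrite G0 !mulr0 subrr mul0r.
have {IH} IH := IH (y \o tperm i j) (tperm i j \o I) (generic_tperm i j gy) _ _ Gs0.
have {IH} IH t' : (count_ge lam t' <= count_ge (tperm i j @: (I @: setT)) t')%N.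
  rewrite -imset_comp; apply: IH; first by move=> a b /perm_inj/injI.
  by move=> a; rewrite xI /= tpermK.
have [->|tj] := eqVneq t j; last first.
  by apply: leq_trans le_lam _; rewrite (leq_trans (IH t)) // count_ge_imset //; apply/eqP.
rewrite count_ge_replace // eqxx count_geS jl add1n subn1 /=.
(* At [t = j] the lowered frame has as many elements as [lam] has above [j], and that count of the
   fixed point is unchanged by the transposition. *)
apply: leq_trans (IH _) _; rewrite count_ge_imset //; last by move=> /esym/n_Sn.
by rewrite [in leqRHS]count_geS leq_addl.
Qed.

Lemma pair_factor (a b f : F) : a != 0 -> b != 0 -> a - b != 0 ->
  (a * 0 - b * ((1 - a / b) * f)) / (a - b) = f.
Proof. by move=> a0 b0 ab; field; rewrite ab b0. Qed.

(** The unswapped term of [D_i] vanishes by triangularity. The swapped one contains the extra factor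
    of the pair [(j, i)], which cancels the denominator [y i - y j]. *)
Lemma family_diag lam y (I : 'I_k -> 'I_n) : generic y -> injective I -> x =1 y \o I ->
  I @: setT = lam -> #|lam| = k ->
  Gr lam y = \prod_(p : 'I_n * 'I_n | [&& p.1 \in lam, p.2 \notin lam & (p.2 < p.1)%N])
              (1 - y p.1 / y p.2).
Proof.
move=> gy injI xI Ilam clam; move: y I gy injI xI Ilam.
move: lam clam; apply: (frame_ind hkn) => [|lam i j clam e jl il IH] y I gy injI xI Ilam.
  rewrite family_top // pair_big_dep /=.
  transitivity (\prod_(p : 'I_n * 'I_n | (p.1 \in I @: setT) && (p.2 < n - k)%N)
    (1 - y p.1 / y p.2)); last first.
    apply: eq_bigl => -[l l'] /=; rewrite Ilam !inE -ltnNge.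
    by apply/andP/and3P => [[nl ll]|[nl ll _]]; split=> //; exact: leq_trans ll nl.
  rewrite -(pair_big_dep (fun l : 'I_n => l \in I @: setT) (fun (_ l' : 'I_n) => (l' < n - k)%N)
     (fun l l' => 1 - y l / y l')) /=.
  rewrite (big_imset _ (fun a b _ _ => @injI a b)) /=.
  rewrite -(pair_big_dep xpredT (fun (_ : 'I_k) (l' : 'I_n) => (l' < n - k)%N)
     (fun a l' => 1 - x a / y l')) /=.
  by apply: eq_big => [a|a _]; [rewrite inE | apply: eq_bigr => l _; rewrite xI].
have ij : i != j by apply: contraNneq il => ->.
have gys := generic_tperm i j gy.
have G0 : Gr lam y = 0.
  apply/eqP; apply: contraTT isT => Gn0.
  have := family_vanish gy injI xI clam Gn0 j.
  by rewrite Ilam count_ge_replace // eqxx count_geS jl add1n subn1 ltnn.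
have Es : Gr lam (y \o tperm i j) = \prod_(p : 'I_n * 'I_n |
    [&& p.1 \in lam, p.2 \notin lam & (p.2 < p.1)%N])
      (1 - (y \o tperm i j) p.1 / (y \o tperm i j) p.2).
  apply: (IH _ (tperm i j \o I)) => //.
  - by move=> a b /perm_inj/injI.
  - by move=> a; rewrite xI /= tpermK.
  rewrite imset_comp Ilam; apply/setP => l.
  rewrite -[in LHS](tpermK i j l) (mem_imset _ _ (@perm_inj _ _)).
  by rewrite -replace_tperm // tpermC tpermK.
rewrite family_step // G0 Es (bigD1 (j, i)) /=; last by rewrite jl il e leqnn.
rewrite tpermL tpermR pair_factor; try exact: gy.2; last exact: generic_neq.
rewrite [RHS](reindex_inj (h := fun p => (tperm i j p.1, tperm i j p.2))) /=; last first.
  by move=> [a b] [a' b'] /= [/perm_inj-> /perm_inj->].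
apply: eq_bigl => -[a b] /=; rewrite xpair_eqE.
have mem_lam l : (tperm i j l \in replace_elt lam j i) = (l \in lam).
  by rewrite -replace_tperm // tpermC tpermK.
rewrite !mem_lam -!andbA; case: (boolP (a \in lam)) => //= al.
case: (boolP (b \in lam)) => //= bl.
have ai : a != i by apply: contraNneq il => <-.
have bj : b != j by apply: contraNneq bl => ->.
have lt_ij (l : 'I_n) : l != i -> l != j -> ((l < i)%N = (l < j)%N) * ((i < l)%N = (j < l)%N).
  move=> li lj; rewrite -!(inj_eq val_inj) /= in li lj.
  split; rewrite [nat_of_ord j]e; first by rewrite ltnS [(l <= i)%N]leq_eqVlt (negPf li).
  by rewrite [(i < l)%N]leq_eqVlt -e eq_sym (negPf lj).
case: (tpermP i j a) ai => [->|->|/eqP ai /eqP aj _]; rewrite ?eqxx //.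
  case: (tpermP i j b) bj => [->|->|/eqP bi /eqP bj _]; rewrite ?eqxx //= ?andbT ?andbF.
    by rewrite [RHS]ltnNge [nat_of_ord j]e leqnSn.
  by rewrite bi andbT lt_ij.
rewrite (negPf aj) andbT.
case: (tpermP i j b) bj => [->|->|/eqP bi /eqP bj _]; rewrite ?eqxx //=.
by rewrite lt_ij.
Qed.

End Family.

(** * The product identity at the fixed points *)

Lemma bsum_ffun (F : fieldType) n (f : seq bool -> F) :
  bsum n f = \sum_(u : {ffun 'I_n -> bool}) f [seq u q | q <- enum 'I_n].
Proof.
elim: n f => [|n IH] f /=.
  rewrite (big_pred1 [ffun=> true]) => [|u]; last first.
    by apply/esym/eqP/ffunP => -[].
  by have -> : enum 'I_0 = [::] by apply: size0nil; rewrite size_enum_ord.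
transitivity (\sum_(t : bool) \sum_(u : {ffun 'I_n -> bool}) f (t :: [seq u q | q <- enum 'I_n])).
  by apply: eq_bigr => t _; rewrite IH.
rewrite -(sum_ffun_ordS (fun t (u : {ffun 'I_n -> bool}) => f (t :: [seq u q | q <- enum 'I_n]))).
apply: eq_bigr => u _; rewrite map_enum_ordS; congr (f (_ :: _)).
by apply: eq_map => q /=; rewrite ffunE.
Qed.

Section GrothFamily.
Variables (F : fieldType) (k n : nat) (x : 'I_k -> F).
Hypothesis x0 : forall a, x a != 0.

Lemma groth_value_generic_top (y : 'I_n -> F) : generic y ->
  groth_value (top_frame k n) x y
  = \prod_(a < k) \prod_(j < n | (j < n - k)%N) (1 - x a / y j).
Proof. by move=> [_ y0]; exact: groth_value_top. Qed.

Lemma groth_value_generic_step (lam : {set 'I_n}) (i j : 'I_n) (y : 'I_n -> F) :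
  generic y -> #|lam| = k -> val j = i.+1 -> j \in lam -> i \notin lam ->
  groth_value (replace_elt lam j i) x y
  = (y i * groth_value lam x y - y j * groth_value lam x (y \o tperm i j)) / (y i - y j).
Proof.
move=> [y_inj y0] clam e jl il; apply: groth_value_step => //.
by rewrite (inj_eq y_inj); apply: contraNneq il => ->.
Qed.

End GrothFamily.

Section ListForm.
Variables (F : fieldType) (k n : nat) (x : 'I_k -> F).
Hypotheses (hkn : (k <= n)%N) (x_inj : injective x) (x0 : forall a, x a != 0).

Definition bits_frame (s : seq bool) : {set 'I_n} := [set j : 'I_n | nth false s j].

(** The extension by zero respects the exchange relation, since [Rl] preserves the number of letters
    true. *)
Definition groth_bits (s : seq bool) (zs : seq F) : F :=
  if #|bits_frame s| == k then groth_value (bits_frame s) x (fun j => nth 0 zs j) else 0.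

Let Gr (lam : {set 'I_n}) y := groth_value lam x y.
Let family_top := groth_value_generic_top (n := n) x0.
Let family_step := groth_value_generic_step (n := n) x0.

Variable Y : seq F.
Hypotheses (Y_uniq : uniq Y) (Y0 : all (fun y => y != 0) Y) (Y_size : size Y = n).

Lemma nth_generic zs : perm_eq zs Y -> generic (fun j : 'I_n => nth 0 zs j).
Proof.
move=> pzs; have szs : size zs = n by rewrite (perm_size pzs).
split=> [i j /eqP|i].
  rewrite nth_uniq ?szs // ?(perm_uniq pzs) // => /eqP; exact: val_inj.
by apply: (allP Y0); rewrite -(perm_mem pzs) mem_nth // szs.
Qed.

Lemma groth_bits_exchange s1 a b s2 zs1 u v zs2 :
  size s1 = size zs1 -> size s2 = size zs2 -> perm_eq (zs1 ++ u :: v :: zs2) Y ->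
  groth_bits (s1 ++ a :: b :: s2) (zs1 ++ v :: u :: zs2)
  = Rl (u / v) a b (fun c d => groth_bits (s1 ++ c :: d :: s2) (zs1 ++ u :: v :: zs2)).
Proof.
move=> sz1 sz2 pY; have gy := nth_generic pY.
have szn : (size zs1 + size zs2).+2 = n by rewrite -Y_size -(perm_size pY) size_cat /= !addnS.
have lti : (size zs1 < n)%N by rewrite -szn ltnS -addnS leq_addr.
have ltj : ((size zs1).+1 < n)%N by rewrite -szn !ltnS leq_addr.
pose i := Ordinal lti; pose j := Ordinal ltj.
have ij : i != j by apply/eqP => /(congr1 val)/n_Sn.
(* Away from positions [i] and [j] an entry does not depend on the two letters; [rest] names it and
   hides the index arithmetic. *)
have [rest nth2] : exists rest : forall T, T -> seq T -> seq T -> 'I_n -> T,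
    forall (T : Type) (d : T) t1 c e t2, size t1 = size zs1 ->
    forall l : 'I_n, nth d (t1 ++ c :: e :: t2) l =
      if l == i then c else if l == j then e else rest T d t1 t2 l.
  exists (fun T d t1 t2 l => nth d (t1 ++ d :: d :: t2) l) => T d t1 c e t2 szt l.
  rewrite -!(inj_eq val_inj) /= !nth_cat szt.
  case: ltngtP => [lt|gt|->]; last by rewrite subnn.
    by rewrite ltn_eqF // ltnS ltnW.
  case: eqP => [->|ne]; first by rewrite subSnn.
  have : ((size zs1).+1 < l)%N by rewrite ltn_neqAle gt andbT; apply/eqP => e'; case: ne.
  rewrite -subn_gt0 => lt; have -> : (l - size zs1 = (l - (size zs1).+1).-1.+2)%N.
    by rewrite prednK // subnSK.
  by [].
rewrite /groth_bits; have -> : (fun l : 'I_n => nth 0 (zs1 ++ v :: u :: zs2) l)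
  = (fun l : 'I_n => nth 0 (zs1 ++ u :: v :: zs2) l) \o tperm i j.
  apply: functional_extensionality => l /=; rewrite !(nth2 F) //.
  case: tpermP => [->|->|/eqP li /eqP lj]; rewrite ?eqxx ?[j == i]eq_sym ?(negPf ij) //.
  by rewrite (negPf li) (negPf lj).
set y := fun l : 'I_n => nth 0 (zs1 ++ u :: v :: zs2) l.
have yi : y i = u by rewrite /y (nth2 F) // eqxx.
have yj : y j = v by rewrite /y (nth2 F) // eqxx eq_sym (negPf ij).
set lam := bits_frame (s1 ++ a :: b :: s2).
have il : (i \in lam) = a by rewrite inE (nth2 bool) // eqxx.
have jl : (j \in lam) = b by rewrite inE (nth2 bool) // eqxx eq_sym (negPf ij).
rewrite -/lam /Rl.
have elam : ~~ a && b -> lam = bits_frame (s1 ++ false :: true :: s2).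
  by rewrite /lam => /andP[/negPf-> ->].
have e2 : ~~ a && b -> bits_frame (s1 ++ true :: false :: s2) = replace_elt lam j i.
  move=> /elam->; apply/setP => l; rewrite in_replace !inE !(nth2 bool) //.
  have [_|li] /= := eqVneq l i; first by [].
  by have [_|lj] /= := eqVneq l j.
have [clam|clam] := eqVneq #|lam| k; last first.
  case: ifP => [nab|_]; last by [].
  have /andP[na nb] := nab; rewrite -elam // (negPf clam) e2 // card_replace ?il ?jl ?(negPf na) //.
  by rewrite (negPf clam) !mulr0 addr0.
have := @family_exchange F k n x Gr hkn family_top family_step lam i j y gy clam (erefl : val j = i.+1).
rewrite il jl yi yj /Gr => ->.
case: ifP => [nab|_]; last by [].
have /andP[na nb] := nab.
by rewrite -elam // clam eqxx e2 // card_replace ?il ?jl ?clam ?eqxx ?(negPf na).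
Qed.

(** The fixed point only uses indices below [size zs1] whereas the frame contains [size zs1],
    against the bound of [family_vanish] there. *)
Lemma groth_bits_vanish s1 s2 zs1 zs2 :
  size s1 = size zs1 -> size zs2 = (size s2).+1 -> perm_eq (zs1 ++ zs2) Y ->
  {subset codom x <= zs1} -> groth_bits (s1 ++ true :: s2) (zs1 ++ zs2) = 0.
Proof.
move=> sz1 sz2 pY Xs; have gy := nth_generic pY.
rewrite /groth_bits; case: eqP => // clam; set lam := bits_frame _ in clam *.
have szn : (size zs1 + size zs2)%N = n by rewrite -Y_size -(perm_size pY) size_cat.
have lt a : (index (x a) zs1 < n)%N.
  by rewrite -szn (leq_trans _ (leq_addr _ _)) // index_mem Xs // codom_f.
have lti : (size zs1 < n)%N by rewrite -szn sz2 addnS ltnS leq_addr.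
set y := fun _ => _.
have xI : x =1 y \o (fun a => Ordinal (lt a)).
  by move=> a; rewrite /= /y nth_cat index_mem Xs ?codom_f // nth_index // Xs // codom_f.
have injI : injective (fun a => Ordinal (lt a)).
  by move=> a b e; apply: x_inj; rewrite !xI /= e.
apply/eqP; apply: contraT => nz.
have c0 : count_ge [set Ordinal (lt a) | a in [set: 'I_k]] (size zs1) = 0.
  apply/eqP; rewrite cards_eq0; apply/eqP/setP => l; rewrite !inE.
  apply/negbTE/negP => /andP[/imsetP[a _ ->] /=].
  by rewrite leqNgt index_mem Xs // codom_f.
have := family_vanish hkn family_top family_step gy injI xI clam nz (size zs1).
by rewrite c0 (count_geS lam (Ordinal lti)) inE /= nth_cat sz1 ltnn subnn.
Qed.

(** At the lowest fixed point triangularity leaves only the frame [bot] of the empty diagram, for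
    which the product of [family_diag] is empty. *)
Lemma groth_bits_base s zs1 zs2 :
  size s = (size zs1 + size zs2)%N -> perm_eq (zs1 ++ zs2) Y -> codom x =i zs1 ->
  groth_bits s (zs1 ++ zs2) = (s == nseq (size zs1) true ++ nseq (size zs2) false)%:R.
Proof.
move=> ssz pY Xs; have gy := nth_generic pY.
have szn : (size zs1 + size zs2)%N = n by rewrite -Y_size -(perm_size pY) size_cat.
have uz : uniq zs1 by move: Y_uniq; rewrite -(perm_uniq pY) cat_uniq => /andP[].
have szk : size zs1 = k.
  rewrite -(card_ord k) -(size_codom x); apply/eqP/esym; rewrite eqn_leq.
  have ux : uniq (codom x) by exact/injectiveP.
  by rewrite !uniq_leq_size // => z; rewrite Xs.
have lt a : (index (x a) zs1 < n)%N.
  by rewrite -szn (leq_trans _ (leq_addr _ _)) // index_mem -Xs codom_f.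
set y := fun l : 'I_n => nth 0 (zs1 ++ zs2) l.
have xI : x =1 y \o (fun a => Ordinal (lt a)).
  by move=> a; rewrite /= /y nth_cat index_mem -Xs ?codom_f // nth_index // -Xs codom_f.
have injI : injective (fun a => Ordinal (lt a)).
  by move=> a b e; apply: x_inj; rewrite !xI /= e.
set I := (fun a => Ordinal (lt a)) in xI injI.
pose bot : {set 'I_n} := [set l : 'I_n | (l < k)%N].
have cbot : #|bot| = k by exact: card_ord_lt.
have Ibot : I @: setT = bot.
  apply/eqP; rewrite eqEcard card_imset // cardsT card_ord cbot leqnn andbT.
  by apply/subsetP => _ /imsetP[a _ ->]; rewrite inE /= -szk index_mem -Xs codom_f.
have nthE (l : 'I_n) : nth false (nseq (size zs1) true ++ nseq (size zs2) false) l = (l < k)%N.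
  by rewrite nth_cat size_nseq !nth_nseq szk; case: ltnP => //; case: ifP.
rewrite /groth_bits; set lam := bits_frame s.
have [es|ns] := eqVneq s _.
  have -> : lam = bot by apply/setP => l; rewrite !inE es nthE.
  rewrite cbot eqxx.
  have := @family_diag F k n x Gr hkn family_top family_step bot y I gy injI xI Ibot cbot.
  rewrite /Gr -/y => ->.
  rewrite big_pred0 // => -[a b] /=; rewrite !inE -leqNgt.
  by apply/negbTE/negP => /and3P[ak kb ba]; have := leq_trans ak (leq_trans kb (ltnW ba)); rewrite ltnn.
case: eqP => // clam; apply/eqP; apply: contraNT ns => nz.
have := family_vanish hkn family_top family_step gy injI xI clam nz k.
have cb : count_ge bot k = 0.
  rewrite /count_ge (_ : [set l in _ | _] = set0) ?cards0 //.
  by apply/setP => l; rewrite !inE; case: ltnP; rewrite ?andbF.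
rewrite Ibot cb leqn0 /count_ge cards_eq0 => /eqP c0.
have slam : lam \subset bot.
  apply/subsetP => l ll; rewrite inE ltnNge; apply/negP => kl.
  by have : l \in set0; [rewrite -c0 inE; apply/andP | rewrite inE].
have elam : lam = bot by apply/eqP; rewrite eqEcard slam cbot clam leqnn.
apply/eqP; apply: (@eq_from_nth _ false) => [|l]; first by rewrite size_cat !size_nseq.
rewrite ssz szn => ln; rewrite (nthE (Ordinal ln)).
by have /setP/(_ (Ordinal ln)) := elam; rewrite !inE.
Qed.

End ListForm.

Section FixedPoint.
Variables (F : fieldType) (k n : nat) (x : 'I_k -> F) (y : 'I_n -> F).
Hypotheses (hkn : (k <= n)%N) (gy : generic y) (x_inj : injective x).
Hypothesis xy : forall a, exists j, x a = y j.

Lemma puzzle_product_at_point (lam mu : {set 'I_n}) : #|lam| = k -> #|mu| = k ->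
  \sum_(nu : {set 'I_n} | #|nu| == k)
    puzzle_sum y lam mu nu * groth_value nu x (y \o @rev_ord n)
  = groth_value lam x y * groth_value mu x (y \o @rev_ord n).
Proof.
move=> clam cmu; have [y_inj y0] := gy.
have x0 a : x a != 0 by have [j ->] := xy a.
pose Y := [seq y q | q <- enum 'I_n].
have szY : size Y = n by rewrite size_map size_enum_ord.
have uY : uniq Y by rewrite map_inj_uniq // enum_uniq.
have Y0 : all (fun z => z != 0) Y by apply/allP => _ /mapP[q _ ->].
have XY : {subset codom x <= Y}.
  by move=> _ /codomP[a ->]; have [j ->] := xy a; rewrite map_f ?mem_enum.
have frameE (A : {set 'I_n}) : bits_frame n [seq q \in A | q <- enum 'I_n] = A.
  by apply/setP => q; rewrite inE (nth_map q) ?size_enum_ord // nth_ord_enum.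
have revE (T : Type) (f : 'I_n -> T) :
    rev [seq f (rev_ord q) | q <- enum 'I_n] = [seq f q | q <- enum 'I_n].
  have -> : [seq f (rev_ord q) | q <- enum 'I_n] = rev [seq f q | q <- enum 'I_n].
    rewrite -map_rev (_ : rev _ = map (@rev_ord n) (enum 'I_n)) -?map_comp //.
    apply: (inj_map val_inj); rewrite map_rev val_enum_ord.
    transitivity [seq (n - i.+1)%N | i <- [seq val q | q <- enum 'I_n]]; last by rewrite -!map_comp.
    rewrite val_enum_ord.
    apply: (@eq_from_nth _ 0%N) => [|i]; rewrite ?size_rev size_iota ?size_map ?size_iota // => lt.
    rewrite nth_rev ?size_iota // (nth_map 0%N) ?size_iota // !nth_iota ?add0n //.
    by rewrite ltn_subrL (leq_ltn_trans _ lt).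
  by rewrite revK.
have fnY : (fun j : 'I_n => nth 0 Y j) = y.
  by apply: functional_extensionality => q; rewrite (nth_map q) ?size_enum_ord // nth_ord_enum.
have fnY' : (fun j : 'I_n => nth 0 (rev Y) j) = y \o @rev_ord n.
  apply: functional_extensionality => q; have -> : rev Y = [seq (y \o @rev_ord n) q | q <- enum 'I_n].
    by rewrite -revE; congr rev; apply: eq_map => r; rewrite /= rev_ordK.
  by rewrite (nth_map q) ?size_enum_ord // nth_ord_enum.
have := product_identity_perm Y0
  (groth_bits_exchange hkn x0 uY Y0 szY) (groth_bits_vanish hkn x_inj x0 uY Y0 szY)
  (groth_bits_base hkn x_inj x0 uY Y0 szY) XY (perm_refl Y).
have szm (f : 'I_n -> bool) : size [seq f q | q <- enum 'I_n] = size Y by rewrite szY size_map size_enum_ord.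
move=> /(_ _ _ (szm (fun q => rev_ord q \in mu)) (szm (mem lam))).
rewrite szY bsum_ffun revE /groth_bits !frameE clam cmu !eqxx fnY fnY' => <-.
(* Left words run from bottom to top and [nu] from top to bottom, hence [rev_ord]; words of the
   wrong weight contribute zero. *)
pose h (nu : {set 'I_n}) := [ffun q => rev_ord q \in nu].
rewrite (reindex h) /=; last first.
  exists (fun f : {ffun 'I_n -> bool} => [set q | f (rev_ord q)]) => [nu _|f _].
    by apply/setP => q; rewrite inE ffunE rev_ordK.
  by apply/ffunP => q; rewrite ffunE inE rev_ordK.
rewrite big_mkcond; apply: eq_bigr => nu _.
have -> : [seq h nu q | q <- enum 'I_n] = [seq rev_ord q \in nu | q <- enum 'I_n].
  by apply: eq_map => q; rewrite ffunE.
rewrite revE frameE puzzle_sum_triangle -map_comp /=.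
by case: eqP => // _; rewrite mulr0.
Qed.

End FixedPoint.

(** * Uniqueness of the coefficients *)

Lemma increasing_enum k n (J : {set 'I_n}) : #|J| = k ->
  exists i : 'I_k -> 'I_n, (forall a b : 'I_k, (a < b)%N -> (i a < i b)%N) /\ i @: setT = J.
Proof.
move=> cJ.
have sz : size (enum J) = k by rewrite -cardE.
case: k => [|k] in cJ sz *.
  have i0 : 'I_0 -> 'I_n by case.
  exists i0.
  split=> [[]//|]; apply/eqP; rewrite eqEcard cJ leq0n andbT.
  by apply/subsetP => l /imsetP[a]; case: a.
have /card_gt0P[j0 _] : (0 < #|J|)%N by rewrite cJ.
exists (fun a => nth j0 (enum J) a); split=> [a b ab|].
  have srt : sorted ltn (map val (enum J)).
    rewrite /enum_mem /= -enumT; apply: (subseq_sorted ltn_trans _ (iota_ltn_sorted 0 n)).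
    by rewrite -val_enum_ord map_subseq // filter_subseq.
  have := sorted_ltn_nth ltn_trans 0%N srt.
  move=> /(_ a b); rewrite !inE !size_map sz !ltn_ord => /(_ isT isT ab).
  by rewrite !(nth_map j0) ?sz ?ltn_ord.
apply/setP => j; apply/imsetP/idP => [[a _ ->]|jJ].
  by rewrite -mem_enum mem_nth // sz.
have lt : (index j (enum J) < k.+1)%N by rewrite -sz index_mem mem_enum.
by exists (Ordinal lt); rewrite //= nth_index // mem_enum.
Qed.

Lemma increasing_inj k n (i : 'I_k -> 'I_n) :
  (forall a b : 'I_k, (a < b)%N -> (i a < i b)%N) -> injective i.
Proof.
move=> inc a b e; apply: val_inj; case: (ltngtP a b) => // /inc.
all: by rewrite e ltnn.
Qed.

Section Independence.
Variables (F : fieldType) (k n : nat).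
Hypothesis hkn : (k <= n)%N.

Lemma groth_value_perm (x : 'I_k -> F) (s : 'S_k) (lam : {set 'I_n}) y :
  (forall a, x a != 0) -> generic y -> #|lam| = k ->
  groth_value lam (x \o s) y = groth_value lam x y.
Proof.
move=> x0 gy clam; move: y gy.
have xs0 a : (x \o s) a != 0 by exact: x0.
move: lam clam; apply: (frame_ind hkn) => [|lam i j clam e jl il IH] y gy.
  rewrite !groth_value_top //; try exact: gy.2.
  by rewrite [RHS](reindex_inj (@perm_inj _ s)).
have yij : y i != y j by rewrite (inj_eq gy.1); apply: contraNneq il => ->.
rewrite !groth_value_step //; try exact: gy.2.
by rewrite !IH //; exact: generic_tperm.
Qed.

(** A triangular system with nonzero diagonal. The rank [w] is strictly increasing for the order of
    [family_vanish], which turns triangularity into an induction. *)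
Lemma groth_value_independent (c : {set 'I_n} -> F) (y : 'I_n -> F) : generic y ->
  (forall i : 'I_k -> 'I_n, (forall a b : 'I_k, (a < b)%N -> (i a < i b)%N) ->
     \sum_(nu : {set 'I_n} | #|nu| == k)
        c nu * groth_value nu (y \o i) (y \o @rev_ord n) = 0) ->
  forall nu : {set 'I_n}, #|nu| = k -> c nu = 0.
Proof.
move=> gy c0 nu; pose w (A : {set 'I_n}) := (\sum_(t < n) count_ge A t)%N.
suff gen m (A : {set 'I_n}) : (w A < m)%N -> #|A| = k -> c A = 0 by exact: gen (leqnn _).
elim: m A => // m IH A wA cA.
(* The parameters are reversed, so the fixed point that is diagonal for [A] is indexed by the
   reversal of [A]. *)
have cJ : #|@rev_ord n @: A| = k by rewrite card_imset //; exact: rev_ord_inj.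
have [i [inc iJ]] := increasing_enum cJ.
pose z := y \o @rev_ord n.
have gz : generic z by split=> [a b /gy.1/rev_ord_inj|j] //; exact: gy.2.
have inj : injective (@rev_ord n \o i) by move=> a b /rev_ord_inj/(increasing_inj inc).
have xz : y \o i =1 z \o (@rev_ord n \o i) by move=> a; rewrite /= /z /= rev_ordK.
have im : (@rev_ord n \o i) @: setT = A.
  by rewrite imset_comp iJ -imset_comp (eq_imset (g := id)) ?imset_id // => l; exact: rev_ordK.
have x0 a : (y \o i) a != 0 by exact: gy.2.
have family_top := groth_value_generic_top (n := n) x0.
have family_step := groth_value_generic_step (n := n) x0.
have := c0 i inc; rewrite (bigD1 A) /=; last by rewrite cA.
rewrite big1 ?addr0 => [/eqP|B /andP[/eqP cB BA]].
  rewrite mulf_eq0 => /orP[/eqP //|]; rewrite -/z.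
  rewrite (family_diag (Gr := fun lam y' => groth_value lam (y \o i) y') hkn family_top family_step gz inj xz im cA).
  rewrite prodf_seq_eq0 => /hasP[[l l'] _ /= /andP[/and3P[lA l'A _]]].
  rewrite subr_eq0 => /eqP e1; case/negP: l'A.
  have zl' := gz.2 l'.
  have : z l = z l' by rewrite -[z l](divfK zl') -e1 mul1r.
  by move=> /gz.1 <-.
have [M0|Mn0] := eqVneq (groth_value B (y \o i) z) 0; first by rewrite M0 mulr0.
have le := family_vanish (Gr := fun lam y' => groth_value lam (y \o i) y') hkn family_top family_step gz inj xz cB Mn0.
rewrite im in le.
rewrite (IH B) ?mul0r //; rewrite ltnS in wA; apply: leq_trans wA.
have [leW eqW] : (w B <= w A ?= iff [forall t : 'I_n, count_ge B t == count_ge A t])%N.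
  by apply: leqif_sum => t _; exact: leqif_eq.
rewrite ltn_neqAle leW andbT eqW; apply: contra BA => /forallP eqt.
apply/eqP/count_ge_inj => t; have [tn|nt] := ltnP t n; first exact/eqP/(eqt (Ordinal tn)).
by rewrite !count_ge_out.
Qed.

End Independence.

(** * From fixed points to the quotient ring *)

Section Final.
Variables k n : nat.
Hypothesis hkn : (k <= n)%N.
Local Notation K := (ratfun k n).
Local Notation x := (@xvar k n).
Local Notation y := (@yvar k n).
Local Notation LA := (laurent (@ratvar (k + n))).
Implicit Types (f g : K) (lam mu nu : {set 'I_n}).

Lemma yvar_generic : generic y.
Proof. by split=> [|j]; [exact: yvar_inj | exact: ratvar_neq0]. Qed.

Lemma point_var : point x y = @ratvar (k + n).
Proof.
apply: functional_extensionality => v; rewrite /point.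
by case: splitP => l e; congr ratvar; apply: val_inj.
Qed.

(** Reversal of the [y] variables as a permutation of all [k + n] variables, the form of
    substitution that [rateval_comp] handles. *)
Definition rev_block (v : 'I_(k + n)) : 'I_(k + n) :=
  match split v with inl a => lshift n a | inr j => rshift k (rev_ord j) end.

Lemma rev_block_x a : rev_block (lshift n a) = lshift n a.
Proof. by rewrite /rev_block -[lshift n a]/(unsplit (inl a)) unsplitK. Qed.

Lemma rev_block_y j : rev_block (rshift k j) = rshift k (rev_ord j).
Proof. by rewrite /rev_block -[rshift k j]/(unsplit (inr j)) unsplitK. Qed.

Lemma rev_block_inj : injective rev_block.
Proof.
apply: (can_inj (g := rev_block)) => v; case: (split_ordP v) => l ->.
  by rewrite !rev_block_x.
by rewrite !rev_block_y rev_ordK.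
Qed.

Lemma point_rev (x' : 'I_k -> K) (y' : 'I_n -> K) :
  point x' (y' \o @rev_ord n) = point x' y' \o perm rev_block_inj.
Proof.
apply: functional_extensionality => v /=; rewrite permE.
case: (split_ordP v) => l ->; first by rewrite rev_block_x !point_x.
by rewrite rev_block_y !point_y.
Qed.

Lemma yrevE f : yrev f = rateval (@ratvar (k + n) \o perm rev_block_inj) f.
Proof. by rewrite -point_var -point_rev. Qed.

Lemma laurent_yrev f : LA f -> LA (yrev f).
Proof. by rewrite yrevE; exact: rateval_perm. Qed.

Lemma rateval_yrev (x' : 'I_k -> K) (y' : 'I_n -> K) f :
  (forall a, x' a != 0) -> (forall j, y' j != 0) -> LA f ->
  rateval (point x' y') (yrev f) = rateval (point x' (y' \o @rev_ord n)) f.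
Proof.
move=> x0 y0 lf; rewrite yrevE point_rev rateval_comp //; exact: point_neq0.
Qed.

Lemma laurentX (f : K) e : LA f -> LA (f ^+ e).
Proof.
move=> lf; elim: e => [|e IH]; first by rewrite expr0; exact: (laurent_const _ 1).
by rewrite exprS; exact: laurentM.
Qed.

Lemma laurent_y_laurent f : laurent y f -> LA f.
Proof.
move=> [p [e ->]]; apply: laurentM.
  have -> : polyeval y p = polyeval (@ratvar (k + n)) (mmap (@mpolyC (k + n) int) (fun i => 'X_(rshift k i)) p).
    by rewrite polyeval_rename.
  exact: laurent_poly.
rewrite -prodfV; apply: laurent_prod => i _; rewrite -exprVn; apply: laurentX; exact: laurent_varV.
Qed.

Lemma rateval_laurent_y (x' : 'I_k -> K) f : laurent y f -> rateval (point x' y) f = f.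
Proof.
move=> /laurentE[p [e ef]].
have y0 : polyeval y 'X_[e] != 0.
  by rewrite polyevalX; apply: monomial_neq0 => j; exact: ratvar_neq0.
pose q p := mmap (@mpolyC (k + n) int) (fun i : 'I_n => 'X_(rshift k i)) p.
have qE p' : polyeval y p' = FracField.tofrac (q p') :> K.
  by rewrite -polyeval_id polyeval_rename.
have qv p' : polyeval (point x' y) (q p') = polyeval y p'.
  rewrite polyeval_rename; congr (mmap _ _ _).
  by apply: functional_extensionality => j /=; rewrite point_y.
by rewrite {1}ef !qE rateval_frac !qv.
Qed.

Section Values.
Variable x' : 'I_k -> K.
Hypothesis x'0 : forall a, x' a != 0.

Let p0 : forall v, point x' y v != 0.
Proof. by apply: point_neq0 => //; exact: yvar_generic.2. Qed.

Lemma rateval_product lam mu :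
  rateval (point x' y) (groth k lam * yrev (groth k mu))
  = groth_value lam x' y * groth_value mu x' (y \o @rev_ord n).
Proof.
have r1 := laurent_regular p0 (laurent_groth k lam).
have r2 := laurent_regular p0 (laurent_yrev (laurent_groth k mu)).
rewrite (regularM_rateval r1 r2).2 (rateval_yrev x'0 yvar_generic.2 (laurent_groth k mu)).
exact: erefl.
Qed.

Variable d : {set 'I_n} -> K.
Hypothesis hd : forall nu : {set 'I_n}, #|nu| = k -> laurent y (d nu).

Lemma laurent_expansion nu : #|nu| == k -> LA (d nu * yrev (groth k nu)).
Proof.
move=> /eqP cnu; apply: laurentM; first exact: laurent_y_laurent (hd cnu).
exact: laurent_yrev (laurent_groth k nu).
Qed.

Lemma rateval_expansion :
  rateval (point x' y) (\sum_(nu : {set 'I_n} | #|nu| == k) d nu * yrev (groth k nu))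
  = \sum_(nu : {set 'I_n} | #|nu| == k) d nu * groth_value nu x' (y \o @rev_ord n).
Proof.
have [_ ->] := regular_sum_rateval (index_enum {set 'I_n})
  (fun nu (cnu : #|nu| == k) => laurent_regular p0 (laurent_expansion cnu)).
apply: eq_bigr => nu /eqP cnu.
have r1 := laurent_regular p0 (laurent_y_laurent (hd cnu)).
have r2 := laurent_regular p0 (laurent_yrev (laurent_groth k nu)).
rewrite (regularM_rateval r1 r2).2 (rateval_yrev x'0 yvar_generic.2 (laurent_groth k nu)).
by rewrite rateval_laurent_y //; exact: hd.
Qed.

End Values.

Lemma substE (x' : 'I_k -> K) (y' : 'I_n -> K) f : subst x' y' f = rateval (point x' y') f.
Proof. exact: erefl. Qed.

Lemma subst_id f : subst x y f = f.
Proof. by rewrite substE point_var rateval_id. Qed.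

Lemma xvar_neq0 (a : 'I_k) : x a != 0.
Proof. exact: ratvar_neq0. Qed.

Lemma rev_generic : generic (y \o @rev_ord n).
Proof.
have [y_inj y0] := yvar_generic.
by split=> [a b /y_inj/rev_ord_inj|j] //=; exact: y0.
Qed.

Lemma KT_ring_product lam mu : #|lam| = k -> #|mu| = k ->
  KT_ring (groth k lam * yrev (groth k mu)).
Proof.
move=> clam cmu; split.
  by apply: laurentM; [exact: laurent_groth | exact: laurent_yrev (laurent_groth k mu)].
move=> s; rewrite -[RHS]subst_id !substE.
have xs0 a : (x \o s) a != 0 by exact: xvar_neq0.
rewrite (rateval_product xvar_neq0) (rateval_product xs0).
rewrite (groth_value_perm hkn s xvar_neq0 yvar_generic clam).
by rewrite (groth_value_perm hkn s xvar_neq0 rev_generic cmu).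
Qed.

Lemma KT_ring_expansion (d : {set 'I_n} -> K) :
  (forall nu : {set 'I_n}, #|nu| = k -> laurent y (d nu)) ->
  KT_ring (\sum_(nu : {set 'I_n} | #|nu| == k) d nu * yrev (groth k nu)).
Proof.
move=> hd; split.
  apply: laurent_sum; first exact: ratvar_neq0.
  by move=> nu; exact: laurent_expansion.
move=> s; rewrite -[RHS]subst_id !substE.
have xs0 a : (x \o s) a != 0 by exact: xvar_neq0.
rewrite (rateval_expansion xvar_neq0 hd) (rateval_expansion xs0 hd).
apply: eq_bigr => nu /eqP cnu.
by rewrite (groth_value_perm hkn s xvar_neq0 rev_generic cnu).
Qed.

Lemma subst_laurentB (x' : 'I_k -> K) f g : (forall a, x' a != 0) -> LA f -> LA g ->
  subst x' y (f - g) = subst x' y f - subst x' y g.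
Proof.
move=> x'0 lf lg; have p0 := point_neq0 x'0 yvar_generic.2.
exact: (regularB_rateval (laurent_regular p0 lf) (laurent_regular p0 lg)).2.
Qed.

Lemma KT_eqP f g : KT_ring f -> KT_ring g ->
  KT_eq f g <-> forall i : 'I_k -> 'I_n, (forall a b : 'I_k, (a < b)%N -> (i a < i b)%N) ->
    subst (y \o i) y f = subst (y \o i) y g.
Proof.
move=> rf rg; have [lf sf] := rf; have [lg sg] := rg.
have yi0 (i : 'I_k -> 'I_n) a : (y \o i) a != 0 by exact: yvar_generic.2.
split=> [[_ _ [_ h]] i inc|h].
  apply/eqP; rewrite -subr_eq0 -(subst_laurentB (yi0 i) lf lg); apply/eqP; exact: h.
split; [exact: rf | exact: rg |]; split; last first.
  by move=> i inc; rewrite (subst_laurentB (yi0 i) lf lg) h // subrr.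
split; first by apply: laurentB; [exact: ratvar_neq0 | exact: lf | exact: lg].
move=> s; rewrite (subst_laurentB (x' := fun a => x (s a)) _ lf lg); last by move=> a; exact: xvar_neq0.
by rewrite sf sg.
Qed.

End Final.

Theorem theorem3 (k n : nat) (hkn : (k <= n)%N) (hn : (1 <= n)%N)
    (lam mu : {set 'I_n}) (hlam : #|lam| = k) (hmu : #|mu| = k)
    (d : {set 'I_n} -> ratfun k n)
    (hd : forall nu : {set 'I_n}, #|nu| = k -> laurent (@yvar k n) (d nu)) :
  KT_eq (groth k lam * yrev (groth k mu))
        (\sum_(nu : {set 'I_n} | #|nu| == k) d nu * yrev (groth k nu))
  <->
  forall nu : {set 'I_n}, #|nu| = k ->
    d nu = puzzle_sum (@yvar k n) lam mu nu.
Proof.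
have ring_l := KT_ring_product hkn hlam hmu; have ring_r := KT_ring_expansion hkn hd.
apply: iff_trans (KT_eqP ring_l ring_r) _.
have gy : generic (@yvar k n) by exact: yvar_generic.
have yi0 (i : 'I_k -> 'I_n) a : (@yvar k n \o i) a != 0 by exact: gy.2.
have puzzle (i : 'I_k -> 'I_n) : (forall a b : 'I_k, (a < b)%N -> (i a < i b)%N) ->
    groth_value lam (@yvar k n \o i) (@yvar k n)
      * groth_value mu (@yvar k n \o i) (@yvar k n \o @rev_ord n)
    = \sum_(nu : {set 'I_n} | #|nu| == k) puzzle_sum (@yvar k n) lam mu nu
        * groth_value nu (@yvar k n \o i) (@yvar k n \o @rev_ord n).
  move=> inc; symmetry; apply: puzzle_product_at_point => //.
    by move=> a b /gy.1/(increasing_inj inc).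
  by move=> a; exists (i a).
split=> [eq_at nu cnu|d_puzzle i inc]; last first.
  rewrite !substE (rateval_product (yi0 i)) (rateval_expansion (yi0 i) hd) (puzzle i inc).
  by apply: eq_bigr => nu /eqP cnu; rewrite d_puzzle.
apply/eqP; rewrite -subr_eq0; apply/eqP.
(* The puzzle sums solve the same linear system as [d] at the fixed points, so the differences solve
   the homogeneous one. *)
apply: (groth_value_independent hkn (c := fun nu => d nu - puzzle_sum (@yvar k n) lam mu nu) gy _ cnu).
move=> i inc; have := eq_at i inc.
rewrite !substE (rateval_product (yi0 i)) (rateval_expansion (yi0 i) hd) (puzzle i inc) => e.
under eq_bigr => nu' _ do rewrite mulrBl.
by rewrite sumrB -e subrr.
Qed.
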